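(* Let $$S:=\{\,n\in\mathbb{N} : 2x^2+3y^2+4z^2=8n+9 \text{ has a solution } (x,y,z)\in\mathbb{Z}^3\,\}.$$ Then a sum of triangular numbers $f$ represents every element of $S$ if and only if $f$ represents the integers $$2,\,3,\,4,\,5,\,10,\,16,\,17,\,19,\,89.$$
   Context: For an integer $x\ge 0$, $T_x:=\frac{x(x+1)}{2}$ is the $x$-th triangular number (with $T_0=0$ included). A sum of triangular numbers is a form $f(x)=\sum_{i=1}^k b_iT_{x_i}$, where $k\ge 1$ and $b_1\le\dots\le b_k$ are positive integers. $f$ represents an integer $n$ if $n=\sum_{i=1}^k b_iT_{x_i}$ for some nonnegative integers $x_1,\dots,x_k$. $\mathbb{N}$ denotes the positive integers. The theorem is unconditional (no Riemann hypothesis is assumed). *)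

(* Defs.v *)
From mathcomp Require Import all_boot all_order all_algebra.

Set Implicit Arguments.
Unset Strict Implicit.
Unset Printing Implicit Defensive.

Import GRing.Theory.

Definition triangular (x : nat) : nat := (x * x.+1) %/ 2.

(* A sum of triangular numbers sum_i b_i T_{x_i} is given by its tuple of
   coefficients b. *)
Definition is_triangular_sum (k : nat) (b : k.-tuple nat) : Prop :=
  [/\ 0 < k, forall i : 'I_k, 0 < tnth b i
    & forall i j : 'I_k, i <= j -> tnth b i <= tnth b j].

Definition represents (k : nat) (b : k.-tuple nat) (n : nat) : Prop :=
  exists x : 'I_k -> nat, n = \sum_(i < k) tnth b i * triangular (x i).

Definition in_S (n : nat) : Prop :=
  0 < n /\
  exists x y z : int,
    (2 * x ^+ 2 + 3 * y ^+ 2 + 4 * z ^+ 2 = 8 * n%:Z + 9 :> int)%R.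

(* Main.v *)
Require Import Defs.
From mathcomp Require Import all_boot all_order all_algebra.
From mathcomp Require Import all_fingroup all_solvable all_field.
From mathcomp Require Import reals sequences exp Rstruct.
From mathcomp Require Import ring lra zify.

(* The set S consists of the positive integers represented by (2, 3, 4).  Escalating
   on the listed integers, a form representing all of them contains (2, 3, 4), one of
   the ternaries (1,1,1), (1,1,2), (1,1,4), (1,1,5), (1,2,2), (1,2,3), (1,2,4), which
   represent every n, or an extension of (1,1,3) or (2,2,3), which represent n up to an
   obstruction at 3.  Completing squares, the former reduce to the three-square theorem
   and the latter to x^2 + y^2 + 3 z^2.

   Both ternary theorems are proved by finding a rational solution m w^2 = z^2 + q u^2
   (Legendre), where q is 1, 2 or 3 times an auxiliary prime r that is itself a value of
   a binary form, and by then descending to integers (Davenport-Cassels).  The prime r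
   has to have prescribed Legendre symbols (r/p) at the primes p dividing m; only real
   characters intervene, so its existence follows from the nonvanishing of L(1, chi) for
   real chi and Mertens-type estimates, without Dirichlet's theorem in general. *)

Set Implicit Arguments.
Unset Strict Implicit.
Unset Printing Implicit Defensive.

Import Order.TTheory GRing.Theory Num.Theory.
Local Open Scope ring_scope.

(** * Legendre symbols and quadratic reciprocity *)

(** The nine integers are where the escalation gets stuck: 2, 3, 4, 5 lead to a ternary form, 17 and
    10 force a fourth coefficient next to (1,1,3) and (2,2,3), 89 and 19 force a fifth one next to
    (1,1,3,12) and (2,2,3,3), and 16 is a value that (2,2,3,6) misses. The extensions may still miss
    8 or 1, which is harmless because neither lies in S. Infinite chains of possible exceptions come
    from [T (3 * x + 1) = 9 * T x + 1]: if n is represented by a form with coefficient sum s, so is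
    9 n + s, and 8 n + s gets multiplied by 9. For s = 17 the chain is 8, 89, ...; for s = 10 it is
    1, 19, .... Subtracting a fifth coefficient cannot lead from one large member of a chain to
    another. The descent to integers needs a lattice point at which the form, evaluated on the
    difference, is below 1. For x^2 + y^2 + 3 z^2 rounding only gives 5/4, so the descent runs on
    x^2 + y^2 + y z + z^2 instead. *)

Lemma sum_mulmod (V : nmodType) (M g : nat) (f : nat -> V) : (0 < M)%N -> coprime M g ->
  \sum_(i < M) f (g * i %% M)%N = \sum_(i < M) f i.
Proof.
move=> M0 cg.
pose h (i : 'I_M) : 'I_M := Ordinal (ltn_pmod (g * i) M0).
have hinj : injective h.
  suff hle (i j : 'I_M) : (i <= j)%N -> h i = h j -> i = j.
    move=> i j; case: (leqP i j) => [/hle//|/ltnW ji e].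
    by apply/esym/hle.
  move=> ij /(congr1 val)/= /esym/eqP.
  rewrite eqn_mod_dvd ?leq_mul2l ?ij ?orbT // -mulnBr Gauss_dvdr // => d.
  apply/ord_inj/eqP; rewrite eqn_leq ij /= leqNgt; apply/negP => h0.
  have h1 : (0 < j - i)%N by rewrite subn_gt0.
  have h2 := dvdn_leq h1 d; have h3 := ltn_ord j; lia.
by rewrite [RHS](reindex_inj hinj).
Qed.

Lemma finField_generator (F : finFieldType) : exists g : F,
  (forall x, x != 0 -> exists k, x = g ^+ k) /\
  (forall m, (g ^+ m == 1) = (#|F|.-1 %| m)%N).
Proof.
have /cyclicP[u uE] := field_unit_group_cyclic [set: {unit F}].
exists (val u); split=> [x x0|m].
  have xU : x \is a GRing.unit by rewrite unitfE.
  have : (Sub x xU : {unit F}) \in <[u]>%g by rewrite -uE inE.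
  by case/cycleP => k /(congr1 val) /= e; exists k; rewrite -FinRing.val_unitX.
rewrite -FinRing.val_unitX -card_finField_unit uE -/(order u) order_dvdn.
by apply/eqP/eqP => [e|->//]; apply: val_inj.
Qed.

Lemma finField_root_of_unity (p k n : nat) : prime p -> (0 < k)%N -> (n %| (p ^ k).-1)%N ->
  exists2 F : finFieldType, p \in [pchar F] & exists z : F, forall m, (z ^+ m == 1) = (n %| m)%N.
Proof.
move=> pp k0 nd; have [F pF cF] := pPrimePowerField pp k0.
exists F => //; have [g [_ gE]] := finField_generator F.
exists (g ^+ ((p ^ k).-1 %/ n)) => m; rewrite -exprM gE cF.
rewrite -{1}(divnK nd) dvdn_pmul2l // divn_gt0; last first.
  by apply: dvdn_gt0 nd; rewrite -subn1 subn_gt0 -(expn0 p) ltn_exp2l ?prime_gt1.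
by apply: dvdn_leq nd; rewrite -subn1 subn_gt0 -(expn0 p) ltn_exp2l ?prime_gt1.
Qed.

(** Euler's criterion is taken as the definition, so multiplicativity becomes a computation in
    characteristic [p]; that the value 1 yields a square root is then a theorem, [legendre_sqrt]. *)
Definition legendre (p a : nat) : int :=
  if (p %| a)%N then 0 else if a ^ p.-1./2 == 1 %[mod p] then 1 else -1.

Lemma legendreV p a : [\/ legendre p a = 0, legendre p a = 1 | legendre p a = -1].
Proof.
by rewrite /legendre; do 2?case: ifP => _; [constructor 1|constructor 2|constructor 3].
Qed.

Lemma legendre_eq0 p a : (legendre p a == 0) = (p %| a)%N.
Proof. by rewrite /legendre; do 2?case: ifP. Qed.

Lemma odd_pred_half p : odd p -> (p.-1 = 2 * p.-1./2)%N.
Proof. by case: p => // p /= op; rewrite mul2n even_halfK. Qed.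

Section Legendre.
Variable p : nat.
Hypotheses (pp : prime p) (op : odd p).

Let p2 : (2 < p)%N.
Proof. by case: p pp op => [|[|[|]]]. Qed.

Lemma two_neq0_pchar (F : fieldType) : p \in [pchar F] -> 2%:R != 0 :> F.
Proof.
move=> pF; rewrite -(dvdn_pcharf pF); apply/negP => /dvdn_leq; lia.
Qed.

(** Since 0, 1 and -1 stay distinct in odd characteristic, an identity between Legendre symbols may
    be checked in any field of characteristic [p], in particular in one containing the roots of
    unity that Gauss sums need. *)
Lemma sign_inj (F : fieldType) (u v : int) : p \in [pchar F] ->
  [\/ u = 0, u = 1 | u = -1] -> [\/ v = 0, v = 1 | v = -1] -> u%:~R = v%:~R :> F -> u = v.
Proof.
move=> pF; have n2 := two_neq0_pchar pF; have n1 := oner_neq0 F.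
have n11 : (1 : F) <> -1.
  by move=> /eqP; rewrite -subr_eq0 opprK -[1 + 1]/(2%:R) (negPf n2).
have m1 : (-1 : F) != 0 by rewrite oppr_eq0.
case=> -> [] -> //; rewrite ?mulrN1z ?mulr1z ?mulr0z => e; exfalso.
- by rewrite -e eqxx in n1.
- by rewrite -e eqxx in m1.
- by rewrite e eqxx in n1.
- by rewrite e eqxx in m1.
- by apply: n11; rewrite e.
Qed.

Lemma euler_criterion (F : fieldType) (a : nat) : p \in [pchar F] ->
  (legendre p a)%:~R = a%:R ^+ p.-1./2 :> F.
Proof.
move=> pF; rewrite /legendre.
have eqF (b c : nat) : (b == c %[mod p]) = (b%:R == c%:R :> F).
  suff le (b' c' : nat) : (b' <= c')%N -> (c' == b' %[mod p]) = (c'%:R == b'%:R :> F).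
    by case: (leqP b c) => [/le|/ltnW/le//]; rewrite eq_sym => ->; rewrite eq_sym.
  by move=> h; rewrite eqn_mod_dvd // (dvdn_pcharf pF) natrB // subr_eq0.
have [|pa] := boolP (p %| a)%N.
  rewrite (dvdn_pcharf pF) => /eqP->; rewrite expr0n; case: eqP => // h.
  by have := odd_pred_half op; rewrite h; lia.
rewrite eqF natrX; case: eqP => [e|ne]; first by rewrite mulr1z; exact: esym e.
have aF : a%:R != 0 :> F by rewrite -(dvdn_pcharf pF).
have : (a%:R : F) ^+ p.-1 = 1.
  apply: (mulIf aF); rewrite mul1r -exprSr prednK ?prime_gt0 //.
  by rewrite -(pFrobenius_autE pF) pFrobenius_aut_nat.
rewrite {1}(odd_pred_half op) mulnC exprM => /eqP.
by rewrite sqrf_eq1 => /orP[/eqP //|/eqP e]; rewrite mulrN1z e.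
Qed.

Lemma legendreM a b : legendre p (a * b) = legendre p a * legendre p b.
Proof.
have pF := pchar_Fp pp.
apply: (sign_inj pF); first exact: legendreV.
  case: (legendreV p a) => ->; case: (legendreV p b) => ->;
  by rewrite ?(mul0r, mulr0, mulr1, mul1r, mulrNN); constructor.
by rewrite intrM !(euler_criterion _ pF) natrM exprMn.
Qed.

Lemma legendre_mod a : legendre p (a %% p) = legendre p a.
Proof. by rewrite /legendre /dvdn modn_mod modnXm. Qed.

Lemma legendre1 : legendre p 1 = 1.
Proof. by rewrite /legendre dvdn1 gtn_eqF ?prime_gt1 // exp1n eqxx. Qed.

Lemma legendre_sqr a : ~~ (p %| a)%N -> legendre p (a * a) = 1.
Proof.
rewrite -legendre_eq0 legendreM; case: (legendreV p a) => -> //.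
Qed.

(** Write [a] as a power of a generator: by Euler's criterion the exponent times (p - 1)/2 is
    divisible by p - 1, so the exponent is even. *)
Lemma legendre_sqrt a : legendre p a = 1 -> exists b, (b ^ 2 = a %[mod p])%N.
Proof.
move=> la; have pF := pchar_Fp pp.
have a0 : (a%:R : 'F_p) != 0.
  by rewrite -(dvdn_pcharf pF) -legendre_eq0 la.
have [g [gen gE]] := finField_generator 'F_p.
have [k ak] := gen _ a0.
have := euler_criterion a pF; rewrite la mulr1z ak -exprM => /esym/eqP.
rewrite gE card_Fp // {1}(odd_pred_half op) dvdn_pmul2r; last first.
  by have := odd_pred_half op; lia.
case/dvdnP => m km; exists (g ^+ m : 'F_p).
have := natr_Zp (g ^+ m) => h.
have : ((g ^+ m : 'F_p) ^ 2)%:R = a%:R :> 'F_p by rewrite natrX h -exprM -km ak.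
by move/(congr1 val); rewrite /= !val_Fp_nat.
Qed.

Lemma legendre_nonresidue : exists g, legendre p g = -1.
Proof.
have pF := pchar_Fp pp; have [g [_ gE]] := finField_generator 'F_p.
exists (g : nat); case: (legendreV p g) => // e.
  have := gE p.-1; rewrite card_Fp // dvdnn -(natr_Zp g).
  move: e => /eqP; rewrite legendre_eq0 (dvdn_pcharf pF) => /eqP->.
  have hp : (p.-1 == 0)%N = false by lia.
  by rewrite expr0n hp eq_sym oner_eq0.
have := euler_criterion g pF; rewrite e mulr1z natr_Zp => /esym/eqP.
rewrite gE card_Fp // => /dvdn_leq; have := odd_pred_half op; lia.
Qed.

Lemma sum_legendre : \sum_(i < p) legendre p i = 0.
Proof.
have [g hg] := legendre_nonresidue.
have cg : coprime p g by rewrite prime_coprime // -legendre_eq0 hg.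
have : \sum_(i < p) legendre p i = - \sum_(i < p) legendre p i.
  rewrite -[LHS](sum_mulmod _ (prime_gt0 pp) cg) -sumrN; apply: eq_bigr => i _.
  by rewrite legendre_mod legendreM hg mulN1r.
by set s := \sum_(_ < _) _; lia.
Qed.

Lemma legendreN1 : legendre p p.-1 = (-1) ^+ p.-1./2.
Proof.
have pF := pchar_Fp pp.
apply: (sign_inj pF); first exact: legendreV.
  by rewrite -signr_odd; case: odd; [constructor 3|constructor 2].
rewrite euler_criterion // rmorphXn /=; congr (_ ^+ _).
rewrite mulrN1z; apply/eqP; rewrite -addr_eq0 natr1 prednK ?prime_gt0 //.
by rewrite -(dvdn_pcharf pF).
Qed.

Lemma legendreN1_mod4 : legendre p p.-1 = if (p %% 4 == 1)%N then 1 else -1.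
Proof.
rewrite legendreN1 -signr_odd.
have -> : odd p.-1./2 = ~~ (p %% 4 == 1)%N.
  by have := odd_pred_half op; have := modn2 p; rewrite op; lia.
by case: eqP.
Qed.

(* The value [(-2/p)] is read off from the Frobenius action on a square root
   [z + z^3] of [-2], where [z] is an eighth root of unity. *)
Lemma legendreN2 : legendre p (2 * p.-1) = if (p %% 8 \in [:: 1; 3])%N then 1 else -1.
Proof.
have d8 : (8 %| (p ^ 2).-1)%N.
  have : (p ^ 2 = 1 %[mod 8])%N.
    rewrite -modnXm; have : (p %% 8 < 8)%N by rewrite ltn_mod.
    have : odd (p %% 8) by rewrite odd_mod.
    by case: (p %% 8)%N => [|[|[|[|[|[|[|[|]]]]]]]].
  by move/eqP; rewrite eqn_mod_dvd ?expn_gt0 ?prime_gt0 // subn1.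
have [F pF [z zE]] := @finField_root_of_unity p 2 8 pp isT d8.
have z8 : z ^+ 8 = 1 by apply/eqP; rewrite zE.
have z4 : z ^+ 4 = -1.
  have : (z ^+ 4) ^+ 2 == 1 by rewrite -exprM z8.
  by rewrite sqrf_eq1 zE /= => /eqP.
have zm n : z ^+ n = z ^+ (n %% 8).
  by rewrite {1}(divn_eq n 8) exprD mulnC exprM z8 expr1n mul1r.
set t := z + z ^+ 3.
have t2 : t ^+ 2 = (2 * p.-1)%:R.
  have -> : (2 * p.-1)%:R = - 2%:R :> F.
    rewrite natrM -mulrN1; congr (_ * _); apply/eqP.
    by rewrite -addr_eq0 natr1 prednK ?prime_gt0 // -(dvdn_pcharf pF).
  have -> : t ^+ 2 = z ^+ 2 * (1 + z ^+ 4) + 2%:R * z ^+ 4 by rewrite /t; ring.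
  by rewrite z4; ring.
have tp : t ^+ p = (if (p %% 8 \in [:: 1; 3])%N then 1 else -1) * t.
  rewrite -(pFrobenius_autE pF) /t rmorphD /= !pFrobenius_autE -exprM.
  rewrite [z ^+ p]zm [z ^+ (3 * p)]zm.
  have -> : (3 * p %% 8 = 3 * (p %% 8) %% 8)%N by rewrite modnMmr.
  have : (p %% 8 < 8)%N by rewrite ltn_mod.
  have : odd (p %% 8) by rewrite odd_mod.
  have z5 : z ^+ 5 = - z by rewrite exprS z4; ring.
  have z7 : z ^+ 7 = - z ^+ 3 by rewrite (exprD z 3 4) z4; ring.
  by case: (p %% 8)%N => [|[|[|[|[|[|[|[|]]]]]]]] //= _ _;
    rewrite ?z5 ?z7 ?expr1; ring.
have t0 : t != 0.
  rewrite -sqrf_eq0 t2 -(dvdn_pcharf pF) Euclid_dvdM // negb_or.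
  by apply/andP; split; apply/negP => /dvdn_leq; lia.
apply: (sign_inj pF); first exact: legendreV.
  by case: ifP; [constructor 2|constructor 3].
rewrite euler_criterion // -t2 -exprM -(odd_pred_half op); apply: (mulIf t0).
rewrite -exprSr prednK ?prime_gt0 // tp.
by case: ifP; rewrite ?mulr1z ?mulrN1z.
Qed.

End Legendre.

Section Reciprocity.
Variables p r : nat.
Hypotheses (pp : prime p) (op : odd p) (rp : prime r) (orr : odd r) (pr : p != r).

Lemma geom_unity_root (F : fieldType) (z : F) :
  (forall m, (z ^+ m == 1) = (p %| m)%N) -> forall n,
  \sum_(a < p) z ^+ (a * n) = if (p %| n)%N then p%:R else 0.
Proof.
move=> zE n; under eq_bigr do rewrite mulnC exprM.
have [|pn] := boolP (p %| n)%N.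
  rewrite -zE => /eqP->; under eq_bigr do rewrite expr1n.
  by rewrite sumr_const card_ord.
have z1 : z ^+ n - 1 != 0 by rewrite subr_eq0 zE.
apply/(mulfI z1); rewrite mulr0 -subrX1 -exprM mulnC exprM.
by have := zE p; rewrite dvdnn => /eqP->; rewrite expr1n subrr.
Qed.

(** Substituting a b for b leaves only the symbol of b, since the symbol of a is squared; summing
    z^(a (b + 1)) over a then singles out b = p - 1. *)
Lemma gauss_sum_sqr (F : fieldType) (z : F) :
  (forall m, (z ^+ m == 1) = (p %| m)%N) ->
  (\sum_(a < p) (legendre p a)%:~R * z ^+ a) ^+ 2 = (legendre p p.-1)%:~R * p%:R.
Proof.
move=> zE; have p0 := prime_gt0 pp.
have zp : z ^+ p = 1 by apply/eqP; rewrite zE.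
have zm n : z ^+ (n %% p) = z ^+ n.
  by rewrite {2}(divn_eq n p) exprD mulnC exprM zp expr1n mul1r.
rewrite expr2 mulr_suml.
(* The substitution is valid for a > 0 only. The subtracted term cancels the row a = 0, so that the
   sum over all a becomes geometric; in total it vanishes by [sum_legendre]. *)
transitivity (\sum_(a < p) \sum_(b < p)
    ((legendre p b)%:~R * z ^+ (a * b.+1) - (a == 0%N :> nat)%:R * (legendre p b)%:~R)).
  apply: eq_bigr => a _; rewrite -mulrA mulr_sumr.
  have [a0|a0] := eqVneq (a : nat) 0%N.
    rewrite a0 /legendre dvdn0 mulr0z mul0r big1 // => b _.
    by rewrite mul0n expr0 mulr1 mul1r subrr.
  have pa : ~~ (p %| a)%N by apply/negP => /dvdn_leq; have := ltn_ord a; lia.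
  have ca : coprime p a by rewrite prime_coprime.
  rewrite -(sum_mulmod (fun b => z ^+ a * ((legendre p b)%:~R * z ^+ b)) p0 ca).
  rewrite mulr_sumr; apply: eq_bigr => b _.
  rewrite legendre_mod // zm legendreM // intrM mul0r subr0 mulnS exprD.
  have := legendre_sqr pp op pa; rewrite legendreM // => /(congr1 (fun x : int => x%:~R : F)).
  rewrite intrM mulr1z; move: (_%:~R) (_%:~R) => x y e.
  by rewrite -[RHS]mul1r -e; ring.
rewrite exchange_big /=.
have s0 : \sum_(b < p) (legendre p b)%:~R = 0 :> F.
  by rewrite -(raddf_sum (intmul 1)) sum_legendre.
transitivity (\sum_(b < p) ((legendre p b)%:~R * (if (p %| b.+1)%N then p%:R else 0)
    - (legendre p b)%:~R) : F).
  apply: eq_bigr => b _; rewrite sumrB -mulr_sumr geom_unity_root //; congr (_ - _).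
  rewrite -mulr_suml -[RHS]mul1r; congr (_ * _).
  rewrite (bigD1 (Ordinal p0)) //= big1 ?addr0 // => i.
  by rewrite -val_eqE /= => /negPf->.
rewrite sumrB s0 subr0.
have lp : (p.-1 < p)%N by rewrite prednK.
rewrite (bigD1 (Ordinal lp)) //= prednK // dvdnn big1 ?addr0 // => b.
rewrite -val_eqE /= => bp; case: ifP => [/dvdn_leq h|_]; last by rewrite mulr0.
by have := ltn_ord b; have := h isT; move/eqP: bp; lia.
Qed.

(** The factor [r.-1] stands for -1 modulo [r], so the right side is the symbol of p or -p,
    according to p modulo 4. In a field of characteristic r the Gauss sum t has this number as its
    square; t^r is (r/p) t by Frobenius, and also the symbol of t^2 times t by Euler's criterion. *)
Lemma quadratic_reciprocity :
  legendre p r = if (p %% 4 == 1)%N then legendre r p else legendre r (p * r.-1).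
Proof.
have p0 := prime_gt0 pp; have r1 := prime_gt1 rp.
have npr : ~~ (p %| r)%N by rewrite dvdn_prime2.
have nrp : ~~ (r %| p)%N by rewrite dvdn_prime2 // eq_sym.
have cpr : coprime p r by rewrite prime_coprime.
have pd : (p %| (r ^ p.-1).-1)%N.
  have := @Euler_exp_totient r p; rewrite coprime_sym totient_prime // => /(_ cpr)/eqP.
  by rewrite eqn_mod_dvd ?expn_gt0 ?(ltnW r1) // subn1.
have p1 : (0 < p.-1)%N by have := prime_gt1 pp; lia.
have [F rF [z zE]] := finField_root_of_unity rp p1 pd.
have zp : z ^+ p = 1 by apply/eqP; rewrite zE.
have zm n : z ^+ (n %% p) = z ^+ n.
  by rewrite {2}(divn_eq n p) exprD mulnC exprM zp expr1n mul1r.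
have t2 := gauss_sum_sqr zE.
set t := \sum_(a < p) _ in t2.
pose s : nat := if (p %% 4 == 1)%N then 1%N else r.-1.
have t2s : t ^+ 2 = (p * s)%:R.
  rewrite t2 legendreN1_mod4 // /s; case: ifP => _; first by rewrite mulr1z mul1r muln1.
  rewrite mulrN1z natrM mulrC; congr (_ * _); apply/esym/eqP.
  by rewrite -addr_eq0 natr1 prednK ?(ltnW r1) // -(dvdn_pcharf rF).
have -> : (if (p %% 4 == 1)%N then legendre r p else legendre r (p * r.-1)) = legendre r (p * s).
  by rewrite /s; case: ifP; rewrite ?muln1.
have t0 : t != 0.
  rewrite -sqrf_eq0 t2s -(dvdn_pcharf rF) Euclid_dvdM // negb_or nrp /=.
  by rewrite /s; case: ifP => _; apply/negP => /dvdn_leq; lia.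
have tr : (legendre p r)%:~R * t ^+ r = t.
  rewrite -(pFrobenius_autE rF) /t rmorph_sum /= mulr_sumr.
  rewrite -(sum_mulmod (fun a => (legendre p a)%:~R * z ^+ a) p0 cpr); apply: eq_bigr => a _.
  rewrite rmorphM /= pFrobenius_aut_int pFrobenius_autE -exprM zm legendre_mod // legendreM //.
  by rewrite intrM mulrA [(a * r)%N]mulnC.
have e1 : (legendre p r)%:~R * (legendre r (p * s))%:~R = 1 :> F.
  apply: (mulIf t0); rewrite mul1r -[RHS]tr -mulrA; congr (_ * _).
  by rewrite (euler_criterion rp orr _ rF) -t2s -exprM -(odd_pred_half orr) -exprSr prednK // ltnW.
apply: (sign_inj rp orr rF); try exact: legendreV.
move: e1; case: (legendreV p r) => ->; case: (legendreV r (p * s)) => ->;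
  rewrite ?(mulr0z, mulr1z, mulrN1z, mul0r, mulr0, mulr1, mul1r, mulNr, mulrN) ?opprK //.
- by move=> /esym/eqP; rewrite oner_eq0.
- by move=> /esym/eqP; rewrite oner_eq0.
Qed.

End Reciprocity.

(** * Primes with prescribed real characters *)

Section Sums.
Variable R : realType.
Implicit Types (u f : nat -> R).

Lemma abel_bound u f (B : R) (a b : nat) :
    (forall c, `|\sum_(a <= n < c) u n| <= B) ->
    (forall n, (a <= n)%N -> f n.+1 <= f n) -> (forall n, (a <= n)%N -> 0 <= f n) ->
  `|\sum_(a <= n < b) u n * f n| <= B * f a.
Proof.
move=> hB fd f0.
have B0 : 0 <= B by apply: le_trans (hB a).
have [ba|ab] := leqP b a; first by rewrite big_geq // normr0 mulr_ge0 // f0.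
have key c : (a <= c)%N -> \sum_(a <= n < c) u n * f n =
   \sum_(a <= n < c) (\sum_(a <= i < n.+1) u i) * (f n - f n.+1)
   + (\sum_(a <= i < c) u i) * f c.
  elim: c => [|c IH]; first by rewrite leqn0 => /eqP->; rewrite !big_geq // mul0r addr0.
  rewrite leq_eqVlt => /orP[/eqP->|]; first by rewrite !big_geq // mul0r addr0.
  rewrite ltnS => ac; rewrite (big_nat_recr c) //= IH // [in RHS](big_nat_recr c) //=.
  by rewrite (big_nat_recr c) //=; ring.
rewrite key; last exact: ltnW.
have fle c : (a <= c)%N -> \sum_(a <= n < c) (f n - f n.+1) = f a - f c.
  move=> ac; under eq_bigr do rewrite -opprB.
  by rewrite sumrN telescope_sumr // opprB.
apply: le_trans (ler_normD _ _) _.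
have -> : B * f a = \sum_(a <= n < b) B * (f n - f n.+1) + B * f b.
  rewrite -mulr_sumr fle; last exact: ltnW.
  by ring.
apply: lerD; last by rewrite normrM (ger0_norm (f0 _ (ltnW ab))) ler_wpM2r // f0 // ltnW.
apply: le_trans (ler_norm_sum _ _ _) _.
rewrite big_nat_cond [leRHS]big_nat_cond; apply: ler_sum => n; rewrite andbT => /andP[an _].
rewrite normrM ler_pM // ger0_norm // subr_ge0; exact: fd.
Qed.

Lemma sum_multiples (F : nat -> R) (d x : nat) : (0 < d)%N ->
  \sum_(1 <= n < x.+1 | (d %| n)%N) F n = \sum_(1 <= k < (x %/ d)%N.+1) F (d * k)%N.
Proof.
move=> d0; elim: x => [|x IH]; first by rewrite div0n !big_geq.
rewrite big_mkcond big_nat_recr //= -big_mkcond IH divnS //.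
case: ifP => dx; last by rewrite addr0 add0n.
rewrite add1n [in RHS]big_nat_recr //=; congr (_ + F _).
by move: (divnS x d0); rewrite dx add1n => <-; rewrite mulnC divnK.
Qed.

Lemma sum_divisor_pairs (G : nat -> nat -> R) (x : nat) :
  \sum_(1 <= n < x.+1) \sum_(1 <= d < x.+1 | (d %| n)%N) G d (n %/ d)%N =
  \sum_(1 <= d < x.+1) \sum_(1 <= k < (x %/ d)%N.+1) G d k.
Proof.
under eq_bigr do rewrite big_mkcond.
rewrite exchange_big /=; apply: eq_big_nat => d /andP[d0 _].
rewrite -big_mkcond sum_multiples //; apply: eq_bigr => k _.
by rewrite mulKn.
Qed.

Definition harm (n : nat) : R := \sum_(1 <= k < n.+1) k%:R^-1.

Lemma ln_succ (n : nat) : (0 < n)%N -> ln n.+1%:R - ln n%:R <= (n%:R^-1 : R).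
Proof.
move=> n0; have nR : 0 < (n%:R : R) by rewrite ltr0n.
rewrite -ln_div ?posrE ?ltr0n //.
have -> : n.+1%:R / n%:R = 1 + (n%:R : R)^-1.
  by rewrite -natr1 mulrDl mulfV ?gt_eqF // mul1r.
by apply: le_ln1Dx; rewrite (lt_trans (ltrN10 _)) // invr_gt0.
Qed.

Lemma ln_le_harm (n : nat) : ln n.+1%:R <= harm n.
Proof.
elim: n => [|n IH]; first by rewrite /harm big_geq // ln1.
rewrite /harm big_nat_recr //= -/(harm n).
by apply: le_trans (lerD IH (@ln_succ n.+1 isT)); rewrite addrC subrK.
Qed.

Lemma ln_nat_unbounded (C : R) : exists n : nat, C < ln n.+1%:R.
Proof.
exists (Num.truncn (expR C)).
have h := truncnS_gt (expR C).
by rewrite -{1}[C]expRK ltr_ln ?posrE ?expR_gt0 ?ltr0n.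
Qed.

Lemma harm_unbounded (C : R) : exists n : nat, C < harm n.
Proof. by have [n hn] := ln_nat_unbounded C; exists n; apply: lt_le_trans (ln_le_harm n). Qed.

(** The weight k^(-1/2), equal to 0 at k = 0; not an integer square root. *)
Definition isqrt (k : nat) : R := (Num.sqrt k%:R)^-1.
Definition sqsum (n : nat) : R := \sum_(1 <= k < n.+1) isqrt k.

Lemma sqrt_succ (n : nat) : (0 < n)%N ->
  let s := Num.sqrt n%:R : R in let t := Num.sqrt n.+1%:R : R in
  [/\ 0 < s, s <= t & t ^+ 2 = s ^+ 2 + 1].
Proof.
move=> n0 /=; split.
- by rewrite sqrtr_gt0 ltr0n.
- by rewrite ler_wsqrtr // ler_nat.
- by rewrite !sqr_sqrtr ?ler0n // -natr1.
Qed.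

Definition sqerr (n : nat) : R := sqsum n - 2 * Num.sqrt n%:R.

(** [sqerr] is nonincreasing while [sqerr] minus [isqrt] is nondecreasing. So the partial sums are 2
    sqrt n plus a constant up to n^(-1/2), and the value of [sqerr] at a large index can stand in
    for the limit. *)
Lemma sqerr_bounds (n m : nat) : (0 < n)%N -> (n <= m)%N ->
  sqerr m <= sqerr n <= sqerr m + isqrt n.
Proof.
move=> n0 nm; pose e := sqerr; rewrite -/e.
suff: e m <= e n /\ e n <= e m + isqrt n - isqrt m.
  by move=> [-> h]; apply: le_trans h _; rewrite gerBl invr_ge0 sqrtr_ge0.
elim: m nm => [|m IH]; first by rewrite leqn0 => /eqP h; rewrite h in n0.
rewrite leq_eqVlt => /orP[/eqP<-|]; first by lra.
rewrite ltnS => nm; have [h1 h2] := IH nm.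
have m0 : (0 < m)%N by apply: leq_trans nm.
have [s0 st t2] := sqrt_succ m0.
have ee : e m.+1 = e m + isqrt m.+1 - 2 * (Num.sqrt m.+1%:R - Num.sqrt m%:R).
  by rewrite /e /sqerr /sqsum big_nat_recr //=; ring.
move: s0 st t2 h1 h2 ee; rewrite /isqrt.
set s := Num.sqrt m%:R; set t := Num.sqrt m.+1%:R => s0 st t2.
have t0 : 0 < t by lra.
have a1 : t^-1 <= 2 * (t - s).
  rewrite -(ler_pM2r t0) mulVf ?gt_eqF //; nra.
have a2 : 2 * (t - s) - t^-1 <= s^-1 - t^-1.
  rewrite lerD2r -(ler_pM2r s0) mulVf ?gt_eqF //; nra.
by move=> h1 h2 ->; split; lra.
Qed.

Lemma sqsum_le (n : nat) : sqsum n <= 2 * Num.sqrt n%:R.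
Proof.
case: n => [|n]; first by rewrite /sqsum big_geq // mulr_ge0 // sqrtr_ge0.
have /andP[h _] := @sqerr_bounds 1 n.+1 isT isT.
move: h; rewrite /sqerr {2}/sqsum big_nat1 /isqrt sqrtr1 invr1 => h; lra.
Qed.

Lemma sqsum_ge (n : nat) : (0 < n)%N -> 2 * Num.sqrt n%:R - 2 <= sqsum n.
Proof.
move=> n0; have /andP[_ +] := @sqerr_bounds 1 n isT n0.
rewrite /sqerr {1}/sqsum big_nat1 /isqrt sqrtr1 invr1 => h; lra.
Qed.

End Sums.

(** * Nonvanishing of L(1, chi) for real chi *)

Record real_char (R : realType) (chi : nat -> R) : Prop := RealChar {
  rchar1 : chi 1%N = 1;
  rcharM : forall m n, chi (m * n)%N = chi m * chi n;
  rcharV : forall n, [\/ chi n = 0, chi n = 1 | chi n = -1] }.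

Section RealChar.
Variables (R : realType) (chi : nat -> R).
Hypothesis chiP : real_char chi.

Lemma rchar_norm n : `|chi n| <= 1.
Proof. by case: (rcharV chiP n) => ->; rewrite ?normr0 ?normrN ?normr1. Qed.

Lemma rcharX n k : chi (n ^ k)%N = chi n ^+ k.
Proof.
elim: k => [|k IH]; first by rewrite expn0 expr0 (rchar1 chiP).
by rewrite expnS exprS (rcharM chiP) IH.
Qed.

(** The coefficients of the Dirichlet series zeta(s) L(s, chi). *)
Definition char_conv (n : nat) : R := \sum_(1 <= d < n.+1 | (d %| n)%N) chi d.

(** A divisor of p^(a+1) m either divides p^a m or has the form p^(a+1) k with k dividing m. *)
Lemma char_conv_pfactor (p a m : nat) : prime p -> ~~ (p %| m)%N -> (0 < m)%N ->
  char_conv (p ^ a.+1 * m) = char_conv (p ^ a * m) + chi p ^+ a.+1 * char_conv m.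
Proof.
move=> pp pm m0; have p0 := prime_gt0 pp.
set P := (p ^ a.+1)%N; set N := (P * m)%N.
have P0 : (0 < P)%N by rewrite expn_gt0 p0.
rewrite /char_conv (bigID (fun d => (d %| p ^ a * m)%N)) /=; congr (_ + _).
  have lN : (p ^ a * m <= N)%N.
    by rewrite leq_pmul2r // /P expnS leq_pmull.
  rewrite [RHS](big_nat_widen _ _ N.+1) //.
  apply: eq_bigl => d; apply/andP/andP => -[h1 h2]; split => //.
    by rewrite ltnS dvdn_leq // muln_gt0 expn_gt0 p0.
  by apply: dvdn_trans h1 _; rewrite /N /P expnS -mulnA dvdn_mull.
transitivity (\sum_(1 <= d < N.+1 | (P %| d)%N) (if (d %/ P %| m)%N then chi d else 0)).
  rewrite -big_mkcondr /=; apply: eq_bigl => d.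
  apply/andP/andP => -[h1 h2].
    have d0 : (0 < d)%N by apply: dvdn_gt0 h1; rewrite muln_gt0 P0.
    have Pd : (P %| d)%N.
      have [e ce de] := pfactor_coprime pp d0.
      have [lo|hi] := ltnP a (logn p d); first by rewrite pfactor_dvdn.
      case/negP: h2; rewrite de mulnC dvdn_mul //; first by rewrite dvdn_exp2l.
      have : (e %| N)%N by apply: dvdn_trans h1; rewrite [X in (_ %| X)%N]de dvdn_mulr.
      by rewrite /N Gauss_dvdr // coprime_sym /P coprimeXl.
    by split => //; rewrite -(dvdn_pmul2l P0) [(P * (d %/ P))%N]mulnC divnK.
  split; first by rewrite -(divnK h1) [(_ * P)%N]mulnC dvdn_mul.
  apply/negP => /(dvdn_trans h1); rewrite /P expnSr dvdn_pmul2l ?(negPf pm) //.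
  by rewrite expn_gt0 p0.
rewrite sum_multiples // mulKn // mulr_sumr [RHS]big_mkcond /=.
apply: eq_bigr => k _; rewrite mulKn // -rcharX -/P (rcharM chiP).
by case: ifP.
Qed.

Lemma char_conv_pfactorE (p a m : nat) : prime p -> ~~ (p %| m)%N -> (0 < m)%N ->
  char_conv (p ^ a * m) = char_conv m * \sum_(0 <= i < a.+1) chi p ^+ i.
Proof.
move=> pp pm m0; elim: a => [|a IH].
  by rewrite big_nat1 expn0 mul1n expr0 mulr1.
by rewrite char_conv_pfactor // IH [in RHS]big_nat_recr //=; ring.
Qed.

Lemma char_geom_ge0 (p a : nat) :
  0 <= \sum_(0 <= i < a.+1) chi p ^+ i /\
  (~~ odd a -> 1 <= \sum_(0 <= i < a.+1) chi p ^+ i).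
Proof.
have [h|h|h] := rcharV chiP p; rewrite h.
- rewrite big_nat_recl //= expr0 big1 ?addr0; first by split=> //; exact: ler01.
  by move=> i _; rewrite expr0n.
- under eq_bigr do rewrite expr1n.
  by rewrite sumr_const_nat subn0 ler0n ler1n.
- suff -> : \sum_(0 <= i < a.+1) (-1) ^+ i = (~~ odd a)%:R :> R.
    by case: odd.
  elim: a => [|a IH]; first by rewrite big_nat1.
  rewrite big_nat_recr //= IH -signr_odd /=.
  by case: odd; rewrite /= ?expr0 ?expr1; ring.
Qed.

(** By multiplicativity each prime power p^a in n contributes 1 + chi(p) + ... + chi(p)^a, which is
    1, a + 1, or alternately 1 and 0; it is never negative, and at least 1 when a is even, as in a
    square. *)
Lemma char_conv_ge (n : nat) : (0 < n)%N ->
  0 <= char_conv n /\ (forall k, n = (k ^ 2)%N -> 1 <= char_conv n).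
Proof.
have [N] := ubnP n; elim: N n => // N IH n nN n0.
have [n1|n1] := leqP n 1.
  have -> : n = 1%N by lia.
  rewrite /char_conv big_mkcond big_nat1 dvdnn (rchar1 chiP).
  by split=> [|? _]; rewrite ?ler01.
have pp := pdiv_prime n1; set p := pdiv n in pp.
have [m cm nE] := pfactor_coprime pp n0.
have pm : ~~ (p %| m)%N by rewrite -prime_coprime.
have m0 : (0 < m)%N by case: (m) nE n0 => // ->.
have l0 : (0 < logn p n)%N by rewrite logn_gt0 mem_primes pp n0 pdiv_dvd.
have mn : (m < n)%N by rewrite [ltnRHS]nE ltn_Pmulr // -(expn0 p) ltn_exp2l // prime_gt1.
have [IH1 IH2] := IH m (leq_trans mn nN) m0.
have E : char_conv n = char_conv m * \sum_(0 <= i < (logn p n).+1) chi p ^+ i.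
  by rewrite {1}nE mulnC char_conv_pfactorE.
have [g0 g1] := char_geom_ge0 p (logn p n).
rewrite E; split=> [|k nk]; first by rewrite mulr_ge0.
have k0 : (0 < k)%N by case: (k) nk n0 => // ->.
have lk : logn p n = (2 * logn p k)%N by rewrite nk lognX.
have [k' ck kE] := pfactor_coprime pp k0.
have mk : m = (k' ^ 2)%N.
  apply/eqP; rewrite -(@eqn_pmul2r (p ^ logn p n)) ?expn_gt0 ?prime_gt0 // -nE.
  by rewrite nk [X in (X ^ 2)%N == _]kE expnMn -expnM lognX mulnC [(2 * _)%N]mulnC mulnC.
rewrite -[leLHS]mulr1 ler_pM // ?ler01 //; first exact: IH2 mk.
by apply: g1; rewrite lk oddM.
Qed.

End RealChar.

Section NonVanishing.
Variables (R : realType) (chi : nat -> R) (B : R).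
Hypothesis chiP : real_char chi.
Hypothesis chiB : forall a b, `|\sum_(a <= n < b) chi n| <= B.

Let B_ge0 : 0 <= B. Proof. exact: le_trans (chiB 0 0). Qed.

Lemma isqrt_ge0 n : 0 <= isqrt R n.
Proof. by rewrite invr_ge0 sqrtr_ge0. Qed.

Lemma isqrt_anti m n : (0 < m)%N -> (m <= n)%N -> isqrt R n <= isqrt R m.
Proof.
move=> m0 mn; rewrite lef_pV2 ?posrE ?sqrtr_gt0 ?ltr0n ?ler_wsqrtr ?ler_nat //.
exact: leq_trans mn.
Qed.

Lemma isqrtM m n : isqrt R (m * n) = isqrt R m * isqrt R n.
Proof. by rewrite /isqrt natrM sqrtrM ?ler0n // invfM. Qed.

Lemma isqrt_sqr n : isqrt R (n ^ 2) = n%:R^-1.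
Proof. by rewrite /isqrt natrX sqrtr_sqr ger0_norm ?ler0n. Qed.

Definition lsum (x : nat) : R := \sum_(1 <= n < x.+1) chi n * n%:R^-1.

Lemma lsum_diff (y x : nat) : (y <= x)%N -> `|lsum x - lsum y| <= B * y.+1%:R^-1.
Proof.
move=> yx; rewrite /lsum (@big_cat_nat _ _ _ y.+1 1 x.+1) //= addrC addrK.
apply: (abel_bound (f := fun n => n%:R^-1)) => [c|n yn|n yn]; first exact: chiB.
  rewrite lef_pV2 ?posrE ?ltr0n ?ler_nat //; lia.
by rewrite invr_ge0 ler0n.
Qed.

(** Only squares are kept: the term at k^2 is at least (k^2)^(-1/2) = 1/k, and the terms between
    squares are nonnegative. *)
Lemma weighted_conv_ge (D : nat) :
  harm R D <= \sum_(1 <= n < (D ^ 2).+1) char_conv chi n * isqrt R n.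
Proof.
elim: D => [|D IH]; first by rewrite /harm !big_geq.
rewrite /harm big_nat_recr //= -/(harm R D).
rewrite (@big_cat_nat _ _ _ (D ^ 2).+1 1) //=; last by rewrite ltnS leq_sqr.
apply: lerD IH _.
rewrite big_nat_recr /=; last by rewrite ltn_sqr.
have [c0 c1] := char_conv_ge chiP (n := (D.+1 ^ 2)%N) isT.
rewrite isqrt_sqr -[leLHS]add0r lerD //.
  rewrite big_nat_cond sumr_ge0 // => n; rewrite andbT => /andP[n1 _].
  rewrite mulr_ge0 ?isqrt_ge0 //.
  by have [] := char_conv_ge chiP (n := n) (leq_trans (ltn0Sn _) n1).
by rewrite ler_peMl ?invr_ge0 ?ler0n // (c1 D.+1).
Qed.

(** Dirichlet's hyperbola method for n = d k <= D^2, cut at d = D. For d > D the cofactor k is at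
    most D and the summations are exchanged; the [if] moves the condition d k <= D^2 into the
    weight, so that the range of d is the same for all k. *)
Lemma weighted_conv_split (D : nat) :
  \sum_(1 <= n < (D ^ 2).+1) char_conv chi n * isqrt R n =
    \sum_(1 <= d < D.+1) chi d * isqrt R d * sqsum R (D ^ 2 %/ d)%N +
    \sum_(1 <= k < D.+1) isqrt R k *
      \sum_(D.+1 <= d < (D ^ 2).+1) chi d * (if (d * k <= D ^ 2)%N then isqrt R d else 0).
Proof.
set X := (D ^ 2)%N.
transitivity (\sum_(1 <= n < X.+1) \sum_(1 <= d < X.+1 | (d %| n)%N)
   (chi d * isqrt R d) * isqrt R (n %/ d)%N).
  apply: eq_big_nat => n /andP[n1 nX]; rewrite /char_conv mulr_suml.
  rewrite (big_nat_widen _ _ X.+1) //; apply: eq_big => d.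
    apply/andP/idP => [[]//|dn]; split => //.
    by rewrite ltnS dvdn_leq.
  by move=> /andP[dn _]; rewrite -mulrA -isqrtM mulnC divnK.
rewrite (sum_divisor_pairs (fun d k => chi d * isqrt R d * isqrt R k)) (@big_cat_nat _ _ _ D.+1 1) //=; last by rewrite ltnS /X; nia.
congr (_ + _); first by apply: eq_bigr => d _; rewrite -mulr_sumr.
transitivity (\sum_(D.+1 <= d < X.+1) \sum_(1 <= k < D.+1)
    isqrt R k * (chi d * (if (d * k <= X)%N then isqrt R d else 0))).
  apply: eq_big_nat => d /andP[Dd dX].
  rewrite (big_nat_widen _ _ D.+1); last first.
    by rewrite ltn_divLR ?(leq_trans _ Dd) // /X; nia.
  rewrite big_mkcond; apply: eq_bigr => k _ /=.
  rewrite ltnS leq_divRL ?(leq_trans _ Dd) // [(k * d)%N]mulnC.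
  by case: ifP => _; ring.
by rewrite exchange_big /=; apply: eq_bigr => k _; rewrite mulr_sumr.
Qed.

(** The truncated weight is still nonincreasing in d, so partial summation bounds each inner sum by
    B D^(-1/2), while the outer weights add up to at most 2 D^(1/2). *)
Lemma tail_part_bound (D : nat) :
  `|\sum_(1 <= k < D.+1) isqrt R k *
      \sum_(D.+1 <= d < (D ^ 2).+1) chi d * (if (d * k <= D ^ 2)%N then isqrt R d else 0)|
   <= 2 * B.
Proof.
apply: le_trans (ler_norm_sum _ _ _) _.
case: D => [|D]; first by rewrite big_geq // mulr_ge0.
apply: (@le_trans _ _ (\sum_(1 <= k < D.+2) isqrt R k * (B * isqrt R D.+1))).
  apply: ler_sum => k _; rewrite normrM ger0_norm ?isqrt_ge0 //.
  rewrite ler_wpM2l ?isqrt_ge0 //.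
  apply: le_trans (abel_bound _ (f := fun d => if (d * k <= D.+1 ^ 2)%N then isqrt R d else 0)
     (chiB _) _ _) _ => [n Dn|n Dn|].
  - case: ifP => h; last by case: ifP; rewrite // isqrt_ge0.
    rewrite ifT; first by apply: isqrt_anti; lia.
    by apply: leq_trans h; rewrite leq_mul2r leqnSn orbT.
  - by case: ifP; rewrite // isqrt_ge0.
  rewrite ler_wpM2l //; case: ifP => _; last exact: isqrt_ge0.
  exact: isqrt_anti.
rewrite -mulr_suml -/(sqsum R D.+1).
apply: (@le_trans _ _ (2 * Num.sqrt D.+1%:R * (B * isqrt R D.+1))).
  by rewrite ler_wpM2r ?sqsum_le // mulr_ge0 // isqrt_ge0.
rewrite /isqrt; have : Num.sqrt D.+1%:R != 0 :> R by rewrite gt_eqF // sqrtr_gt0 ltr0n.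
by move=> s0; rewrite [leLHS](_ : _ = 2 * B) //; field.
Qed.

(** Replacing the inner sum up to D^2/d by 2 D d^(-1/2) + c, with c the value of [sqerr] at D^2,
    produces the main term. Since -2 <= c <= 0, the constant costs at most 2 B by partial summation;
    the replacement error is at most D^(-1/2) for each d, which against the weights d^(-1/2) sums to
    at most 2. *)
Lemma head_part_bound (D : nat) :
  `|\sum_(1 <= d < D.+1) chi d * isqrt R d * sqsum R (D ^ 2 %/ d)%N
    - 2 * D%:R * lsum D| <= 2 * B + 2.
Proof.
case: D => [|D]; first by rewrite big_geq // mulr0 mul0r subrr normr0 addr_ge0 // mulr_ge0.
set N := D.+1; set X := (N ^ 2)%N; set c := sqerr R X.
have X0 : (0 < X)%N by rewrite /X; lia.
have sX : Num.sqrt X%:R = N%:R :> R by rewrite /X natrX sqrtr_sqr ger0_norm ?ler0n.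
have -> : \sum_(1 <= d < N.+1) chi d * isqrt R d * sqsum R (X %/ d)%N - 2 * N%:R * lsum N =
   c * (\sum_(1 <= d < N.+1) chi d * isqrt R d) +
   \sum_(1 <= d < N.+1) chi d * isqrt R d * (sqsum R (X %/ d)%N - 2 * N%:R * isqrt R d - c).
  rewrite /lsum !mulr_sumr -sumrB -big_split /=; apply: eq_bigr => d _.
  have -> : d%:R^-1 = isqrt R d * isqrt R d by rewrite -isqrtM mulnn isqrt_sqr.
  by ring.
apply: le_trans (ler_normD _ _) _; apply: lerD.
  rewrite normrM ler_pM //.
    rewrite /c ler_norml; apply/andP; split.
      by rewrite /sqerr; have := sqsum_ge R X0; lra.
    by rewrite /sqerr; have := sqsum_le R X; lra.
  apply: le_trans (abel_bound _ (chiB _) _ _) _ => [n n1|n _|]; first exact: isqrt_anti.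
    exact: isqrt_ge0.
  by rewrite /isqrt sqrtr1 invr1 mulr1.
apply: le_trans (ler_norm_sum _ _ _) _.
apply: (@le_trans _ _ (\sum_(1 <= d < N.+1) isqrt R d * isqrt R N)).
  rewrite big_nat_cond [leRHS]big_nat_cond; apply: ler_sum => d; rewrite andbT => /andP[d1 dN].
  rewrite !normrM [`|isqrt R d|]ger0_norm ?isqrt_ge0 //.
  rewrite -[leRHS]mul1r -mulrA ler_pM ?mulr_ge0 ?isqrt_ge0 ?rchar_norm //.
  rewrite ler_wpM2l ?isqrt_ge0 //.
  set n := (X %/ d)%N.
  have Nn : (N <= n)%N by rewrite /n leq_divRL // /X -mulnn leq_mul2l -ltnS dN orbT.
  have n0 : (0 < n)%N by apply: leq_trans Nn.
  have nX : (n <= X)%N by rewrite /n leq_div.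
  have /andP[e1 e2] := sqerr_bounds R n0 nX; rewrite -/c in e1 e2.
  apply: (@le_trans _ _ (isqrt R n)); last exact: isqrt_anti.
  have s0 : 0 < Num.sqrt n%:R :> R by rewrite sqrtr_gt0 ltr0n.
  (* The square of [y] is the real quotient X / d and [n] is its integer part, hence n <= y^2 < n +
     1. *)
  set y := N%:R * isqrt R d.
  have y0 : 0 <= y by rewrite mulr_ge0 ?ler0n ?isqrt_ge0.
  have y2 : y ^+ 2 * d%:R = X%:R.
    rewrite /y exprMn /isqrt exprVn sqr_sqrtr ?ler0n // -natrX -/X.
    by rewrite mulfVK // pnatr_eq0 -lt0n.
  have dR : 0 < d%:R :> R by rewrite ltr0n.
  have ylo : Num.sqrt n%:R ^+ 2 <= y ^+ 2.
    rewrite sqr_sqrtr ?ler0n // -(ler_pM2r dR) y2 -natrM ler_nat.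
    exact: leq_trunc_div.
  have yhi : y ^+ 2 < Num.sqrt n%:R ^+ 2 + 1.
    rewrite sqr_sqrtr ?ler0n // -(ltr_pM2r dR) y2 natr1 -natrM ltr_nat.
    exact: ltn_ceil.
  rewrite ler_sqr ?nnegrE ?sqrtr_ge0 ?y0 // in ylo.
  have h : 2 * y - 2 * Num.sqrt n%:R <= isqrt R n.
    rewrite -(ler_pM2r s0) /isqrt mulVf ?gt_eqF //; nra.
  have -> : 2 * N%:R * isqrt R d = 2 * y by rewrite /y mulrA.
  move: e1 e2 h ylo; rewrite /sqerr ler_norml.
  move: (sqsum R n) (Num.sqrt _) (isqrt R n) y {y0 y2 yhi s0} c => a s i y c *.
  by apply/andP; split; lra.
rewrite -mulr_suml -/(sqsum R N).
apply: (@le_trans _ _ (2 * Num.sqrt N%:R * isqrt R N)).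
  by rewrite ler_wpM2r ?sqsum_le // isqrt_ge0.
by rewrite /isqrt mulfK // gt_eqF // sqrtr_gt0 ltr0n.
Qed.

(* The convolution [1 * chi] is nonnegative and at least 1 at the squares, so
   summing it against [n^(-1/2)] gives [2 D L(1,chi) + O(1) >= log D]. *)
Lemma lsum_bounded_below :
  exists delta x0, 0 < delta /\ forall x, (x0 <= x)%N -> delta <= lsum x.
Proof.
(* The head is within 2 B + 2 of 2 D [lsum D] and the tail is at most 2 B, so a harmonic sum above 6
   B + 2 forces D [lsum D] > B; later partial sums differ from [lsum D] by at most B / D. *)
have [D hD] := harm_unbounded (6 * B + 2).
have D0 : (0 < D)%N.
  case: (D) hD => // ; rewrite /harm big_geq // => h; exfalso.
  by have := B_ge0; lra.
have hh := weighted_conv_ge D; rewrite weighted_conv_split in hh.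
have h1 := head_part_bound D; have h2 := tail_part_bound D.
have DR : 0 < D%:R :> R by rewrite ltr0n.
have key : B < D%:R * lsum D.
  move: h1 h2 hh; rewrite !ler_norml => /andP[_ h1] /andP[_ h2] hh.
  have e : 2 * D%:R * lsum D = 2 * (D%:R * lsum D) by ring.
  by rewrite e in h1; move: h1 h2 hh; set u := \sum_(_ <= _ < _) _; set v := \sum_(_ <= _ < _) _ => *; lra.
exists (lsum D - B * D%:R^-1), D; split.
  by rewrite subr_gt0 -(ltr_pM2l DR) mulrCA mulfV ?gt_eqF // mulr1.
move=> x Dx; have := lsum_diff Dx; rewrite ler_norml => /andP[h _].
have i : B * D.+1%:R^-1 <= B * D%:R^-1.
  by rewrite ler_wpM2l // lef_pV2 ?posrE ?ltr0n ?ler_nat.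
by move: h i; set u := _ * _; set v := _ * _ => *; lra.
Qed.

End NonVanishing.

(** * The von Mangoldt function and Mertens-type estimates *)

Section VonMangoldt.
Variable R : realType.

(** At most one pair (p, j) contributes. The double sum allows summations to be exchanged without
    extracting the prime from [d], and its ranges can be enlarged at will ([mangoldt_widen]). *)
Definition mangoldt (d : nat) : R :=
  \sum_(1 <= p < d.+1 | prime p) \sum_(1 <= j < d.+1) (if (d == p ^ j)%N then ln p%:R else 0).

Lemma mangoldt_ge0 d : 0 <= mangoldt d.
Proof.
apply: sumr_ge0 => p pp; apply: sumr_ge0 => j _; case: ifP => // _.
by rewrite ln_ge0 // ler1n prime_gt0.
Qed.

Lemma mangoldt_neq0 d : mangoldt d != 0 -> exists p j, prime p /\ d = (p ^ j)%N.
Proof.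
rewrite /mangoldt => h.
have [/hasP[p _ /andP[pp /hasP[j _ /eqP dE]]]|/hasPn no] :=
  boolP (has (fun p => prime p && has (fun j => d == p ^ j)%N (iota 1 d)) (iota 1 d)).
  by exists p, j.
case/eqP: h; rewrite big_nat_cond big1 // => p /andP[pd pp].
rewrite big_nat_cond big1 // => j /andP[jd _]; case: ifP => // dE.
have := no p; rewrite mem_iota add1n pd pp /= => /(_ isT)/hasPn/(_ j).
by rewrite mem_iota add1n jd dE => /(_ isT).
Qed.

Lemma mangoldt_widen d x : (0 < d)%N -> (d <= x)%N -> mangoldt d =
  \sum_(1 <= p < x.+1 | prime p) \sum_(1 <= j < x.+1) (if (d == p ^ j)%N then ln p%:R else 0).
Proof.
move=> d0 dx; rewrite (@big_cat_nat _ _ _ d.+1 1 x.+1) //=.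
rewrite [X in _ + X]big_nat_cond [X in _ + X]big1 ?addr0 => [|p /andP[/andP[dp _] pp]].
  apply: eq_bigr => p pp; rewrite (@big_cat_nat _ _ _ d.+1 1 x.+1) //=.
  rewrite [X in _ + X]big_nat_cond [X in _ + X]big1 ?addr0 // => j /andP[/andP[dj _] _].
  case: ifP => // /eqP dE; have := ltn_expl j (prime_gt1 pp); lia.
rewrite big_nat_cond big1 // => j /andP[/andP[j1 _] _]; case: ifP => // /eqP dE.
have : (p ^ 1 <= p ^ j)%N by rewrite leq_exp2l // prime_gt1.
by rewrite expn1; lia.
Qed.

Lemma ln_prodn (s : seq nat) (P : pred nat) (F : nat -> nat) :
  (forall i, P i -> 0 < F i)%N ->
  ln (\prod_(i <- s | P i) F i)%N%:R = \sum_(i <- s | P i) ln (F i)%:R :> R.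
Proof.
move=> F0.
suff : (0 < \prod_(i <- s | P i) F i)%N /\
  ln (\prod_(i <- s | P i) F i)%N%:R = \sum_(i <- s | P i) ln (F i)%:R :> R by case.
elim: s => [|i s [IH1 IH2]]; first by rewrite !big_nil ln1.
rewrite !big_cons; case: ifP => // Pi.
by rewrite muln_gt0 F0 // IH1 natrM lnM ?posrE ?ltr0n ?F0 // IH2.
Qed.

Lemma sum_mangoldt n x : (0 < n)%N -> (n <= x)%N ->
  \sum_(1 <= d < x.+1 | (d %| n)%N) mangoldt d = ln n%:R.
Proof.
move=> n0 nx.
transitivity (\sum_(1 <= d < x.+1 | (d %| n)%N)
  \sum_(1 <= p < x.+1 | prime p) \sum_(1 <= j < x.+1) (if (d == p ^ j)%N then ln p%:R else 0) : R).
  rewrite big_nat_cond [RHS]big_nat_cond; apply: eq_bigr => d /andP[/andP[d1 dx] _].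
  exact: mangoldt_widen.
rewrite exchange_big /=.
transitivity (\sum_(1 <= p < x.+1 | prime p) (ln p%:R *+ logn p n : R)).
  apply: eq_bigr => p pp; rewrite exchange_big /= logn_count_dvd //.
  transitivity (\sum_(1 <= j < x.+1) (ln p%:R *+ (p ^ j %| n)%N : R)).
    apply: eq_big_nat => j /andP[j1 jx]; rewrite -big_mkcondr /=.
    have [pn|pn] := boolP (p ^ j %| n)%N.
      rewrite (big_rem (p ^ j)%N) /=; last first.
        rewrite mem_index_iota expn_gt0 prime_gt0 //= ltnS.
        by apply: leq_trans nx; exact: dvdn_leq.
      rewrite pn eqxx big_seq_cond big1 ?addr0 // => d.
      rewrite mem_rem_uniq ?iota_uniq // inE => /andP[/andP[d1 _] /andP[_ d2]].
      by rewrite d2 in d1.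
    by rewrite big1 // => d /andP[dn /eqP de]; rewrite -de dn in pn.
  rewrite (@big_cat_nat _ _ _ n 1) //=; last exact: leqW.
  rewrite [X in _ + X]big_nat_cond [X in _ + X]big1 ?addr0 => [|j /andP[/andP[nj _] _]].
    by rewrite -sumrMnr.
  case: (boolP (_ %| _)%N) => // /(dvdn_leq n0).
  have := ltn_expl j (prime_gt1 pp); lia.
rewrite -[in RHS](partnT n0) /partn ln_prodn; last first.
  by move=> [|p] _; [rewrite lognE | rewrite expn_gt0].
rewrite [RHS](big_nat_widen _ _ x.+1) //=.
rewrite [RHS]big_ltn_cond //= lognE /= expn0 ln1 add0r.
rewrite big_mkcond [RHS]big_mkcond /=; apply: eq_big_nat => p /andP[p1 px].
have [pp|npp] := boolP (prime p); last by rewrite lognE (negPf npp) expn0 ln1 if_same.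
have lX : ln (p ^ logn p n)%N%:R = ln p%:R *+ logn p n :> R.
  by rewrite natrX lnXn // ltr0n.
rewrite lX; case: ifP => //= pn.
rewrite [logn p n]lognE pp n0 /=; case: ifP => // /(dvdn_leq n0); lia.
Qed.

Lemma ln_fact n x : (n <= x)%N ->
  ln (n`!)%:R = \sum_(1 <= d < x.+1) mangoldt d *+ (n %/ d)%N.
Proof.
move=> nx.
transitivity (\sum_(1 <= d < n.+1) mangoldt d *+ (n %/ d)%N).
  rewrite fact_prod big_nat ln_prodn => [|i /andP[]//]; rewrite -big_nat.
  transitivity (\sum_(1 <= m < n.+1) \sum_(1 <= d < n.+1 | (d %| m)%N) mangoldt d).
    by apply: eq_big_nat => m /andP[m1 mn]; rewrite sum_mangoldt.
  rewrite (sum_divisor_pairs (fun d k => mangoldt d)); apply: eq_bigr => d _.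
  by rewrite sumr_const_nat subSS subn0.
rewrite [RHS](@big_cat_nat _ _ _ n.+1 1) //=.
rewrite [X in _ = _ + X]big_nat_cond [X in _ = _ + X]big1 ?addr0 // => d /andP[/andP[nd _] _].
by rewrite divn_small.
Qed.

Definition cheb (x : nat) : R := \sum_(1 <= d < x.+1) mangoldt d.

Lemma cheb_mono x y : (x <= y)%N -> cheb x <= cheb y.
Proof.
move=> xy; rewrite /cheb (@big_cat_nat _ _ _ x.+1 1 y.+1) //= lerDl.
by apply: sumr_ge0 => d _; exact: mangoldt_ge0.
Qed.

(** In terms of [mangoldt], ln C(2y, y) has coefficients floor(2y/d) - 2 floor(y/d), which are
    nonnegative and equal to 1 for y < d <= 2y; on the other side C(2y, y) <= 2^(2y) and ln 2 <=
    1. *)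
Lemma cheb_double y : cheb (2 * y) <= cheb y + (2 * y)%:R.
Proof.
have [->|y0] := posnP y; first by rewrite muln0 addr0.
have C0 : (0 < 'C(2 * y, y))%N by rewrite bin_gt0; lia.
have E : ln ((2 * y)`!)%:R = ln 'C(2 * y, y)%:R + 2 * ln (y`!)%:R :> R.
  rewrite -(@bin_fact (2 * y) y); last lia.
  have -> : (2 * y - y = y)%N by lia.
  rewrite !natrM !lnM ?posrE ?mulr_gt0 ?ltr0n ?fact_gt0 //; ring.
have C2 : ln 'C(2 * y, y)%:R <= (2 * y)%:R :> R.
  apply: (@le_trans _ _ (ln (2 ^ (2 * y))%N%:R)).
    rewrite ler_ln ?posrE ?ltr0n ?expn_gt0 // ler_nat.
    rewrite (Pascal 1 1 (2 * y)) (bigD1 (inord y)) //= !exp1n !muln1 inordK; last lia.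
    exact: leq_addr.
  rewrite natrX lnXn ?ltr0n // ler_wMn2r //.
  by have := @le_ln1Dx R 1; apply; lra.
rewrite (@ln_fact (2 * y) (2 * y)) // (@ln_fact y (2 * y)) in E; last lia.
suff : cheb (2 * y) - cheb y <= ln 'C(2 * y, y)%:R by move=> h; lra.
have -> : ln 'C(2 * y, y)%:R = \sum_(1 <= d < (2 * y).+1)
    (mangoldt d *+ (2 * y %/ d)%N - 2 * (mangoldt d *+ (y %/ d)%N)) :> R.
  by rewrite sumrB E -mulr_sumr addrK.
rewrite /cheb (@big_cat_nat _ _ _ y.+1 1 (2 * y).+1) //=; last lia.
rewrite [leLHS]addrC addKr [leRHS](@big_cat_nat _ _ _ y.+1 1 (2 * y).+1) //=; last lia.
rewrite -[leLHS]add0r lerD //.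
  apply: sumr_ge0 => d _; rewrite -!(mulr_natr (mangoldt d)).
  have : (2 * (y %/ d))%:R <= (2 * y %/ d)%:R :> R.
    rewrite ler_nat; have [->|d0] := posnP d; first by rewrite !divn0.
    by rewrite leq_divRL // -mulnA leq_mul2l leq_trunc_div.
  rewrite natrM; have := mangoldt_ge0 d; nra.
rewrite big_nat_cond [leRHS]big_nat_cond; apply: ler_sum => d; rewrite andbT => /andP[yd dy].
rewrite (@divn_small y) // mulr0n mulr0 subr0.
rewrite -[leLHS]mulr1n ler_wpMn2l ?mangoldt_ge0 // divn_gt0; lia.
Qed.

Lemma cheb_le x : cheb x <= 4 * x%:R.
Proof.
have cheb2 k : cheb (2 ^ k) <= 2 * (2 ^ k)%:R.
  elim: k => [|k IH].
    rewrite expn0 /cheb big_nat1 /mangoldt big_mkcond big_nat1 /=.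
    by rewrite mulr1 ler0n.
  rewrite expnS; apply: le_trans (cheb_double _) _.
  by rewrite natrM; lra.
have [x1|x1] := leqP x 1.
  apply: le_trans (cheb_mono x1) _; have := cheb2 0; rewrite expn0.
  case: x x1 => [|[|//]] _; rewrite ?mulr1; last lra.
  rewrite /cheb big_nat1 /mangoldt big_mkcond big_nat1 /= mulr0; lra.
have /andP[lo hi] := @up_log_bounds 2 x isT x1.
apply: le_trans (cheb_mono hi) _; apply: le_trans (cheb2 _) _.
have k0 : (0 < up_log 2 x)%N by rewrite up_log_gt0.
rewrite -(prednK k0) expnS.
have -> : 4 * x%:R = 2 * (2 * x)%:R :> R by rewrite natrM; ring.
by rewrite ler_wpM2l // ler_nat leq_mul2l ltnW.
Qed.

Definition char_mangoldt (chi : nat -> R) (x : nat) : R :=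
  \sum_(1 <= d < x.+1) chi d * (mangoldt d * d%:R^-1).

(** The convolution identity ln = 1 * Lambda, twisted by the completely multiplicative chi. *)
Lemma sum_char_ln chi x : real_char chi ->
  \sum_(1 <= n < x.+1) chi n * (ln n%:R * n%:R^-1) =
  \sum_(1 <= d < x.+1) chi d * (mangoldt d * d%:R^-1) * lsum chi (x %/ d)%N.
Proof.
move=> chiP.
transitivity (\sum_(1 <= n < x.+1) \sum_(1 <= d < x.+1 | (d %| n)%N)
    (chi d * (mangoldt d * d%:R^-1)) * (chi (n %/ d)%N * (n %/ d)%:R^-1)).
  apply: eq_big_nat => n /andP[n1 nx]; rewrite -(sum_mangoldt n1 nx).
  rewrite mulr_suml mulr_sumr; apply: eq_bigr => d dn.
  rewrite -{1 2}(divnK dn) (rcharM chiP) natrM invfM; ring.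
rewrite (sum_divisor_pairs (fun d k => chi d * (mangoldt d * d%:R^-1) * (chi k * k%:R^-1))).
by apply: eq_bigr => d _; rewrite -mulr_sumr.
Qed.

Lemma sum_char_ln_bounded chi (B : R) :
  (forall a b, `|\sum_(a <= n < b) chi n| <= B) ->
  exists C, forall x, `|\sum_(1 <= n < x.+1) chi n * (ln n%:R * n%:R^-1)| <= C.
Proof.
move=> chiB; set F := fun n => chi n * (ln n%:R * n%:R^-1).
(* The quotient ln n / n is seen to decrease once ln n >= 1; cutting at 4 = (1/2)^(-2) makes that
   follow from ln (1/2) <= -1/2. *)
have ln4 : 1 <= ln 4%:R :> R.
  have -> : 4%:R = 2^-1 ^- 2 :> R by field.
  rewrite lnV ?posrE ?exprn_gt0 ?invr_gt0 // lnXn ?invr_gt0 //.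
  have := @le_ln1Dx R (- 2^-1) ltac:(lra).
  have -> : 1 + - 2^-1 = 2^-1 :> R by field.
  by move=> h; rewrite mulr2n; lra.
have tail c : (4 <= c)%N -> `|\sum_(4 <= n < c) F n| <= B * (ln 4%:R * 4%:R^-1).
  move=> _; apply: abel_bound => [//|n n4|n n4]; last first.
    by rewrite mulr_ge0 ?invr_ge0 ?ler0n // ln_ge0 // ler1n; lia.
  have n0 : 0 < n%:R :> R by rewrite ltr0n; lia.
  have n1 : 0 < n.+1%:R :> R by rewrite ltr0n.
  rewrite -(ler_pM2r n0) -(ler_pM2r n1) [leLHS]mulrAC !mulfVK ?gt_eqF //.
  have h : ln n.+1%:R - ln n%:R <= n%:R^-1 :> R by apply: ln_succ; lia.
  have l1 : 1 <= ln n%:R :> R.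
    by apply: le_trans ln4 _; rewrite ler_ln ?posrE ?ltr0n ?ler_nat //; lia.
  have : (ln n.+1%:R - ln n%:R) * n%:R <= 1 :> R by rewrite -ler_pdivlMr // div1r.
  rewrite -natr1; nra.
exists (\sum_(1 <= n < 4) `|F n| + B * (ln 4%:R * 4%:R^-1)) => x.
have B0 : 0 <= B by exact: le_trans (chiB 0 0).
have [x4|x4] := leqP 4 x.+1.
  rewrite (@big_cat_nat _ _ _ 4 1 x.+1) //=.
  by apply: le_trans (ler_normD _ _) (lerD (ler_norm_sum _ _ _) (tail _ x4)).
apply: le_trans (ler_norm_sum _ _ _) _.
rewrite [X in _ <= X + _](@big_cat_nat _ _ _ x.+1 1 4) //=; last exact: ltnW.
rewrite -addrA lerDl addr_ge0 ?sumr_ge0 // mulr_ge0 // mulr_ge0 ?invr_ge0 //; lra.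
Qed.

(** Mertens' argument. In [sum_char_ln], replacing [lsum] at x/d by [lsum] at x costs at most B d/x
    for each d, hence at most 4 B in total by Chebyshev's bound; what remains is [char_mangoldt]
    times [lsum], and the latter is bounded away from 0. *)
Lemma char_mangoldt_bounded chi (B : R) : real_char chi ->
  (forall a b, `|\sum_(a <= n < b) chi n| <= B) ->
  exists C x0, forall x, (x0 <= x)%N -> `|char_mangoldt chi x| <= C.
Proof.
move=> chiP chiB.
have B0 : 0 <= B by exact: le_trans (chiB 0 0).
have [delta [x0 [d0 hd]]] := lsum_bounded_below chiP chiB.
have [C hC] := sum_char_ln_bounded chiB.
exists ((C + 4 * B) / delta), (maxn 1 x0) => x; rewrite geq_max => /andP[x1 xx].
have xR : 0 < x%:R :> R by rewrite ltr0n.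
rewrite ler_pdivlMr //.
apply: (@le_trans _ _ (`|char_mangoldt chi x * lsum chi x|)).
  by rewrite normrM ler_wpM2l //; exact: le_trans (hd x xx) (ler_norm _).
have -> : char_mangoldt chi x * lsum chi x =
    \sum_(1 <= n < x.+1) chi n * (ln n%:R * n%:R^-1) -
    \sum_(1 <= d < x.+1) chi d * (mangoldt d * d%:R^-1) * (lsum chi (x %/ d)%N - lsum chi x).
  rewrite sum_char_ln // -sumrB mulr_suml; apply: eq_bigr => d _; ring.
apply: le_trans (ler_normB _ _) (lerD (hC x) _).
apply: le_trans (ler_norm_sum _ _ _) _.
apply: (@le_trans _ _ (\sum_(1 <= d < x.+1) mangoldt d * (B * x%:R^-1))).
  rewrite big_nat_cond [leRHS]big_nat_cond; apply: ler_sum => d; rewrite andbT => /andP[d1 dx].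
  have dR : 0 < d%:R :> R by rewrite ltr0n.
  rewrite !normrM (ger0_norm (mangoldt_ge0 d)) [`|d%:R^-1|]ger0_norm ?invr_ge0 ?ler0n //.
  have h1 : `|lsum chi (x %/ d)%N - lsum chi x| <= B * (x %/ d).+1%:R^-1.
    by rewrite distrC; apply: lsum_diff => //; exact: leq_div.
  have h2 : B * (x %/ d).+1%:R^-1 <= B * (d%:R * x%:R^-1).
    rewrite ler_wpM2l // -[leRHS]invrK lef_pV2 ?posrE ?ltr0n ?invr_gt0 ?mulr_gt0 ?invr_gt0 //.
    rewrite invfM invrK mulrC ler_pdivrMr // -natrM ler_nat ltnW //.
    exact: ltn_ceil.
  rewrite -[leRHS]mul1r -mulrA ler_pM ?mulr_ge0 ?mangoldt_ge0 ?invr_ge0 ?ler0n ?rchar_norm //.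
  rewrite -mulrA ler_wpM2l ?mangoldt_ge0 //.
  rewrite mulrC ler_pdivrMr //; apply: le_trans (le_trans h1 h2) _.
  by rewrite le_eqVlt; apply/orP; left; apply/eqP; ring.
rewrite -mulr_suml -/(cheb x).
apply: (@le_trans _ _ (4 * x%:R * (B * x%:R^-1))).
  by rewrite ler_wpM2r ?cheb_le // mulr_ge0 // invr_ge0 ltW.
by rewrite le_eqVlt; apply/orP; left; apply/eqP; field; rewrite gt_eqF.
Qed.

(** If [char_mangoldt] were at most M, [sum_char_ln] would give a logarithmic sum of at most M
    [lsum x]; but beyond K, where ln n > 2 M, this sum is at least 2 M ([lsum x] - [lsum K]), which
    is impossible once [lsum x] exceeds 2 [lsum K] + 1. *)
Lemma char_mangoldt_unbounded chi : real_char chi -> (forall n, 0 <= chi n) ->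
  (forall C, exists x, C < lsum chi x) ->
  forall C x0, exists x, (x0 <= x)%N /\ C < char_mangoldt chi x.
Proof.
move=> chiP chi0 unb C x0.
have t0 d : 0 <= chi d * (mangoldt d * d%:R^-1).
  by rewrite !mulr_ge0 ?mangoldt_ge0 ?invr_ge0 ?ler0n.
have lmono x y : (x <= y)%N -> lsum chi x <= lsum chi y.
  move=> xy; rewrite /lsum (@big_cat_nat _ _ _ x.+1 1 y.+1) //= lerDl.
  by apply: sumr_ge0 => n _; rewrite mulr_ge0 ?invr_ge0 ?ler0n.
have mmono x y : (x <= y)%N -> char_mangoldt chi x <= char_mangoldt chi y.
  move=> xy; rewrite /char_mangoldt (@big_cat_nat _ _ _ x.+1 1 y.+1) //= lerDl.
  by apply: sumr_ge0 => n _; exact: t0.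
suff [x hx] : exists x, C < char_mangoldt chi x.
  exists (maxn x0 x); split; first exact: leq_maxl.
  by apply: lt_le_trans hx _; apply: mmono; exact: leq_maxr.
have [K hK] := ln_nat_unbounded (2 * Num.max C 0).
set M := Num.max C 0 in hK; have M0 : 0 <= M by rewrite le_max lexx orbT.
have [x hx] := unb (2 * lsum chi K + 1).
have ls0 y : 0 <= lsum chi y by apply: le_trans (lmono 0 y _); rewrite // /lsum big_geq.
have Kx : (K <= x)%N.
  by rewrite leqNgt; apply/negP => /ltnW/lmono h; have := ls0 K; lra.
exists x; rewrite ltNge; apply/negP => hC.
have hM : char_mangoldt chi x <= M by rewrite le_max hC.
have lo : ln K.+1%:R * (lsum chi x - lsum chi K) <=
    \sum_(1 <= n < x.+1) chi n * (ln n%:R * n%:R^-1).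
  rewrite /lsum (@big_cat_nat _ _ _ K.+1 1 x.+1) //= [X in _ * X <= _]addrC addKr.
  rewrite [leRHS](@big_cat_nat _ _ _ K.+1 1 x.+1) //= -[leLHS]add0r lerD //.
    rewrite big_nat_cond sumr_ge0 // => n; rewrite andbT => /andP[n1 _].
    by rewrite !mulr_ge0 ?invr_ge0 ?ler0n // ln_ge0 // ler1n.
  rewrite mulr_sumr [leLHS]big_nat_cond [leRHS]big_nat_cond.
  apply: ler_sum => n; rewrite andbT => /andP[Kn _].
  rewrite mulrCA ler_wpM2l // ler_wpM2r ?invr_ge0 ?ler0n //.
  by rewrite ler_ln ?posrE ?ltr0n ?ler_nat //; lia.
have hi : \sum_(1 <= n < x.+1) chi n * (ln n%:R * n%:R^-1) <= char_mangoldt chi x * lsum chi x.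
  rewrite sum_char_ln // /char_mangoldt mulr_suml; apply: ler_sum => d _.
  by rewrite ler_wpM2l // lmono // leq_div.
have := ls0 K; move: lo hi hM hK hx.
have := ls0 x.
move: (char_mangoldt chi x) (lsum chi x) (lsum chi K) (ln _) (\sum_(_ <= _ < _) _) => Q s t l S.
move=> s0 lo hi hM hK hx t0'.
have : l * (s - t) <= M * s by nra.
have : 2 * M * (s - t) <= l * (s - t) by nra.
nra.
Qed.

End VonMangoldt.

(** * A prime with prescribed values of independent real characters *)

Section PrescribedCharacters.
Variable R : realType.

Lemma real_charMul (f g : nat -> R) :
  real_char f -> real_char g -> real_char (fun n => f n * g n).
Proof.
move=> fP gP; split=> [|m n|n].
- by rewrite (rchar1 fP) (rchar1 gP) mulr1.
- by rewrite (rcharM fP) (rcharM gP); ring.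
- by case: (rcharV fP n) => ->; case: (rcharV gP n) => ->;
    rewrite ?(mul0r, mulr0, mulr1, mul1r, mulrNN); constructor.
Qed.

Lemma real_char_prod (I : Type) (s : seq I) (P : pred I) (f : I -> nat -> R) :
  (forall i, real_char (f i)) -> real_char (fun n => \prod_(i <- s | P i) f i n).
Proof.
move=> fP; elim: s => [|i s IH].
  by split=> [|m n|n]; rewrite !big_nil ?mulr1 //; constructor 2.
case Pi: (P i); last first.
  split=> [|m n|n]; rewrite !big_cons Pi; by case: IH.
have [h1 h2 h3] := real_charMul (fP i) IH.
by split=> [|m n|n]; rewrite !big_cons Pi.
Qed.

Lemma periodic_sum_bounded (u : nat -> R) (M : nat) : (0 < M)%N ->
  (forall n, u (n + M)%N = u n) -> (forall n, `|u n| <= 1) ->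
  \sum_(0 <= n < M) u n = 0 ->
  forall a b, `|\sum_(a <= n < b) u n| <= (2 * M)%:R.
Proof.
move=> M0 uM u1 s0 a b.
pose U c := \sum_(0 <= n < c) u n.
have UM q r : U (q * M + r)%N = U r.
  elim: q => [|q IH]; first by rewrite mul0n.
  rewrite mulSn -addnA -IH /U (@big_cat_nat _ _ _ M 0) ?leq_addr //= s0 add0r.
  rewrite -{1}[M]add0n big_addn addKn; apply: eq_bigr => n _; exact: uM.
have Ub c : `|U c| <= M%:R.
  rewrite (divn_eq c M) UM; apply: le_trans (ler_norm_sum _ _ _) _.
  apply: (@le_trans _ _ (\sum_(0 <= n < c %% M) 1)); first exact: ler_sum.
  by rewrite sumr_const_nat subn0 ler_nat ltnW // ltn_pmod.
have [ba|ab] := leqP b a; first by rewrite big_geq // normr0 ler0n.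
have -> : \sum_(a <= n < b) u n = U b - U a.
  by rewrite /U (@big_cat_nat _ _ _ a 0 b) //= ?(ltnW ab) // [RHS]addrC addKr.
apply: le_trans (ler_normB _ _) _.
by rewrite mul2n -addnn natrD lerD.
Qed.

Lemma char_period_sum0 (u : nat -> R) (M g : nat) : (0 < M)%N -> real_char u ->
  (forall n, u (n + M)%N = u n) -> coprime M g -> u g = -1 -> \sum_(0 <= n < M) u n = 0.
Proof.
move=> M0 uP uM cg ug.
have umod n : u (n %% M)%N = u n.
  rewrite [in RHS](divn_eq n M) addnC; elim: (n %/ M)%N => [|q IH]; first by rewrite mul0n addn0.
  by rewrite mulSn addnCA addnC uM -IH.
rewrite big_mkord.
have : \sum_(i < M) u i = u g * \sum_(i < M) u i.
  rewrite -[LHS](sum_mulmod _ M0 cg) mulr_sumr; apply: eq_bigr => i _.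
  by rewrite umod (rcharM uP).
by rewrite ug; set s := \sum_(_ < _) _ => e; lra.
Qed.

Variables (I : finType) (chi : I -> nat -> R) (M : nat).
Hypothesis M0 : (0 < M)%N.
Hypothesis chiP : forall i, real_char (chi i).
Hypothesis chi_per : forall i n, chi i (n + M)%N = chi i n.
Hypothesis chi_indep : forall i, exists g,
  [/\ coprime M g, chi i g = -1 & forall j, j != i -> chi j g = 1].

(** As the [chi i] take the values 0, 1, -1, this is the indicator of the n at which none of them
    vanishes: the principal character of the system. Multiplying by it gives all the [subset_char]
    below the same zeros. *)
Definition princ (n : nat) : R := (\prod_i chi i n) * (\prod_i chi i n).
Definition subset_char (A : {set I}) (n : nat) : R := princ n * \prod_(i in A) chi i n.

Lemma princP : real_char princ.
Proof. by apply: real_charMul; exact: real_char_prod. Qed.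

Lemma princ_ge0 n : 0 <= princ n.
Proof. by rewrite /princ -expr2 sqr_ge0. Qed.

Lemma subset_charP A : real_char (subset_char A).
Proof. by apply: real_charMul; [exact: princP | exact: real_char_prod]. Qed.

Lemma princ_per n : princ (n + M)%N = princ n.
Proof. by rewrite /princ; under eq_bigr do rewrite chi_per. Qed.

Lemma subset_char_per A n : subset_char A (n + M)%N = subset_char A n.
Proof.
by rewrite /subset_char princ_per; congr (_ * _); apply: eq_bigr => i _; rewrite chi_per.
Qed.

Lemma subset_char_bounded A : A != set0 ->
  forall a b, `|\sum_(a <= n < b) subset_char A n| <= (2 * M)%:R.
Proof.
move=> /set0Pn[i iA].
have [g [cg gi gj]] := chi_indep i.
apply: periodic_sum_bounded => //; first exact: subset_char_per.
  by move=> n; apply: rchar_norm; exact: subset_charP.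
apply: (char_period_sum0 M0 (subset_charP A) (subset_char_per A) cg).
rewrite /subset_char /princ (bigD1 i) //= (bigD1 i iA) /= gi.
by rewrite !big1 => [|j /andP[_ /gj]|j /gj]; rewrite ?mulr1 ?mulrNN ?mul1r.
Qed.

(** On the progression 1 modulo M, where [princ] is 1, the terms already dominate a harmonic series
    divided by M + 1. *)
Lemma princ_lsum_unbounded C : exists x, C < lsum princ x.
Proof.
have MR : 0 < M.+1%:R :> R by rewrite ltr0n.
have p1 j : princ (j * M + 1)%N = 1.
  elim: j => [|j IH]; first by rewrite mul0n (rchar1 princP).
  by rewrite mulSn -addnA addnC princ_per.
have key K : harm R K / M.+1%:R <= lsum princ (K * M + 1).
  elim: K => [|K IH].
    rewrite /harm big_geq // mul0r /lsum sumr_ge0 // => n _.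
    by rewrite mulr_ge0 ?invr_ge0 ?princ_ge0.
  rewrite /harm big_nat_recr //= -/(harm R K) mulrDl.
  rewrite /lsum (@big_cat_nat _ _ _ (K * M + 1).+1 1) //=; last by rewrite mulSn; lia.
  apply: lerD IH _.
  have -> : (K.+1 * M + 1).+1 = ((K * M + 1) + M).+1 by rewrite mulSn; lia.
  rewrite big_nat_recr /=; last by lia.
  rewrite princ_per p1 mul1r -[leLHS]add0r lerD //.
    by apply: sumr_ge0 => n _; rewrite mulr_ge0 ?invr_ge0 ?princ_ge0.
  rewrite -invfM -natrM lef_pV2 ?posrE ?ltr0n //; last by lia.
  by rewrite ler_nat; nia.
have [K hK] := @harm_unbounded R (C * M.+1%:R).
exists (K * M + 1)%N; apply: lt_le_trans (key K).
by rewrite ltr_pdivlMr.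
Qed.

(* The indicator of the prescribed values is [princ * prod (1 + eps_i chi_i)];
   in its expansion over subsets only the principal term contributes
   unboundedly to the von Mangoldt sums.  A sign [-1] among the [eps_i] forces
   the exponent of the prime power found in this way to be odd. *)
Lemma prime_with_characters (eps : I -> R) (i0 : I) :
  (forall i, eps i = 1 \/ eps i = -1) -> eps i0 = -1 ->
  exists p, prime p /\ forall i, chi i p = eps i.
Proof.
move=> epsP eps0.
have bnd (A : {set I}) : exists Cx : R * nat, A != set0 ->
    forall x, (Cx.2 <= x)%N -> `|char_mangoldt (subset_char A) x| <= Cx.1.
  have [->|An0] := eqVneq A set0; first by exists (0, 0%N).
  have [C [x0 h]] := char_mangoldt_bounded (subset_charP A) (subset_char_bounded An0).
  by exists (C, x0).
have [F FP] := fin_all_exists bnd.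
have [x [xx hx]] := char_mangoldt_unbounded princP princ_ge0 princ_lsum_unbounded (\sum_(A | A != set0) (F A).1) (\max_A (F A).2).
pose h d := princ d * \prod_i (1 + eps i * chi i d).
have hE : \sum_(1 <= d < x.+1) h d * (mangoldt R d * d%:R^-1) =
    \sum_(A : {set I}) (\prod_(i in A) eps i) * char_mangoldt (subset_char A) x.
  transitivity (\sum_(1 <= d < x.+1) \sum_(A : {set I})
     (\prod_(i in A) eps i) * (subset_char A d * (mangoldt R d * d%:R^-1))).
    apply: eq_bigr => d _; rewrite /h.
    have -> : \prod_i (1 + eps i * chi i d) =
        \sum_(A : {set I}) (\prod_(i in A) eps i) * (\prod_(i in A) chi i d).
      under eq_bigr do rewrite addrC.
      rewrite bigA_distr; apply: eq_bigr => A _.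
      by rewrite -big_mkcond -big_split.
    rewrite mulrAC mulr_sumr; apply: eq_bigr => A _; rewrite /subset_char; ring.
  rewrite exchange_big; apply: eq_bigr => A _.
  by rewrite /char_mangoldt mulr_sumr.
have pos : 0 < \sum_(1 <= d < x.+1) h d * (mangoldt R d * d%:R^-1).
  rewrite hE (bigD1 set0) //= big_set0 mul1r.
  have -> : char_mangoldt (subset_char set0) x = char_mangoldt princ x.
    by apply: eq_bigr => d _; rewrite /subset_char big_set0 mulr1.
  have : - (\sum_(A | A != set0) (F A).1) <= \sum_(A : {set I} | A != set0)
      (\prod_(i in A) eps i) * char_mangoldt (subset_char A) x.
    rewrite -sumrN; apply: ler_sum => A An0.
    have : `|(\prod_(i in A) eps i) * char_mangoldt (subset_char A) x| <= (F A).1.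
      rewrite normrM normr_prod big1 => [|i _]; last by case: (epsP i) => ->; rewrite ?normrN normr1.
      rewrite mul1r; apply: FP => //; apply: leq_trans xx; exact: leq_bigmax.
    by rewrite ler_norml => /andP[].
  by move: hx; set u := \sum_(A | _) _; set v := \sum_(A | _) _ => *; lra.
have [d hd] : exists d, h d * (mangoldt R d * d%:R^-1) != 0.
  have [/hasP[d _ hd]|/hasPn no] := boolP (has (fun d => h d * (mangoldt R d * d%:R^-1) != 0)
    (index_iota 1 x.+1)); first by exists d.
  move: pos; rewrite big_seq_cond big1 ?ltxx // => d /andP[din _].
  by have := no d din; rewrite negbK => /eqP.
move: hd; rewrite !mulf_eq0 !negb_or => /andP[/andP[/andP[p0 _] q0] /andP[/mangoldt_neq0[p [j [pp dE]]] _]].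
have val i : chi i d = eps i.
  move/prodf_neq0: p0 => /(_ i isT) c0; move/prodf_neq0: q0 => /(_ i isT).
  case: (epsP i) => ->; case: (rcharV (chiP i) d) => e; rewrite e ?eqxx // in c0 *.
    by rewrite mul1r subrr eqxx.
  by rewrite mulr1 subrr eqxx.
have jE i : chi i d = chi i p ^+ odd j * (chi i p ^+ 2) ^+ j./2.
  by rewrite dE (rcharX (chiP i)) -exprM -exprD mul2n odd_double_half.
have oj : odd j.
  have := val i0; rewrite jE eps0; case: odd => //; rewrite expr0 mul1r => e.
  by have := exprn_ge0 j./2 (sqr_ge0 (chi i0 p)); rewrite e; lra.
exists p; split=> // i; rewrite -val jE oj expr1.
case: (rcharV (chiP i) p) => e; rewrite e ?mul0r //.
  by rewrite !expr1n mulr1.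
by rewrite sqrrN !expr1n mulr1.
Qed.

End PrescribedCharacters.

(** [chi4] is the symbol (-1/n) and [chi8] is (2/n), both tabulated modulo 8. Together they
    determine an odd residue modulo 8 ([chi48_inj]), so a congruence modulo 8 becomes two sign
    conditions. *)
Definition chi4 (n : nat) : int := nth 0 [:: 0; 1; 0; -1; 0; 1; 0; -1] (n %% 8).
Definition chi8 (n : nat) : int := nth 0 [:: 0; 1; 0; -1; 0; -1; 0; 1] (n %% 8).

Lemma chi4M m n : chi4 (m * n) = chi4 m * chi4 n.
Proof.
rewrite /chi4 -modnMm; have := ltn_pmod m (isT : 0 < 8)%N; have := ltn_pmod n (isT : 0 < 8)%N.
by move: (m %% 8)%N (n %% 8)%N => [|[|[|[|[|[|[|[|?]]]]]]]] [|[|[|[|[|[|[|[|?]]]]]]]].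
Qed.

Lemma chi8M m n : chi8 (m * n) = chi8 m * chi8 n.
Proof.
rewrite /chi8 -modnMm; have := ltn_pmod m (isT : 0 < 8)%N; have := ltn_pmod n (isT : 0 < 8)%N.
by move: (m %% 8)%N (n %% 8)%N => [|[|[|[|[|[|[|[|?]]]]]]]] [|[|[|[|[|[|[|[|?]]]]]]]].
Qed.

Lemma chi4V n : [\/ chi4 n = 0, chi4 n = 1 | chi4 n = -1].
Proof.
rewrite /chi4; have := ltn_pmod n (isT : 0 < 8)%N.
by case: (n %% 8)%N => [|[|[|[|[|[|[|[|?]]]]]]]] //= _; first [by constructor 1 | by constructor 2 | by constructor 3].
Qed.

Lemma chi8V n : [\/ chi8 n = 0, chi8 n = 1 | chi8 n = -1].
Proof.
rewrite /chi8; have := ltn_pmod n (isT : 0 < 8)%N.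
by case: (n %% 8)%N => [|[|[|[|[|[|[|[|?]]]]]]]] //= _; first [by constructor 1 | by constructor 2 | by constructor 3].
Qed.

Lemma chi48_inj a b : odd a -> chi4 a = chi4 b -> chi8 a = chi8 b -> (a = b %[mod 8])%N.
Proof.
rewrite -(@odd_mod a 8) // /chi4 /chi8.
have := ltn_pmod a (isT : 0 < 8)%N; have := ltn_pmod b (isT : 0 < 8)%N.
by move: (a %% 8)%N (b %% 8)%N => [|[|[|[|[|[|[|[|?]]]]]]]] [|[|[|[|[|[|[|[|?]]]]]]]].
Qed.

Lemma int_real_char (R : realType) (f : nat -> int) :
  f 1%N = 1 -> (forall m n, f (m * n)%N = f m * f n) ->
  (forall n, [\/ f n = 0, f n = 1 | f n = -1]) -> real_char (fun n => (f n)%:~R : R).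
Proof.
move=> f1 fM fV; split=> [|m n|n]; first by rewrite f1.
  by rewrite fM intrM.
by case: (fV n) => ->; [constructor 1|constructor 2|constructor 3]; rewrite ?mulrN1z.
Qed.

Lemma coprime_prodr (p : nat) (s : seq nat) :
  (forall q, q \in s -> coprime p q) -> coprime p (\prod_(q <- s) q)%N.
Proof.
elim: s => [|q s IH] h; first by rewrite big_nil coprimen1.
rewrite big_cons coprimeMr h ?mem_head //= IH // => q' q's.
by apply: h; rewrite inE q's orbT.
Qed.

Lemma dvdn_prod_mem (p : nat) (s : seq nat) : p \in s -> (p %| \prod_(q <- s) q)%N.
Proof. by move=> ps; rewrite (big_rem p) //= dvdn_mulr. Qed.

Lemma coprime_mod1 (m g : nat) : (g = 1 %[mod m])%N -> coprime m g.
Proof. by move=> h; rewrite -coprime_modr h coprime_modr coprimen1. Qed.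

Lemma legendre_congr p a b : prime p -> odd p -> (a = b %[mod p])%N ->
  legendre p a = legendre p b.
Proof. by move=> pp op h; rewrite -legendre_mod // h legendre_mod. Qed.

Lemma congr_dvd (d m a b : nat) : (d %| m)%N -> (a = b %[mod m])%N -> (a = b %[mod d])%N.
Proof. by move=> dm h; rewrite -(modn_dvdm a dm) h modn_dvdm. Qed.

(** By the Chinese remainder theorem [chi4], [chi8] and the Legendre symbols at finitely many odd
    primes are independent, so [prime_with_characters] applies to them jointly. *)
Lemma prime_with_residues (ps : seq nat) (e : nat -> bool) (a : nat) :
  uniq ps -> (forall p, p \in ps -> prime p && odd p) -> odd a ->
  exists r, [/\ prime r, (r = a %[mod 8])%N & forall p, p \in ps -> legendre p r = (-1) ^+ e p].
Proof.
move=> ups psP oa.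
(* Prescribing a nonresidue at an auxiliary prime provides the sign [-1] that
   [prime_with_characters] needs. *)
have [p0 p0big pp0] := prime_above (2 + \sum_(p <- ps) p).
have p0n : p0 \notin ps.
  by apply/negP => h; move: p0big; rewrite (big_rem p0 h) /=; lia.
have op0 : odd p0.
  by case: (even_prime pp0) => // h; move: p0big; rewrite h; lia.
pose qs := p0 :: ps.
have uqs : uniq qs by rewrite /= p0n.
have qsP p : p \in qs -> prime p && odd p.
  by rewrite inE => /predU1P[->|/psP//]; rewrite pp0.
pose I := (bool + 'I_(size qs))%type.
pose q (i : 'I_(size qs)) := nth 0%N qs i.
have qin i : q i \in qs by exact: mem_nth.
pose R := (Rdefinitions.R : realType).
pose f (i : I) (n : nat) : int :=
  match i with inl false => chi4 n | inl true => chi8 n | inr j => legendre (q j) n end.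
pose M := (8 * \prod_(p <- qs) p)%N.
have P0 : (0 < \prod_(p <- qs) p)%N.
  by rewrite big_seq_cond prodn_cond_gt0 // => p /andP[/qsP/andP[pp _] _]; exact: prime_gt0.
have M0 : (0 < M)%N by rewrite /M muln_gt0.
have qM i : (q i %| M)%N by rewrite /M dvdn_mull // dvdn_prod_mem.
have fP i : real_char (fun n => (f i n)%:~R : R).
  apply: int_real_char; case: i => [[]|j] //=.
  - by have /andP[pp op] := qsP _ (qin j); exact: legendre1.
  - exact: chi8M.
  - exact: chi4M.
  - by have /andP[pp op] := qsP _ (qin j); exact: legendreM.
  - exact: chi8V.
  - exact: chi4V.
  - exact: legendreV.
have fcongr i m n : (m = n %[mod M])%N -> f i m = f i n.
  move=> h; case: i => [[]|j] /=.
  - by rewrite /chi8 (congr_dvd (dvdn_mulr _ (dvdnn 8)) h).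
  - by rewrite /chi4 (congr_dvd (dvdn_mulr _ (dvdnn 8)) h).
  - have /andP[pp op] := qsP _ (qin j).
    by apply: legendre_congr => //; exact: congr_dvd (qM j) h.
have fper i n : (f i (n + M))%:~R = (f i n)%:~R :> R.
  by congr (_%:~R); apply: fcongr; rewrite modnDr.
have c8 : coprime 8 (\prod_(p <- qs) p).
  apply: coprime_prodr => p /qsP/andP[_ op].
  by rewrite (_ : 8%N = (2 ^ 3)%N) // coprimeXl // coprime2n.
have f1 j g : (g = 1 %[mod q j])%N -> legendre (q j) g = 1.
  have /andP[pp op] := qsP _ (qin j).
  by move=> /(legendre_congr pp op)->; exact: legendre1.
have indep i : exists g, [/\ coprime M g, (f i g)%:~R = -1 :> R &
    forall j, j != i -> (f j g)%:~R = 1 :> R].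
  suff [g [h1 h2 h3]] : exists g, [/\ coprime M g, f i g = -1 & forall j, j != i -> f j g = 1].
    by exists g; split=> // [|j /h3->]; rewrite ?h2 ?mulrN1z ?mulr1z.
  case: i => [b|i].
    (* The residue 5 is negative for [chi8] only, and 7 for [chi4] only. *)
    pose c := if b then 5%N else 7%N.
    pose g := chinese 8 (\prod_(p <- qs) p) c 1.
    have g8 : (g %% 8 = c)%N by rewrite /g chinese_modl // /c; case: (b).
    have g1 : (g = 1 %[mod \prod_(p <- qs) p])%N by rewrite /g chinese_modr.
    exists g; split=> [||[b'|j] jb].
    - by rewrite /M coprimeMl (coprime_mod1 g1) andbT -coprime_modr g8 /c; case: (b).
    - by rewrite /f /chi4 /chi8 g8 /c; case: (b).
    - by move: jb; rewrite /f /chi4 /chi8 g8 /c; case: (b); case: (b').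
    - by apply: f1; apply: congr_dvd g1; exact: dvdn_prod_mem.
  have /andP[pp op] := qsP _ (qin i).
  have [n hn] := legendre_nonresidue pp op.
  pose m := (8 * \prod_(p <- rem (q i) qs) p)%N.
  have ME : M = (q i * m)%N by rewrite /M (big_rem (q i)) //= /m; ring.
  have cpm : coprime (q i) m.
    rewrite /m coprimeMr; apply/andP; split.
      by rewrite (_ : 8%N = (2 ^ 3)%N) // coprimeXr // coprimen2.
    apply: coprime_prodr => p; rewrite mem_rem_uniq // inE => /andP[pq /qsP/andP[pp' _]].
    by rewrite prime_coprime // dvdn_prime2 // eq_sym.
  pose g := chinese (q i) m n 1.
  have gp : (g = n %[mod q i])%N by rewrite /g chinese_modl.
  have gm : (g = 1 %[mod m])%N by rewrite /g chinese_modr.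
  have lg : legendre (q i) g = -1 by rewrite (legendre_congr pp op gp).
  have g8 : (g %% 8 = 1)%N by rewrite (congr_dvd (dvdn_mulr _ (dvdnn 8)) gm).
  exists g; split=> // [|[b|j] ji].
  - by rewrite ME coprimeMl (coprime_mod1 gm) andbT prime_coprime // -legendre_eq0 lg.
  - by case: b {ji} => /=; rewrite /chi4 /chi8 g8.
  - apply: f1; apply: congr_dvd gm; rewrite /m dvdn_mull // dvdn_prod_mem //.
    rewrite mem_rem_uniq // inE qin andbT; apply: contra ji => /eqP e'.
    apply/eqP; congr inr; apply/ord_inj/eqP.
    by rewrite -(nth_uniq 0%N (ltn_ord j) (ltn_ord i) uqs); apply/eqP.
pose s (i : I) : int := match i with inl false => chi4 a | inl true => chi8 a
  | inr j => (-1) ^+ (if q j == p0 then true else e (q j)) end.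
have a8 : odd (a %% 8) by rewrite odd_mod.
have sV i : s i = 1 \/ s i = -1.
  case: i => [b|j] /=; last by case: ifP => _; [right | case: (e (q j)); [right|left]].
  have := ltn_pmod a (isT : 0 < 8)%N; rewrite /chi4 /chi8; move: a8.
  by case: b; move: (a %% 8)%N => [|[|[|[|[|[|[|[|?]]]]]]]] //= _ _; first [by left | by right].
have [||r [pr hr]] := @prime_with_characters R I (fun i n => (f i n)%:~R) M M0 fP fper indep
    (fun i => (s i)%:~R) (inr ord0).
- by move=> i; case: (sV i) => ->; [left | right; rewrite mulrN1z].
- by rewrite /= /q /= eqxx expr1 mulrN1z.
have fs i : f i r = s i by apply: (@intr_inj R); exact: hr.
exists r; split=> // [|p pps].
  by apply/esym/chi48_inj => //; [have /= := fs (inl false) | have /= := fs (inl true)].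
have pq : p \in qs by rewrite inE pps orbT.
have ip : (index p qs < size qs)%N by rewrite index_mem.
have := fs (inr (Ordinal ip)); rewrite /= /q /= -/qs nth_index // => ->.
by rewrite ifN //; apply: contraNneq p0n => <-.
Qed.

(** * Rational and integral solutions of ternary equations *)

Lemma nat_sqrt (n : nat) : exists s, (s ^ 2 <= n < s.+1 ^ 2)%N.
Proof.
elim: n => [|n [s /andP[h1 h2]]]; first by exists 0%N.
have [h|h] := ltnP n.+1 (s.+1 ^ 2); first by exists s; rewrite h leqW.
by exists s.+1; rewrite h /=; nia.
Qed.

Lemma sqr_sub_le (a b n : nat) : (a <= n)%N -> (b <= n)%N ->
  (a%:Z - b%:Z) ^+ 2 <= (n ^ 2)%N%:Z.
Proof.
move=> an bn; have h1 : 0 <= n%:Z - (a%:Z - b%:Z) by lia.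
have h2 : 0 <= n%:Z + (a%:Z - b%:Z) by lia.
have -> : (n ^ 2)%N%:Z = (n%:Z - (a%:Z - b%:Z)) * (n%:Z + (a%:Z - b%:Z)) + (a%:Z - b%:Z) ^+ 2.
  by rewrite expnS expn1 PoszM; ring.
by rewrite lerDr mulr_ge0.
Qed.

Lemma sqr_le_eq0 (a b : int) : a ^+ 2 + b ^+ 2 <= 0 -> a = 0 /\ b = 0.
Proof.
move=> h; have := sqr_ge0 a; have := sqr_ge0 b => hb ha.
have /eqP : a ^+ 2 = 0 by lia.
have /eqP : b ^+ 2 = 0 by lia.
by rewrite !sqrf_eq0 => /eqP-> /eqP->.
Qed.

(* A pigeonhole in a box of volume greater than [qc] gives a small vector of the
   lattice on which [z^2 + q u^2 - c w^2] is divisible by [qc]; that multiple can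
   only be [0], [qc] or [2qc], and each of the three leads to a solution. *)
Lemma legendre_equation (c q beta gamma : nat) :
  (0 < c)%N -> (0 < q)%N -> coprime q c ->
  (q%:Z %| beta%:Z ^+ 2 - c%:Z)%Z -> (c%:Z %| gamma%:Z ^+ 2 + q%:Z)%Z ->
  exists z u w : int, w != 0 /\ z ^+ 2 + q%:Z * u ^+ 2 = c%:Z * w ^+ 2.
Proof.
move=> c0 q0 cqc hb hg.
have [A /andP[A1 A2]] := nat_sqrt (q * c); have [C /andP[C1 C2]] := nat_sqrt c.
(* The sides A + 1, C + 1, W + 1 have squares above q c, above c and at least q, so the box has more
   than q c points. Taking the root of q - 1 keeps w^2 < q strict, which is what excludes the
   multiple -1. *)
have [W /andP[W1 W2]] := nat_sqrt q.-1.
pose f (t : 'I_A.+1 * 'I_C.+1 * 'I_W.+1) : 'I_q * 'I_c :=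
  (Ordinal (ltn_pmod (t.1.1 + beta * t.2) q0), Ordinal (ltn_pmod (t.1.1 + gamma * t.1.2) c0)).
have ninj : ~~ injectiveb f.
  apply/negP => /injectiveP/leq_card; rewrite !card_prod !card_ord leqNgt => /negP; apply.
  rewrite -ltn_sqr !expnMn.
  have -> : (q ^ 2 * c ^ 2 = q * c * c * q)%N by ring.
  apply: leq_ltn_trans (_ : q * c * c * W.+1 ^ 2 < _)%N.
    by rewrite leq_mul2l; apply/orP; right; lia.
  rewrite ltn_pmul2r ?expn_gt0 //; apply: ltn_mul => //.
have /injectivePn[[[z1 u1] w1] [[[z2 u2] w2] ne fe]] := ninj.
have [e1 e2] : (z1 + beta * w1 = z2 + beta * w2 %[mod q])%N /\
               (z1 + gamma * u1 = z2 + gamma * u2 %[mod c])%N.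
  by case: fe.
pose z := z1%:Z - z2%:Z; pose u := u1%:Z - u2%:Z; pose w := w1%:Z - w2%:Z.
have d1 : (q%:Z %| z + beta%:Z * w)%Z.
  have -> : z + beta%:Z * w = (z1 + beta * w1)%N%:Z - (z2 + beta * w2)%N%:Z.
    by rewrite !PoszD !PoszM /z /w; ring.
  by rewrite -eqz_mod_dvd !modz_nat e1.
have d2 : (c%:Z %| z + gamma%:Z * u)%Z.
  have -> : z + gamma%:Z * u = (z1 + gamma * u1)%N%:Z - (z2 + gamma * u2)%N%:Z.
    by rewrite !PoszD !PoszM /z /u; ring.
  by rewrite -eqz_mod_dvd !modz_nat e2.
set V := z ^+ 2 + q%:Z * u ^+ 2 - c%:Z * w ^+ 2.
have dq : (q%:Z %| V)%Z.
  have -> : V = (z + beta%:Z * w) * (z - beta%:Z * w) + (beta%:Z ^+ 2 - c%:Z) * w ^+ 2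
    + q%:Z * u ^+ 2 by rewrite /V; ring.
  by rewrite !rpredD ?dvdz_mulr // dvdz_mulr.
have dc : (c%:Z %| V)%Z.
  have -> : V = (z + gamma%:Z * u) * (z - gamma%:Z * u) + (gamma%:Z ^+ 2 + q%:Z) * u ^+ 2
    - c%:Z * w ^+ 2 by rewrite /V; ring.
  by rewrite !rpredB ?rpredD ?dvdz_mulr // dvdz_mulr.
have /dvdzP[k Vk] : (q%:Z * c%:Z %| V)%Z by rewrite Gauss_dvdz ?dq.
have zb : z ^+ 2 <= q%:Z * c%:Z.
  by rewrite -PoszM; apply: le_trans (sqr_sub_le (leq_ord z1) (leq_ord z2)) _.
have ub : u ^+ 2 <= c%:Z.
  by apply: le_trans (sqr_sub_le (leq_ord u1) (leq_ord u2)) _.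
have wb : w ^+ 2 < q%:Z.
  by apply: le_lt_trans (sqr_sub_le (leq_ord w1) (leq_ord w2)) _; rewrite ltz_nat -(prednK q0) ltnS.
have nz : [|| z != 0, u != 0 | w != 0].
  apply: contraNT ne; rewrite !negb_or !negbK !subr_eq0 !eqz_nat => /and3P[/eqP a /eqP b /eqP d].
  by apply/eqP; congr (_, _, _); apply: ord_inj.
have qZ : 0 < q%:Z by []. have cZ : 0 < c%:Z by [].
have qcZ : 0 < q%:Z * c%:Z by exact: mulr_gt0.
have qu : q%:Z * u ^+ 2 <= q%:Z * c%:Z by rewrite ler_pM2l.
have cw : c%:Z * w ^+ 2 < q%:Z * c%:Z by rewrite [ltRHS]mulrC ltr_pM2l.
have z0 := sqr_ge0 z; have u0 := mulr_ge0 (ltW qZ) (sqr_ge0 u).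
have w0 := mulr_ge0 (ltW cZ) (sqr_ge0 w).
have k3 : (k == 0) || (k == 1) || (k == 2).
  have l1 : -1 < k by rewrite -(ltr_pM2r qcZ) mulN1r -Vk /V; clear -z0 u0 w0 zb qu cw; lia.
  have l2 : k <= 2 by rewrite -(ler_pM2r qcZ) -Vk /V; clear -z0 u0 w0 zb qu cw; lia.
  by clear -l1 l2; lia.
clear hb hg A1 A2 C1 C2 W1 W2 ninj fe e1 e2 d1 d2 dq dc.
case/orP: k3 => [/orP[]|] /eqP k3; rewrite k3 /V in Vk.
- have E : z ^+ 2 + q%:Z * u ^+ 2 = c%:Z * w ^+ 2 by clear -Vk; lia.
  exists z, u, w; split=> //; apply: contraL nz => /eqP w'0.
  have z'0 : z ^+ 2 = 0 by rewrite w'0 expr0n mulr0 in E; clear -E z0 u0; lia.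
  have : q%:Z * u ^+ 2 = 0 by rewrite w'0 expr0n mulr0 in E; clear -E z0 u0; lia.
  move/eqP; rewrite mulf_eq0 sqrf_eq0 (gt_eqF qZ) /= => ->.
  by move/eqP: z'0; rewrite sqrf_eq0 w'0 => ->.
(* Here z^2 + q u^2 = c (w^2 + q). Multiplying by w^2 + q, itself a value of the norm form X^2 + q
   Y^2, turns the right side into c times a square. *)
- exists (z * w - q%:Z * u), (z + u * w), (w ^+ 2 + q%:Z); split.
    by rewrite gt_eqF // ltr_wpDl // sqr_ge0.
  have -> : (z * w - q%:Z * u) ^+ 2 + q%:Z * (z + u * w) ^+ 2 =
    (z ^+ 2 + q%:Z * u ^+ 2) * (w ^+ 2 + q%:Z) by ring.
  have -> : z ^+ 2 + q%:Z * u ^+ 2 = c%:Z * (w ^+ 2 + q%:Z).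
    by rewrite mulrDr [X in _ + X]mulrC; clear -Vk; lia.
  by ring.
(* The multiple 2 q c is reached only if all bounds are attained; in particular u^2 = c. *)
- exists u, 0, 1; split=> //; rewrite expr0n mulr0 addr0 expr1n mulr1.
  by apply: (mulfI (lt0r_neq0 qZ)); clear -Vk zb qu w0; lia.
Qed.

Lemma int_parity (s : int) : (exists a, s = 2 * a) \/ (exists a, s = 2 * a + 1).
Proof.
have h3 := divz_eq s 2; have h2 := ltz_pmod s (isT : 0 < 2 :> int).
have h1 := modz_ge0 s (isT : 2 != 0 :> int).
have [e|e] : (s %% 2)%Z = 0 \/ (s %% 2)%Z = 1 by clear -h1 h2; lia.
  by left; exists (s %/ 2)%Z; clear -h3 e; lia.
by right; exists (s %/ 2)%Z; clear -h3 e; lia.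
Qed.

Lemma int_round (x t : int) : 0 < t -> exists a, - t <= 2 * (x - t * a) < t.
Proof.
move=> t0; exists ((2 * x + t) %/ (2 * t))%Z.
have := divz_eq (2 * x + t) (2 * t).
have := modz_ge0 (2 * x + t) (lt0r_neq0 (mulr_gt0 (isT : 0 < 2 :> int) t0)).
have := ltz_pmod (2 * x + t) (mulr_gt0 (isT : 0 < 2 :> int) t0).
nia.
Qed.

Lemma sqr_le_of_bounds (a t : int) : - t <= a -> a <= t -> a ^+ 2 <= t ^+ 2.
Proof.
move=> h1 h2; have : 0 <= (t - a) * (t + a) by rewrite mulr_ge0 //; lia.
have -> : (t - a) * (t + a) = t ^+ 2 - a ^+ 2 by ring.
by lia.
Qed.

(* The half-open cell is chosen so that, for [e = 1], the extreme value
   [1/4 + 3/4 = 1] of the form is not attained. *)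
Lemma rounding_cell (e X Y Z t : int) : (e == 0) || (e == 1) -> 0 < t ->
  - t <= 2 * X < t -> - t <= 2 * Y < t -> - t < 2 * Z <= t ->
  let f := X ^+ 2 + Y ^+ 2 + e * (Y * Z) + Z ^+ 2 in
  [/\ f < t ^+ 2, 0 <= f & f = 0 -> [/\ X = 0, Y = 0 & Z = 0]].
Proof.
move=> e01 t0 /andP[x1 x2] /andP[y1 y2] /andP[z1 z2] f.
have X2 := sqr_le_of_bounds x1 (ltW x2); have Y2 := sqr_le_of_bounds y1 (ltW y2).
have Z2 := sqr_le_of_bounds (ltW z1) z2; rewrite !exprMn in X2 Y2 Z2.
have t2 : 0 < t ^+ 2 by rewrite exprn_gt0.
have sX := sqr_ge0 X; have sY := sqr_ge0 Y; have sZ := sqr_ge0 Z.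
have eF : 4 * (e * (Y * Z)) < t ^+ 2.
  case/orP: e01 => /eqP->; first by rewrite mul0r mulr0.
  rewrite mul1r.
  have : (2 * Y) * (2 * Z) < t ^+ 2.
    rewrite expr2; have [Y0|Y0] := lerP 0 Y; have [Z0|Z0] := lerP 0 Z.
    - apply: (@le_lt_trans _ _ ((2 * Y) * t)); first by rewrite ler_wpM2l //; lia.
      by rewrite ltr_pM2r.
    - apply: (@le_lt_trans _ _ 0); last by rewrite mulr_gt0.
      by rewrite mulr_ge0_le0 //; lia.
    - apply: (@le_lt_trans _ _ 0); last by rewrite mulr_gt0.
      by rewrite mulr_le0_ge0 //; lia.
    - rewrite -mulrNN; apply: (@le_lt_trans _ _ (t * (- (2 * Z)))).
        by rewrite ler_wpM2r //; lia.
      by rewrite ltr_pM2l //; lia.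
  by rewrite mulrACA.
have low : 2 * f = 2 * X ^+ 2 + e * (Y + Z) ^+ 2 + (2 - e) * (Y ^+ 2 + Z ^+ 2) by rewrite /f; ring.
have sYZ := sqr_ge0 (Y + Z).
have e0 : 0 <= e * (Y + Z) ^+ 2 by rewrite mulr_ge0 //; case/orP: e01 => /eqP->.
have e1 : Y ^+ 2 + Z ^+ 2 <= (2 - e) * (Y ^+ 2 + Z ^+ 2).
  by case/orP: e01 => /eqP->; lia.
split; first by rewrite /f; lia.
  by lia.
move=> fz; rewrite fz in low.
have [-> ->] : Y = 0 /\ Z = 0 by apply: sqr_le_eq0; lia.
have [-> _] : X = 0 /\ X = 0 by apply: sqr_le_eq0; lia.
by [].
Qed.

(** Descent on the denominator: the line from the rational point (x, y, z)/t to a nearby lattice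
    point (a, b, c) meets the quadric again in a point of denominator t', where t t' is the value of
    the form at (x, y, z) - t (a, b, c), hence below t^2. *)
Lemma davenport_cassels (e n x y z t : int) : (e == 0) || (e == 1) -> t != 0 ->
  x ^+ 2 + y ^+ 2 + e * (y * z) + z ^+ 2 = n * t ^+ 2 ->
  exists a b c : int, a ^+ 2 + b ^+ 2 + e * (b * c) + c ^+ 2 = n.
Proof.
move=> e01.
have [N] := ubnP `|t|%N; elim: N x y z t => // N IH x y z t tN t0 E.
wlog tpos : t tN t0 E / 0 < t.
  move=> h; have [tp|tn] := ltrP 0 t; first exact: (h t).
  apply: (h (- t)); rewrite ?abszN ?oppr_eq0 ?sqrrN // oppr_gt0 lt_neqAle t0 //.
have [a /andP[a1 a2]] := int_round x tpos.
have [b /andP[b1 b2]] := int_round y tpos.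
(* Rounding -z and negating reverses the half-open interval in this coordinate, so Y and Z cannot
   both sit at the same end of the cell. *)
have [c' /andP[c1' c2']] := int_round (- z) tpos.
pose c := - c'.
have c1 : - t < 2 * (z - t * c) by rewrite /c; lia.
have c2 : 2 * (z - t * c) <= t by rewrite /c; lia.
pose X := x - t * a; pose Y := y - t * b; pose Z := z - t * c.
pose f u v w : int := u ^+ 2 + v ^+ 2 + e * (v * w) + w ^+ 2.
pose B := 2 * (x * a) + 2 * (y * b) + e * (y * c + z * b) + 2 * (z * c).
pose t' := n * t - B + t * f a b c.
have ft : f X Y Z = t * t'.
  have -> : f X Y Z = (x ^+ 2 + y ^+ 2 + e * (y * z) + z ^+ 2) - t * B + t ^+ 2 * f a b c.
    by rewrite /f /X /Y /Z /B; ring.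
  by rewrite E /t'; ring.
have [flt f0 fz] : [/\ f X Y Z < t ^+ 2, 0 <= f X Y Z & f X Y Z = 0 -> [/\ X = 0, Y = 0 & Z = 0]].
  by apply: rounding_cell; rewrite // /X /Y /Z ?a1 ?b1 ?c1.
have [t'0|t'0] := eqVneq t' 0.
  rewrite t'0 mulr0 in ft; have [X0 Y0 Z0] := fz ft.
  exists a, b, c.
  have xE : x = t * a by rewrite /X in X0; move: X0; clear; lia.
  have yE : y = t * b by rewrite /Y in Y0; move: Y0; clear; lia.
  have zE : z = t * c by rewrite /Z in Z0; move: Z0; clear; lia.
  apply: (mulIf (expf_neq0 2 t0)); rewrite -E xE yE zE; ring.
have t'p : 0 < t' by rewrite ft pmulr_rge0 // in f0; rewrite lt_neqAle eq_sym t'0.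
have t'lt : t' < t by rewrite ft expr2 ltr_pM2l // in flt.
(* The second intersection point is A (x, y, z, t) + D (a, b, c, 1) in homogeneous coordinates; its
   last coordinate is t'. *)
pose A := f a b c - n; pose D := 2 * (n * t) - B.
apply: (IH (A * x + D * a) (A * y + D * b) (A * z + D * c) t') => //.
  by move: tN t'p t'lt; clear; lia.
have -> : (A * x + D * a) ^+ 2 + (A * y + D * b) ^+ 2
  + e * ((A * y + D * b) * (A * z + D * c)) + (A * z + D * c) ^+ 2 =
  A ^+ 2 * (x ^+ 2 + y ^+ 2 + e * (y * z) + z ^+ 2) + A * D * B + D ^+ 2 * f a b c.
  by rewrite /B /f; ring.
rewrite E (_ : B = 2 * (n * t) - D); last by rewrite /D; ring.
rewrite (_ : f a b c = A + n); last by rewrite /A; ring.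
rewrite (_ : t' = A * t + D); first by ring.
by rewrite /t' /A /D; ring.
Qed.

(** * Three squares and [x^2 + y^2 + 3 z^2] *)

Lemma squarefree_part (m : nat) : (0 < m)%N -> exists ps k,
  [/\ uniq ps, forall p, p \in ps -> prime p & m = (\prod_(p <- ps) p * k ^ 2)%N].
Proof.
have [N] := ubnP m; elim: N m => // N IH m mN m0.
have [m1|m1] := leqP m 1.
  by exists [::], 1%N; split=> //; rewrite big_nil; lia.
have pp := pdiv_prime m1; have /dvdnP[m' mE] := pdiv_dvd m; set p := pdiv m in pp mE.
have p1 := prime_gt1 pp.
have [||ps [k [ups psP E]]] := IH m'; [by nia | by nia |].
have [pin|pnin] := boolP (p \in ps).
  exists (rem p ps), (p * k)%N; split; first exact: rem_uniq.
    by move=> q /mem_rem; exact: psP.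
  by rewrite mE E (big_rem p) //=; ring.
exists (p :: ps), k; split; first by rewrite /= pnin.
  by move=> q; rewrite inE => /predU1P[->|/psP].
by rewrite mE E big_cons; ring.
Qed.

Lemma crt_sqrt (ps : seq nat) (a : int) : uniq ps -> (forall p, p \in ps -> prime p) ->
  (forall p, p \in ps -> exists b : nat, (p%:Z %| b%:Z ^+ 2 - a)%Z) ->
  exists b : nat, ((\prod_(p <- ps) p)%N%:Z %| b%:Z ^+ 2 - a)%Z.
Proof.
elim: ps => [|p ps IH] /=; first by exists 0%N; rewrite big_nil dvd1z.
move=> /andP[pnin ups] psP h.
have [||b hb] := IH ups.
- by move=> q qs; apply: psP; rewrite inE qs orbT.
- by move=> q qs; apply: h; rewrite inE qs orbT.
have [c hc] := h p (mem_head _ _).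
have cp : coprime p (\prod_(q <- ps) q).
  apply: coprime_prodr => q qs; rewrite prime_coprime ?psP ?mem_head //.
  rewrite dvdn_prime2 ?psP ?mem_head // ?inE ?qs ?orbT //.
  by apply: contraNneq pnin => ->.
set P := (\prod_(q <- ps) q)%N in hb cp *.
pose g := chinese p P c b.
have key (d x y : nat) : (x = y %[mod d])%N -> (d%:Z %| y%:Z ^+ 2 - a)%Z -> (d%:Z %| x%:Z ^+ 2 - a)%Z.
  move=> /eqP; rewrite -eqz_nat -!modz_nat eqz_mod_dvd => h1 h2.
  have -> : x%:Z ^+ 2 - a = (x%:Z - y%:Z) * (x%:Z + y%:Z) + (y%:Z ^+ 2 - a) by ring.
  by rewrite rpredD // dvdz_mulr.
exists g; rewrite big_cons -/P PoszM Gauss_dvdz //; apply/andP; split.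
  by apply: key hc; rewrite /g chinese_modl.
by apply: key hb; rewrite /g chinese_modr.
Qed.

Lemma legendre_sqrtz p a : prime p -> odd p -> legendre p a = 1 ->
  exists b : nat, (p%:Z %| b%:Z ^+ 2 - a%:Z)%Z.
Proof.
move=> pp op /(legendre_sqrt pp op)[b hb]; exists b.
rewrite -eqz_mod_dvd -[_ ^+ 2]/(b%:Z * b%:Z) -PoszM !modz_nat.
by rewrite -[(b * b)%N]/(b ^ 2)%N hb.
Qed.

Lemma legendre_sqrtzN p a : prime p -> odd p -> legendre p (a * p.-1) = 1 ->
  exists b : nat, (p%:Z %| b%:Z ^+ 2 - - a%:Z)%Z.
Proof.
move=> pp op /(legendre_sqrtz pp op)[b hb]; exists b.
have -> : b%:Z ^+ 2 - - a%:Z = (b%:Z ^+ 2 - (a * p.-1)%N%:Z) + a%:Z * p%:Z.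
  have -> : p%:Z = p.-1%:Z + 1 by have := prime_gt0 pp; clear; lia.
  by rewrite PoszM; ring.
by rewrite rpredD // dvdz_mull.
Qed.

Lemma legendre_prod r (ps : seq nat) : prime r -> odd r ->
  legendre r (\prod_(p <- ps) p)%N = \prod_(p <- ps) legendre r p.
Proof.
move=> rp orr; elim: ps => [|p ps IH]; first by rewrite !big_nil legendre1.
by rewrite !big_cons legendreM // IH.
Qed.

Lemma chi4_prod (ps : seq nat) : chi4 (\prod_(p <- ps) p)%N = \prod_(p <- ps) chi4 p.
Proof. by elim: ps => [|p ps IH]; rewrite ?big_nil // !big_cons chi4M IH. Qed.

Lemma chi8_prod (ps : seq nat) : chi8 (\prod_(p <- ps) p)%N = \prod_(p <- ps) chi8 p.
Proof. by elim: ps => [|p ps IH]; rewrite ?big_nil // !big_cons chi8M IH. Qed.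

Lemma legendre_chi4 p : prime p -> odd p -> legendre p p.-1 = chi4 p.
Proof.
move=> pp op; rewrite legendreN1_mod4 // /chi4 -(@modn_dvdm 8 p 4) //.
have := ltn_pmod p (isT : 0 < 8)%N; have : odd (p %% 8) by rewrite odd_mod.
by move: (p %% 8)%N => [|[|[|[|[|[|[|[|?]]]]]]]].
Qed.

Lemma legendre_chi48 p : prime p -> odd p -> legendre p (2 * p.-1) = chi4 p * chi8 p.
Proof.
move=> pp op; rewrite legendreN2 // /chi4 /chi8.
have := ltn_pmod p (isT : 0 < 8)%N; have : odd (p %% 8) by rewrite odd_mod.
by move: (p %% 8)%N => [|[|[|[|[|[|[|[|?]]]]]]]].
Qed.

Lemma prime_with_legendre (ps : seq nat) (f : nat -> nat) (a : nat) :
  uniq ps -> (forall p, p \in ps -> prime p && odd p) -> odd a ->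
  (forall p, p \in ps -> ~~ (p %| f p)%N) ->
  exists r, [/\ prime r, odd r, (r = a %[mod 8])%N, r \notin ps &
    forall p, p \in ps -> legendre p r = legendre p (f p)].
Proof.
move=> ups psP oa f0.
have [r [rp r8 hr]] := prime_with_residues (fun p => legendre p (f p) == -1) ups psP oa.
exists r; split=> // [||p pin].
- by rewrite -(@odd_mod r 8) // r8 odd_mod.
- apply/negP => rin; have := hr r rin; rewrite {1}/legendre dvdnn.
  by case: (_ == _).
- rewrite hr //; have := f0 p pin; rewrite -legendre_eq0.
  by case: (legendreV p (f p)) => ->.
Qed.

Lemma sum_sqr_prime (d r : nat) : prime r -> odd r -> (0 < d)%N -> coprime d r ->
  legendre r (d * r.-1) = 1 -> (exists b : nat, (d%:Z %| b%:Z ^+ 2 - r%:Z)%Z) ->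
  exists z u w : int, w != 0 /\ z ^+ 2 + d%:Z * u ^+ 2 = r%:Z * w ^+ 2.
Proof.
move=> rp orr d0 cdr /(legendre_sqrtzN rp orr)[g hg] [b hb].
by apply: (@legendre_equation r d b g) => //; rewrite ?prime_gt0 // -[d%:Z]opprK.
Qed.

Lemma coprime_prime_prod r (ps : seq nat) : prime r -> (forall p, p \in ps -> prime p) ->
  r \notin ps -> coprime r (\prod_(p <- ps) p)%N.
Proof.
move=> rp psP rn; apply: coprime_prodr => q qs.
by rewrite prime_coprime // dvdn_prime2 ?(psP _ qs) //; apply: contraNneq rn => ->.
Qed.

Lemma not_dvdn_pred p : prime p -> ~~ (p %| p.-1)%N.
Proof. by move=> pp; apply/negP => /dvdn_leq; have := prime_gt1 pp; lia. Qed.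

(** * Rational representations of squarefree odd numbers and their multiples by 2 and 3 *)

Section Rational.
Variable ps : seq nat.
Hypotheses (ups : uniq ps) (psP : forall p, p \in ps -> prime p && odd p).
Let m := (\prod_(p <- ps) p)%N.

Let psprime p : p \in ps -> prime p. Proof. by move/psP/andP; case. Qed.
Let psodd p : p \in ps -> odd p. Proof. by move/psP/andP; case. Qed.

Let m_gt0 : (0 < m)%N.
Proof. by rewrite /m big_seq_cond prodn_cond_gt0 // => p /andP[/psprime/prime_gt0]. Qed.

Let m_odd : odd m.
Proof.
rewrite -coprime2n; apply: coprime_prodr => p /psodd op; by rewrite coprime2n.
Qed.

Let solve (q : nat) : (0 < q)%N -> coprime q m ->
  (forall p, p \in ps -> legendre p (q * p.-1) = 1) ->
  (exists b : nat, (q%:Z %| b%:Z ^+ 2 - m%:Z)%Z) ->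
  exists z u w : int, w != 0 /\ z ^+ 2 + q%:Z * u ^+ 2 = m%:Z * w ^+ 2.
Proof.
move=> q0 cq hq [b hb].
have [g hg] : exists g : nat, (m%:Z %| g%:Z ^+ 2 - - q%:Z)%Z.
  apply: crt_sqrt => // p pin; apply: legendre_sqrtzN; rewrite ?psprime ?psodd //.
  exact: hq.
by apply: (@legendre_equation m q b g) => //; rewrite -[q%:Z]opprK.
Qed.

(** Take r = 1 modulo 8 with (r/p) = (-1/p) for all p dividing m. Then -r is a square modulo m, and
    by reciprocity (m/r) is the product of the [chi4 p], that is [chi4 m] = 1. So m is z^2 + r u^2
    over the rationals, and r is a sum of two rational squares. *)
Lemma rational_three_squares_1mod4 : (m %% 4 = 1)%N ->
  exists x y z t : int, t != 0 /\ x ^+ 2 + y ^+ 2 + z ^+ 2 = m%:Z * t ^+ 2.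
Proof.
move=> m4.
have [|r [rp orr r8 rn hr]] := @prime_with_legendre ps predn 1 ups psP isT.
  by move=> p /psprime; exact: not_dvdn_pred.
have r4 : (r %% 4 = 1)%N by rewrite -(@modn_dvdm 8) // r8.
have rec p : p \in ps -> legendre r p = chi4 p.
  move=> pin; rewrite (quadratic_reciprocity rp orr (psprime pin) (psodd pin)) ?r4 /=; last first.
    by apply: contraNneq rn => ->.
  by rewrite hr // legendre_chi4 ?psprime ?psodd.
have lm : legendre r m = 1.
  rewrite legendre_prod // (eq_big_seq chi4) // -chi4_prod /chi4.
  move: m4; rewrite -/m -(@modn_dvdm 8 m 4) //; have := ltn_pmod m (isT : 0 < 8)%N.
  by move: (m %% 8)%N => [|[|[|[|[|[|[|[|?]]]]]]]].
have [||||z [u [w [w0 E]]]] := @solve r.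
- exact: prime_gt0.
- exact: coprime_prime_prod.
- move=> p pin; rewrite legendreM ?psprime ?psodd // hr // -legendreM ?psprime ?psodd //.
  by rewrite legendre_sqr ?psprime ?psodd ?not_dvdn_pred ?psprime.
- exact: legendre_sqrtz.
have [||||z' [u' [w' [w'0 E']]]] := @sum_sqr_prime 1 r rp orr; rewrite ?coprime1n //.
- by rewrite mul1n legendreN1_mod4 // r4.
- by exists 0%N; rewrite dvd1z.
exists (z * w'), (u * z'), (u * u'), (w * w'); split; first by rewrite mulf_neq0.
transitivity (z ^+ 2 * w' ^+ 2 + u ^+ 2 * (z' ^+ 2 + 1%:Z * u' ^+ 2)); first by ring.
rewrite E'; transitivity ((z ^+ 2 + r%:Z * u ^+ 2) * w' ^+ 2); first by ring.
by rewrite E; ring.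
Qed.

(** Now (m/r) = [chi4 m] would be -1 with the previous r, so 2 r replaces r: with (r/p) = (-2/p) the
    symbol becomes [chi4 m] times [chi8 m], which is 1. Twice a sum of two squares is again one. *)
Lemma rational_three_squares_3mod8 : (m %% 8 = 3)%N ->
  exists x y z t : int, t != 0 /\ x ^+ 2 + y ^+ 2 + z ^+ 2 = m%:Z * t ^+ 2.
Proof.
move=> m8.
have n2 p : p \in ps -> ~~ (p %| 2 * p.-1)%N.
  move=> pin; have pp := psprime pin; rewrite Euclid_dvdM // negb_or not_dvdn_pred // andbT.
  by rewrite dvdn_prime2 //; apply/eqP => p2; have := psodd pin; rewrite p2.
have [//|r [rp orr r8 rn hr]] := @prime_with_legendre ps (fun p => 2 * p.-1)%N 1 ups psP isT.
have r4 : (r %% 4 = 1)%N by rewrite -(@modn_dvdm 8) // r8.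
have rec p : p \in ps -> legendre r p = chi4 p * chi8 p.
  move=> pin; rewrite (quadratic_reciprocity rp orr (psprime pin) (psodd pin)) ?r4 /=; last first.
    by apply: contraNneq rn => ->.
  by rewrite hr // legendre_chi48 ?psprime ?psodd.
have lm : legendre r m = 1.
  rewrite legendre_prod // (eq_big_seq (fun p => chi4 p * chi8 p)) // big_split /=.
  by rewrite -chi4_prod -chi8_prod /chi4 /chi8 m8.
have [||||z [u [w [w0 E]]]] := @solve (2 * r).
- by rewrite muln_gt0 (prime_gt0 rp).
- by rewrite coprimeMl coprime2n m_odd (coprime_prime_prod rp psprime rn).
- move=> p pin; rewrite mulnAC legendreM ?psprime ?psodd // hr // -legendreM ?psprime ?psodd //.
  by rewrite legendre_sqr ?psprime ?psodd ?n2.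
- have := @crt_sqrt [:: 2; r] m%:Z; rewrite !big_cons big_nil muln1; apply.
  + by rewrite /= inE andbT; apply/eqP => r2; rewrite -r2 in orr.
  + by move=> p; rewrite !inE => /orP[]/eqP->.
  move=> p; rewrite !inE => /orP[]/eqP->; last exact: legendre_sqrtz.
  exists 1%N; move: m_odd; rewrite -eqz_mod_dvd expr1n modz_nat modn2 => ->.
  by [].
have [||||z' [u' [w' [w'0 E']]]] := @sum_sqr_prime 1 r rp orr; rewrite ?coprime1n //.
- by rewrite mul1n legendreN1_mod4 // r4.
- by exists 0%N; rewrite dvd1z.
exists (z * w'), (u * (z' + u')), (u * (z' - u')), (w * w'); split; first by rewrite mulf_neq0.
transitivity (z ^+ 2 * w' ^+ 2 + 2%:Z * u ^+ 2 * (z' ^+ 2 + 1%:Z * u' ^+ 2)); first by ring.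
rewrite E'; transitivity ((z ^+ 2 + (2 * r)%N%:Z * u ^+ 2) * w' ^+ 2); first by rewrite PoszM; ring.
by rewrite E; ring.
Qed.

(** With r = 3 modulo 4, reciprocity gives (p/r) = (-r/p) = 1 for each p, hence no condition on m.
    As r = 3 modulo 8, r has the rational form z'^2 + 2 u'^2, and doubling z^2 + r u^2 then gives
    three squares. *)
Lemma rational_three_squares_double :
  exists x y z t : int, t != 0 /\ x ^+ 2 + y ^+ 2 + z ^+ 2 = (2 * m)%N%:Z * t ^+ 2.
Proof.
have [|r [rp orr r8 rn hr]] := @prime_with_legendre ps predn 3 ups psP isT.
  by move=> p /psprime; exact: not_dvdn_pred.
have r4 : (r %% 4 = 3)%N by rewrite -(@modn_dvdm 8) // r8.
have sq p : p \in ps -> legendre p (r * p.-1) = 1.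
  move=> pin; rewrite legendreM ?psprime ?psodd // hr // -legendreM ?psprime ?psodd //.
  by rewrite legendre_sqr ?psprime ?psodd ?not_dvdn_pred ?psprime.
have lm : legendre r m = 1.
  rewrite legendre_prod // (eq_big_seq (fun=> 1)) ?big1_eq // => p pin.
  rewrite (quadratic_reciprocity rp orr (psprime pin) (psodd pin)) ?r4 ?sq //.
  by apply: contraNneq rn => ->.
have [||||z [u [w [w0 E]]]] := @solve r => //.
- exact: prime_gt0.
- exact: coprime_prime_prod.
- exact: legendre_sqrtz.
have [||||z' [u' [w' [w'0 E']]]] := @sum_sqr_prime 2 r rp orr; rewrite ?coprime2n //.
- by rewrite legendreN2 // r8.
- exists 1%N; rewrite -eqz_mod_dvd expr1n modz_nat modn2 orr.
  by [].
exists (z * w' + u * z'), (z * w' - u * z'), (2 * (u * u')), (w * w').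
split; first by rewrite mulf_neq0.
transitivity (2 * (z ^+ 2 * w' ^+ 2 + u ^+ 2 * (z' ^+ 2 + 2%:Z * u' ^+ 2))); first by ring.
rewrite E'; transitivity (2 * ((z ^+ 2 + r%:Z * u ^+ 2) * w' ^+ 2)); first by ring.
by rewrite E PoszM; ring.
Qed.

Hypothesis p3 : 3%N \notin ps.

Let ups3 : uniq (3%N :: ps). Proof. by rewrite /= p3. Qed.
Let psP3 p : p \in 3%N :: ps -> prime p && odd p.
Proof. by rewrite inE => /predU1P[->|/psP]. Qed.

(** Again (p/r) = (-r/p) = 1 for each p; the extra condition (r/3) = 1 makes r a rational value of
    z'^2 + 3 u'^2. *)
Lemma rational_113 :
  exists x y z t : int, t != 0 /\ x ^+ 2 + y ^+ 2 + 3 * z ^+ 2 = m%:Z * t ^+ 2.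
Proof.
have [|r [rp orr r8 rn hr]] := @prime_with_legendre (3%N :: ps)
    (fun p => if p == 3%N then 1%N else p.-1) 3 ups3 psP3 isT.
  move=> p /psP3/andP[pp _]; case: eqP => _; last exact: not_dvdn_pred.
  by rewrite dvdn1 gtn_eqF ?prime_gt1.
rewrite inE negb_or in rn; case/andP: rn => r3 rn.
have l3 : legendre 3 r = 1 by rewrite hr ?mem_head // legendre1.
have hr' p : p \in ps -> legendre p r = legendre p p.-1.
  move=> pin; rewrite hr ?inE ?pin ?orbT // ifN //.
  by apply: contraNneq p3 => <-.
have r4 : (r %% 4 = 3)%N by rewrite -(@modn_dvdm 8) // r8.
have sq p : p \in ps -> legendre p (r * p.-1) = 1.
  move=> pin; rewrite legendreM ?psprime ?psodd // hr' // -legendreM ?psprime ?psodd //.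
  by rewrite legendre_sqr ?psprime ?psodd ?not_dvdn_pred ?psprime.
have lm : legendre r m = 1.
  rewrite legendre_prod // (eq_big_seq (fun=> 1)) ?big1_eq // => p pin.
  rewrite (quadratic_reciprocity rp orr (psprime pin) (psodd pin)) ?r4 ?sq //.
  by apply: contraNneq rn => ->.
have [||||z [u [w [w0 E]]]] := @solve r => //.
- exact: prime_gt0.
- exact: coprime_prime_prod.
- exact: legendre_sqrtz.
have [||||z' [u' [w' [w'0 E']]]] := @sum_sqr_prime 3 r rp orr => //.
- by rewrite prime_coprime // dvdn_prime2 // eq_sym.
- by rewrite -l3 (@quadratic_reciprocity 3 r) // eq_sym.
- exact: legendre_sqrtz.
exists (z * w'), (u * z'), (u * u'), (w * w'); split; first by rewrite mulf_neq0.
transitivity (z ^+ 2 * w' ^+ 2 + u ^+ 2 * (z' ^+ 2 + 3%:Z * u' ^+ 2)); first by ring.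
rewrite E'; transitivity ((z ^+ 2 + r%:Z * u ^+ 2) * w' ^+ 2); first by ring.
by rewrite E; ring.
Qed.

(** Here m = z^2 + 3 r u^2 with r a sum of two rational squares, so 3 m = 3 z^2 + (3 u)^2 r has the
    required shape. With (r/p) = (-3/p), reciprocity gives (m/r) = (m/3), whence the condition on m
    modulo 3. *)
Lemma rational_113_triple : (m %% 3 = 1)%N ->
  exists x y z t : int, t != 0 /\ x ^+ 2 + y ^+ 2 + 3 * z ^+ 2 = (3 * m)%N%:Z * t ^+ 2.
Proof.
move=> m3.
have n3 p : p \in ps -> ~~ (p %| 3 * p.-1)%N.
  move=> pin; have pp := psprime pin; rewrite Euclid_dvdM // negb_or not_dvdn_pred // andbT.
  by rewrite dvdn_prime2 //; apply: contraNneq p3 => <-.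
have [|r [rp orr r8 rn hr]] := @prime_with_legendre (3%N :: ps)
    (fun p => if p == 3%N then 1%N else 3 * p.-1)%N 1 ups3 psP3 isT.
  move=> p; rewrite inE => /predU1P[->//|pin]; rewrite ifN ?n3 //.
  by apply: contraNneq p3 => <-.
rewrite inE negb_or in rn; case/andP: rn => r3 rn.
have hr' p : p \in ps -> legendre p r = legendre p (3 * p.-1).
  move=> pin; rewrite hr ?inE ?pin ?orbT // ifN //.
  by apply: contraNneq p3 => <-.
have r4 : (r %% 4 = 1)%N by rewrite -(@modn_dvdm 8) // r8.
have rec p : p \in ps -> legendre r p = legendre 3 p.
  move=> pin; rewrite (quadratic_reciprocity rp orr (psprime pin) (psodd pin)) ?r4 /=; last first.
    by apply: contraNneq rn => ->.
  rewrite hr' // (@quadratic_reciprocity 3 p isT isT (psprime pin) (psodd pin)) //.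
  by apply: contraNneq p3 => ->.
have lm : legendre r m = 1.
  rewrite legendre_prod // (eq_big_seq (legendre 3)) // -legendre_prod //.
  by rewrite -legendre_mod // -/m m3.
have c3 : coprime 3 m.
  by apply: coprime_prime_prod.
have [||||z [u [w [w0 E]]]] := @solve (3 * r).
- by rewrite muln_gt0 (prime_gt0 rp).
- by rewrite coprimeMl c3 (coprime_prime_prod rp psprime rn).
- move=> p pin; rewrite mulnAC legendreM ?psprime ?psodd // hr' // -legendreM ?psprime ?psodd //.
  by rewrite legendre_sqr ?psprime ?psodd ?n3.
- have := @crt_sqrt [:: 3; r] m%:Z; rewrite !big_cons big_nil muln1; apply.
  + by rewrite /= inE andbT eq_sym.
  + by move=> p; rewrite !inE => /orP[]/eqP->.
  move=> p; rewrite !inE => /orP[]/eqP->; last exact: legendre_sqrtz.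
  by exists 1%N; rewrite -eqz_mod_dvd expr1n modz_nat m3.
have [||||z' [u' [w' [w'0 E']]]] := @sum_sqr_prime 1 r rp orr; rewrite ?coprime1n //.
- by rewrite mul1n legendreN1_mod4 // r4.
- by exists 0%N; rewrite dvd1z.
exists (3 * (u * z')), (3 * (u * u')), (z * w'), (w * w'); split; first by rewrite mulf_neq0.
transitivity (3 * (z ^+ 2 * w' ^+ 2 + 3 * u ^+ 2 * (z' ^+ 2 + 1%:Z * u' ^+ 2))); first by ring.
rewrite E'; transitivity (3 * ((z ^+ 2 + (3 * r)%N%:Z * u ^+ 2) * w' ^+ 2)).
  by rewrite PoszM; ring.
by rewrite E PoszM; ring.
Qed.

End Rational.

Lemma integral_three_squares (n x y z t : int) : t != 0 ->
  x ^+ 2 + y ^+ 2 + z ^+ 2 = n * t ^+ 2 ->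
  exists a b c : int, a ^+ 2 + b ^+ 2 + c ^+ 2 = n.
Proof.
move=> t0 E; have [|a [b [c h]]] := @davenport_cassels 0 n x y z t isT t0.
  by rewrite mul0r addr0.
by exists a, b, c; rewrite mul0r addr0 in h.
Qed.

(* [y^2 + 3 z^2 = (y - z)^2 + (y - z)(2 z) + (2 z)^2]; conversely one of [b], [c],
   [b + c] is even, so every value of [b^2 + b c + c^2] has the shape [v^2 + 3 w^2]. *)
Lemma integral_113 (n x y z t : int) : t != 0 ->
  x ^+ 2 + y ^+ 2 + 3 * z ^+ 2 = n * t ^+ 2 ->
  exists a b c : int, a ^+ 2 + b ^+ 2 + 3 * c ^+ 2 = n.
Proof.
move=> t0 E; have [|a [b [c h]]] := @davenport_cassels 1 n x (y - z) (2 * z) t isT t0.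
  by rewrite -E; ring.
suff [v [w vw]] : exists v w : int, v ^+ 2 + 3 * w ^+ 2 = b ^+ 2 + b * c + c ^+ 2.
  by exists a, v, w; rewrite -h -addrA vw; ring.
have [[b' ->]|[b' ->]] := int_parity b; first by exists (c + b'), b'; ring.
have [[c' ->]|[c' ->]] := int_parity c; first by exists (2 * b' + 1 + c'), c'; ring.
by exists (b' - c'), (b' + c' + 1); ring.
Qed.

Lemma odd_squarefree_part (n : nat) : odd n -> exists ps k,
  [/\ uniq ps, forall p, p \in ps -> prime p && odd p, odd k
    & n = (\prod_(p <- ps) p * k ^ 2)%N].
Proof.
move=> on; have n0 : (0 < n)%N by case: n on.
have [ps [k [ups psP E]]] := squarefree_part n0.
move: (on); rewrite E oddM oddX /= => /andP[om ok].
exists ps, k; split=> // p pin; rewrite psP //=.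
by apply: dvdn_odd om; exact: dvdn_prod_mem.
Qed.

Lemma odd_sqr_mod8 k : odd k -> (k ^ 2 %% 8 = 1)%N.
Proof.
rewrite -(@odd_mod k 8) // -modnXm; have := ltn_pmod k (isT : 0 < 8)%N.
by move: (k %% 8)%N => [|[|[|[|[|[|[|[|?]]]]]]]].
Qed.

Lemma scale_rational (P : int -> int -> int -> int) (s n : nat) (k : nat) :
  (forall a x y z : int, P (a * x) (a * y) (a * z) = a ^+ 2 * P x y z) ->
  n = (s * k ^ 2)%N ->
  (exists x y z t : int, t != 0 /\ P x y z = s%:Z * t ^+ 2) ->
  exists x y z t : int, t != 0 /\ P x y z = n%:Z * t ^+ 2.
Proof.
move=> hP nE [x [y [z [t [t0 E]]]]]; exists (k%:Z * x), (k%:Z * y), (k%:Z * z), t; split=> //.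
by rewrite hP E nE PoszM -[(k ^ 2)%N]/(k * k)%N PoszM; ring.
Qed.

Definition sum_sqr3 (x y z : int) := x ^+ 2 + y ^+ 2 + z ^+ 2.
Definition form113 (x y z : int) := x ^+ 2 + y ^+ 2 + 3 * z ^+ 2.

Lemma sum_sqr3Z (a x y z : int) : sum_sqr3 (a * x) (a * y) (a * z) = a ^+ 2 * sum_sqr3 x y z.
Proof. by rewrite /sum_sqr3; ring. Qed.

Lemma form113Z (a x y z : int) : form113 (a * x) (a * y) (a * z) = a ^+ 2 * form113 x y z.
Proof. by rewrite /form113; ring. Qed.

Lemma three_squares_1mod4 (n : nat) : (n %% 4 = 1)%N ->
  exists x y z : int, x ^+ 2 + y ^+ 2 + z ^+ 2 = n%:Z.
Proof.
move=> n4; have on : odd n by rewrite -(@odd_mod n 4) // n4.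
have [ps [k [ups psP ok E]]] := odd_squarefree_part on.
have k4 : (k ^ 2 %% 4 = 1)%N by rewrite -(@modn_dvdm 8) // odd_sqr_mod8.
move: n4; rewrite E -modnMmr k4 muln1 => m4.
have [x [y [z [t [t0 h]]]]] := scale_rational sum_sqr3Z E (rational_three_squares_1mod4 ups psP m4).
by rewrite -E; exact: integral_three_squares t0 h.
Qed.

Lemma three_squares_3mod8 (n : nat) : (n %% 8 = 3)%N ->
  exists x y z : int, x ^+ 2 + y ^+ 2 + z ^+ 2 = n%:Z.
Proof.
move=> n8; have on : odd n by rewrite -(@odd_mod n 8) // n8.
have [ps [k [ups psP ok E]]] := odd_squarefree_part on.
move: n8; rewrite E -modnMmr odd_sqr_mod8 // muln1 => m8.
have [x [y [z [t [t0 h]]]]] := scale_rational sum_sqr3Z E (rational_three_squares_3mod8 ups psP m8).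
by rewrite -E; exact: integral_three_squares t0 h.
Qed.

Lemma three_squares_double (n : nat) : odd n ->
  exists x y z : int, x ^+ 2 + y ^+ 2 + z ^+ 2 = (2 * n)%N%:Z.
Proof.
move=> on; have [ps [k [ups psP ok E]]] := odd_squarefree_part on.
have E2 : (2 * n = 2 * \prod_(p <- ps) p * k ^ 2)%N by rewrite E mulnA.
have [x [y [z [t [t0 h]]]]] := scale_rational sum_sqr3Z E2 (rational_three_squares_double ups psP).
exact: integral_three_squares t0 h.
Qed.

Lemma sqr_mod3 k : (k %% 3 != 0)%N -> (k ^ 2 %% 3 = 1)%N.
Proof.
rewrite -modnXm; have := ltn_pmod k (isT : 0 < 3)%N.
by move: (k %% 3)%N => [|[|[|?]]].
Qed.

Lemma form113_coprime3 (n : nat) : odd n -> (n %% 3 != 0)%N ->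
  exists x y z : int, x ^+ 2 + y ^+ 2 + 3 * z ^+ 2 = n%:Z.
Proof.
move=> on n3; have [ps [k [ups psP ok E]]] := odd_squarefree_part on.
have p3 : 3%N \notin ps.
  by apply: contra n3 => /dvdn_prod_mem h; rewrite -[_ == _]/(3 %| n)%N E dvdn_mulr.
have [x [y [z [t [t0 h]]]]] := scale_rational form113Z E (rational_113 ups psP p3).
exact: integral_113 t0 h.
Qed.

Lemma form113_triple (n : nat) : odd n -> (n %% 3 = 1)%N ->
  exists x y z : int, x ^+ 2 + y ^+ 2 + 3 * z ^+ 2 = (3 * n)%N%:Z.
Proof.
move=> on n3; have [ps [k [ups psP ok E]]] := odd_squarefree_part on.
have p3 : 3%N \notin ps.
  apply/negP => /dvdn_prod_mem h; have : (3 %| n)%N by rewrite E dvdn_mulr.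
  by rewrite /dvdn n3.
have k3 : (k ^ 2 %% 3 = 1)%N.
  apply: sqr_mod3; apply/negP => h; have : (3 %| n)%N by rewrite E dvdn_mull // dvdn_mulr.
  by rewrite /dvdn n3.
have m3 : (\prod_(p <- ps) p %% 3 = 1)%N by move: n3; rewrite E -modnMmr k3 muln1.
have E2 : (3 * n = 3 * \prod_(p <- ps) p * k ^ 2)%N by rewrite {1}E mulnA.
have [x [y [z [t [t0 h]]]]] := scale_rational form113Z E2 (rational_113_triple ups psP p3 m3).
exact: integral_113 t0 h.
Qed.

(** * Sums of triangular numbers *)

Local Notation T := triangular.

Lemma triangular_double x : (2 * T x = x * x.+1)%N.
Proof. by rewrite /T mulnC divnK // dvdn2 oddM /= andbN. Qed.

Lemma triangular_triple x : (T (3 * x + 1) = 9 * T x + 1)%N.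
Proof.
by apply/eqP; rewrite -(eqn_pmul2l (isT : 0 < 2)%N) mulnDr mulnCA !triangular_double; apply/eqP; lia.
Qed.

Lemma odd_sqr_triangular (s a : int) : s = 2 * a + 1 -> exists t : nat, s * s = 8 * (T t)%:Z + 1.
Proof.
suff key (t : nat) : (2 * t%:Z + 1) * (2 * t%:Z + 1) = 8 * (T t)%:Z + 1.
  move=> ->; have [a0|a0] := lerP 0 a.
    by exists `|a|%N; rewrite -key; have -> : (`|a|%N)%:Z = a by lia.
  exists `|- a - 1|%N; rewrite -key.
  have -> : (`|- a - 1|%N)%:Z = - a - 1 by lia.
  by ring.
have : 2 * (T t)%:Z = t%:Z * (t%:Z + 1).
  by rewrite -[t%:Z + 1]/((t + 1)%N%:Z) addn1 -PoszM -triangular_double PoszM.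
move=> h; have -> : 8 * (T t)%:Z = 4 * (2 * (T t)%:Z) by ring.
by rewrite h; ring.
Qed.

Lemma sqr_parity (s : int) : (exists a, s = 2 * a /\ s * s = 4 * (a * a)) \/
  (exists a (t : nat), s = 2 * a + 1 /\ s * s = 8 * (T t)%:Z + 1).
Proof.
have [[a sE]|[a sE]] := int_parity s; first by left; exists a; split=> //; rewrite sE; ring.
by right; have [t ht] := odd_sqr_triangular sE; exists a, t.
Qed.

(** Representation by an unsorted list of coefficients, so that the escalation can append them in
    the order in which they are found. *)
Fixpoint trep (l : seq nat) (n : nat) : Prop :=
  if l is b :: l' then exists x m, n = (b * T x + m)%N /\ trep l' m else n = 0%N.

Lemma trep3 a b c x y z n : (n = a * T x + b * T y + c * T z)%N -> trep [:: a; b; c] n.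
Proof.
move=> ->; exists x, (b * T y + c * T z)%N; split; first by rewrite addnA.
by exists y, (c * T z)%N; split=> //; exists z, 0%N; rewrite addn0.
Qed.

(** Completing squares through 8 T_x + 1 = (2 x + 1)^2; the odd integers may be negative, since T_x
    and T_(-x-1) agree. *)
Lemma trep_sqr a b c (n : nat) (r s u a' b' c' : int) :
  r = 2 * a' + 1 -> s = 2 * b' + 1 -> u = 2 * c' + 1 ->
  a%:Z * (r * r) + b%:Z * (s * s) + c%:Z * (u * u) = 8 * n%:Z + a%:Z + b%:Z + c%:Z ->
  trep [:: a; b; c] n.
Proof.
move=> /odd_sqr_triangular[x ->] /odd_sqr_triangular[y ->] /odd_sqr_triangular[z ->] h.
apply: (@trep3 a b c x y z); apply/eqP; rewrite -eqz_nat !PoszD !PoszM; apply/eqP.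
have : 8 * n%:Z = 8 * (a%:Z * (T x)%:Z + b%:Z * (T y)%:Z + c%:Z * (T z)%:Z).
  transitivity (8 * n%:Z + a%:Z + b%:Z + c%:Z - a%:Z - b%:Z - c%:Z); first by ring.
  by rewrite -h; ring.
by move/(mulfI (isT : 8 != 0 :> int)).
Qed.

(** In terms of the completed squares this multiplies every variable by 3. *)
Lemma trep_scale3 (l : seq nat) (n : nat) : trep l n -> trep l (9 * n + sumn l).
Proof.
elim: l n => [|b l IH] n /=; first by move=> ->.
case=> x [m [-> /IH h]]; exists (3 * x + 1)%N, (9 * m + sumn l)%N; split=> //.
by rewrite triangular_triple; ring.
Qed.

Lemma triangular0 : T 0 = 0%N. Proof. by []. Qed.
Lemma triangular1 : T 1 = 1%N. Proof. by []. Qed.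

Lemma trep_111 n : trep [:: 1; 1; 1]%N n.
Proof.
have [|x [y [z]]] := @three_squares_3mod8 (8 * n + 3); first by lia.
rewrite !expr2 PoszD PoszM => E.
have [[a [xE xx]]|[a [x' [xE xx]]]] := sqr_parity x;
have [[b [yE yy]]|[b [y' [yE yy]]]] := sqr_parity y;
have [[c [zE zz]]|[c [z' [zE zz]]]] := sqr_parity z;
  try (exfalso; move: E; rewrite xx yy zz; clear; lia).
by apply: (trep_sqr xE yE zE); rewrite !mul1r E; ring.
Qed.

(** In 4 n + 2 = x^2 + y^2 + z^2 exactly one square is even, say y^2; doubling gives (x + y)^2 + (x
    - y)^2 + 2 z^2 = 8 n + 4 with odd entries. *)
Lemma trep_112 n : trep [:: 1; 1; 2]%N n.
Proof.
have key (x y z a b c : int) : x = 2 * a + 1 -> y = 2 * b -> z = 2 * c + 1 ->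
    x * x + y * y + z * z = 4 * n%:Z + 2 -> trep [:: 1; 1; 2]%N n.
  move=> xE yE zE E.
  apply: (@trep_sqr _ _ _ _ (x + y) (x - y) z (a + b) (a - b) c) => //.
  - by rewrite xE yE; ring.
  - by rewrite xE yE; ring.
  - transitivity (2 * (x * x + y * y + z * z)); first by ring.
    by rewrite E; ring.
have [|x [y [z]]] := @three_squares_double (2 * n + 1); first by lia.
rewrite !expr2 => E.
have {}E : x * x + y * y + z * z = 4 * n%:Z + 2 by rewrite E; clear; lia.
have [[a [xE xx]]|[a [x' [xE xx]]]] := sqr_parity x;
have [[b [yE yy]]|[b [y' [yE yy]]]] := sqr_parity y;
have [[c [zE zz]]|[c [z' [zE zz]]]] := sqr_parity z;
  try (exfalso; move: E; rewrite xx yy zz; clear; lia).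
- by apply: (key _ _ _ _ _ _ yE xE zE); rewrite -E; ring.
- by apply: (key _ _ _ _ _ _ xE yE zE); rewrite -E; ring.
- by apply: (key _ _ _ _ _ _ xE zE yE); rewrite -E; ring.
Qed.

(** In 8 n + 6 = x^2 + y^2 + z^2 one variable is even, and modulo 8 its half is odd. *)
Lemma trep_114 n : trep [:: 1; 1; 4]%N n.
Proof.
have key (x y z a b c : int) : x = 2 * a + 1 -> y = 2 * b + 1 -> z = 2 * c ->
    x * x + y * y + z * z = 8 * n%:Z + 6 -> trep [:: 1; 1; 4]%N n.
  move=> xE yE zE E.
  have [x' xx] := odd_sqr_triangular xE; have [y' yy] := odd_sqr_triangular yE.
  have zz : z * z = 4 * (c * c) by rewrite zE; ring.
  have [[d [_ cc]]|[d [_ [cE _]]]] := sqr_parity c.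
    by exfalso; move: E; rewrite xx yy zz cc; clear; lia.
  apply: (trep_sqr xE yE cE); rewrite !mul1r -zz E; ring.
have [|x [y [z]]] := @three_squares_double (4 * n + 3); first by lia.
rewrite !expr2 => E.
have {}E : x * x + y * y + z * z = 8 * n%:Z + 6 by rewrite E; clear; lia.
have [[a [xE xx]]|[a [x' [xE xx]]]] := sqr_parity x;
have [[b [yE yy]]|[b [y' [yE yy]]]] := sqr_parity y;
have [[c [zE zz]]|[c [z' [zE zz]]]] := sqr_parity z;
  try (exfalso; move: E; rewrite xx yy zz; clear; lia).
- by apply: (key _ _ _ _ _ _ yE zE xE); rewrite -E; ring.
- by apply: (key _ _ _ _ _ _ xE zE yE); rewrite -E; ring.
- by apply: (key _ _ _ _ _ _ xE yE zE); rewrite -E; ring.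
Qed.

(** In 8 n + 5 = x^2 + 4 (b^2 + c^2) the sum b + c is odd, and 4 (b^2 + c^2) = 2 (b + c)^2 + 2 (b -
    c)^2. *)
Lemma trep_122 n : trep [:: 1; 2; 2]%N n.
Proof.
have key (x y z a b c : int) : x = 2 * a + 1 -> y = 2 * b -> z = 2 * c ->
    x * x + y * y + z * z = 8 * n%:Z + 5 -> trep [:: 1; 2; 2]%N n.
  move=> xE yE zE E.
  have [x' xx] := odd_sqr_triangular xE.
  have S : (b + c) * (b + c) + (b - c) * (b - c) = 2 * (b * b + c * c) by ring.
  have E4 : x * x + 4 * (b * b + c * c) = 8 * n%:Z + 5 by rewrite -E yE zE; ring.
  have [[d [bE bb]]|[d [? [bE bb]]]] := sqr_parity b;
  have [[f [cE cc]]|[f [? [cE cc]]]] := sqr_parity c;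
    try (exfalso; move: E4; rewrite xx bb cc; clear; lia).
  - apply: (@trep_sqr _ _ _ _ x (b + c) (b - c) a (d + f) (d - f - 1)) => //.
    + by rewrite bE cE; ring.
    + by rewrite bE cE; ring.
    + transitivity (x * x + 2 * ((b + c) * (b + c) + (b - c) * (b - c))); first by ring.
      rewrite S; move: E4; clear; lia.
  - apply: (@trep_sqr _ _ _ _ x (b + c) (b - c) a (d + f) (d - f)) => //.
    + by rewrite bE cE; ring.
    + by rewrite bE cE; ring.
    + transitivity (x * x + 2 * ((b + c) * (b + c) + (b - c) * (b - c))); first by ring.
      rewrite S; move: E4; clear; lia.
have [|x [y [z]]] := @three_squares_1mod4 (8 * n + 5); first by lia.
rewrite !expr2 PoszD PoszM => E.
have [[a [xE xx]]|[a [x' [xE xx]]]] := sqr_parity x;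
have [[b [yE yy]]|[b [y' [yE yy]]]] := sqr_parity y;
have [[c [zE zz]]|[c [z' [zE zz]]]] := sqr_parity z;
  try (exfalso; move: E; rewrite xx yy zz; clear; lia).
- by apply: (key _ _ _ _ _ _ zE xE yE); rewrite -E; ring.
- by apply: (key _ _ _ _ _ _ yE xE zE); rewrite -E; ring.
- by apply: (key _ _ _ _ _ _ xE yE zE); rewrite -E; ring.
Qed.

(** In 16 n + 14 = x^2 + y^2 + (2 c)^2 the sign of y can be chosen with x - y = 4 d; halving gives
    u^2 + 2 c^2 + 4 d^2 with u = (x + y)/2. *)
Lemma trep_124 n : trep [:: 1; 2; 4]%N n.
Proof.
have key (x y z a b c : int) : x = 2 * a + 1 -> y = 2 * b + 1 -> z = 2 * c ->
    x * x + y * y + z * z = 16 * n%:Z + 14 -> trep [:: 1; 2; 4]%N n.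
  move=> xE yE zE E.
  wlog [d dE] : y b yE E / exists d, x - y = 4 * d.
    move=> h; have [|[d dE]] := int_parity (a - b).
      by case=> d dE; apply: (h y b yE E); exists d; rewrite xE yE; move: dE; clear; lia.
    apply: (h (- y) (- b - 1)); rewrite ?mulrNN // ?yE; first by ring.
    by exists (d + b + 1); rewrite xE; move: dE; clear; lia.
  pose u := y + 2 * d.
  have uE : u = 2 * (b + d) + 1 by rewrite /u yE; ring.
  have [u' uu] := odd_sqr_triangular uE.
  have E2 : u * u + 2 * (c * c) + 4 * (d * d) = 8 * n%:Z + 7.
    apply: (mulfI (isT : 2 != 0 :> int)).
    transitivity (x * x + y * y + z * z); last by rewrite E; ring.
    have -> : x = y + 4 * d by move: dE; clear; lia.
    by rewrite /u zE; ring.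
  have [[f [cE cc]]|[f [? [cE cc]]]] := sqr_parity c;
  have [[g [gE dd]]|[g [? [gE dd]]]] := sqr_parity d;
    try (exfalso; move: E2; rewrite uu cc dd; clear; lia).
  by apply: (trep_sqr uE cE gE); rewrite mul1r E2; ring.
have [|x [y [z]]] := @three_squares_double (8 * n + 7); first by lia.
rewrite !expr2 => E.
have {}E : x * x + y * y + z * z = 16 * n%:Z + 14 by rewrite E; clear; lia.
have [[a [xE xx]]|[a [x' [xE xx]]]] := sqr_parity x;
have [[b [yE yy]]|[b [y' [yE yy]]]] := sqr_parity y;
have [[c [zE zz]]|[c [z' [zE zz]]]] := sqr_parity z;
  try (exfalso; move: E; rewrite xx yy zz; clear; lia).
- by apply: (key _ _ _ _ _ _ yE zE xE); rewrite -E; ring.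
- by apply: (key _ _ _ _ _ _ xE zE yE); rewrite -E; ring.
- by apply: (key _ _ _ _ _ _ xE yE zE); rewrite -E; ring.
Qed.

Lemma sqr_mod5 (s : int) : [\/ (exists a, s = 5 * a) /\ (exists q, s * s = 5 * q),
   (exists a, s = 5 * a + 1 \/ s = 5 * a - 1) /\ (exists q, s * s = 5 * q + 1) |
   (exists a, s = 5 * a + 2 \/ s = 5 * a - 2) /\ (exists q, s * s = 5 * q + 4)].
Proof.
have h3 := divz_eq s 5; have h2 := ltz_pmod s (isT : 0 < 5 :> int).
have h1 := modz_ge0 s (isT : 5 != 0 :> int).
move: (s %/ 5)%Z (s %% 5)%Z h3 h1 h2 => q r sE r0 r5.
have : [|| r == 0, r == 1, r == 4, r == 2 | r == 3] by clear -r0 r5; lia.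
case/orP=> [/eqP r1|/orP[/eqP r1|/orP[/eqP r1|/orP[]/eqP r1]]]; rewrite sE r1.
- by constructor 1; split; [exists q; ring | exists (5 * q * q); ring].
- by constructor 2; split; [exists q; left; ring | exists (5 * q * q + 2 * q); ring].
- by constructor 2; split; [exists (q + 1); right; ring | exists (5 * q * q + 8 * q + 3); ring].
- by constructor 3; split; [exists q; left; ring | exists (5 * q * q + 4 * q); ring].
- by constructor 3; split; [exists (q + 1); right; ring | exists (5 * q * q + 6 * q + 1); ring].
Qed.

(** Write 5 (8 n + 7) as three odd squares. Modulo 5 the squares are 0, 0, 0 or 0, 1, 4, so up to
    order and sign 5 divides z, 2 x + y and x - 2 y; then (2 x + y)^2 + (x - 2 y)^2 = 5 (x^2 + y^2)
    can be divided by 25. *)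
Lemma trep_115 n : trep [:: 1; 1; 5]%N n.
Proof.
have key (x y z a b c d e f : int) : x = 2 * a + 1 -> y = 2 * b + 1 -> z = 2 * c + 1 ->
    z = 5 * d -> 2 * x + y = 5 * e -> x - 2 * y = 5 * f ->
    x * x + y * y + z * z = 5 * (8 * n%:Z + 7) -> trep [:: 1; 1; 5]%N n.
  move=> xE yE zE zd xe xf E.
  have [d' dE] : exists d', d = 2 * d' + 1.
    by exists (c - 2 * d); move: zE zd; clear; lia.
  have [e' eE] : exists e', e = 2 * e' + 1.
    by exists (x + b - 2 * e); move: yE xe; clear; lia.
  have [f' fE] : exists f', f = 2 * f' + 1.
    by exists (a - y - 2 * f); move: xE xf; clear; lia.
  apply: (trep_sqr eE fE dE).
  apply: (mulfI (isT : 25 != 0 :> int)).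
  transitivity (5 * (x * x + y * y + z * z)); last by rewrite E; ring.
  transitivity ((5 * e) * (5 * e) + (5 * f) * (5 * f) + 5 * ((5 * d) * (5 * d))); first by ring.
  by rewrite -xe -xf -zd; ring.
have key2 (x y z a b c d t : int) : x = 2 * a + 1 -> y = 2 * b + 1 -> z = 2 * c + 1 ->
    z = 5 * d -> (exists r, x = 5 * r + t) ->
    (exists s, y = 5 * s + 2 * t \/ y = 5 * s - 2 * t) ->
    x * x + y * y + z * z = 5 * (8 * n%:Z + 7) -> trep [:: 1; 1; 5]%N n.
  move=> xE yE zE zd [r xr] [s [ys|ys]] E'.
    have ny : - y = 2 * (- b - 1) + 1 by rewrite yE; ring.
    apply: (key x (- y) z a (- b - 1) c d (2 * r - s) (r + 2 * s + t)) => //.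
    - by rewrite xr ys; ring.
    - by rewrite xr ys; ring.
    - by rewrite mulrNN.
  apply: (key x y z a b c d (2 * r + s) (r - 2 * s + t)) => //.
  - by rewrite xr ys; ring.
  - by rewrite xr ys; ring.
have key3 (x y z a b c : int) : x = 2 * a + 1 -> y = 2 * b + 1 -> z = 2 * c + 1 ->
    (exists d, z = 5 * d) -> (exists r, x = 5 * r + 1 \/ x = 5 * r - 1) ->
    (exists s, y = 5 * s + 2 \/ y = 5 * s - 2) ->
    x * x + y * y + z * z = 5 * (8 * n%:Z + 7) -> trep [:: 1; 1; 5]%N n.
  move=> xE yE zE [d zd] [r xr] [s ys].
  have [t tE xt] : exists2 t, t = 1 \/ t = -1 & x = 5 * r + t.
    by case: xr => ->; [exists 1; [left|] | exists (-1); [right|]].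
  apply: (key2 x y z a b c d t) => //; first by exists r.
  by exists s; case: tE => ->; case: ys => ->; [left|right|right|left]; ring.
have [|x [y [z]]] := @three_squares_3mod8 (5 * (8 * n + 7)); first by lia.
rewrite !expr2 => E.
have {}E : x * x + y * y + z * z = 5 * (8 * n%:Z + 7) by rewrite E; clear; lia.
have [[a [xE xx]]|[a [x' [xE xx]]]] := sqr_parity x;
have [[b [yE yy]]|[b [y' [yE yy]]]] := sqr_parity y;
have [[c [zE zz]]|[c [z' [zE zz]]]] := sqr_parity z;
  try (exfalso; move: E; rewrite xx yy zz; clear; lia).
clear xx yy zz x' y' z'.
have [[X3 [qx xx]]|[X3 [qx xx]]|[X3 [qx xx]]] := sqr_mod5 x;
have [[Y3 [qy yy]]|[Y3 [qy yy]]|[Y3 [qy yy]]] := sqr_mod5 y;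
have [[Z3 [qz zz]]|[Z3 [qz zz]]|[Z3 [qz zz]]] := sqr_mod5 z;
  try (exfalso; move: E; rewrite xx yy zz; clear; lia).
- have [d zd] := Z3; have [r xr] := X3; have [s ys] := Y3.
  by apply: (key2 x y z a b c d 0) => //; [exists r | exists s; left]; rewrite ?mulr0 addr0.
- by apply: (key3 _ _ _ _ _ _ yE zE xE) => //; rewrite -E; ring.
- by apply: (key3 _ _ _ _ _ _ zE yE xE) => //; rewrite -E; ring.
- by apply: (key3 _ _ _ _ _ _ xE zE yE) => //; rewrite -E; ring.
- by apply: (key3 _ _ _ _ _ _ xE yE zE) => //; rewrite -E; ring.
- by apply: (key3 _ _ _ _ _ _ zE xE yE) => //; rewrite -E; ring.
- by apply: (key3 _ _ _ _ _ _ yE xE zE) => //; rewrite -E; ring.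
Qed.

(* [6 (x^2 + y^2 + z^2) = 2 (x + y + z)^2 + 3 (x - y)^2 + (x + y - 2 z)^2]; after
   sign changes [x = y = z] modulo 3. *)
Lemma trep_123 n : trep [:: 1; 2; 3]%N n.
Proof.
have key (x y z a b c : int) : x = 2 * a + 1 -> y = 2 * b -> z = 2 * c ->
    (exists r, x - z = 3 * r) -> (exists s, y - z = 3 * s) ->
    x * x + y * y + z * z = 12 * n%:Z + 9 -> trep [:: 1; 2; 3]%N n.
  move=> xE yE zE [r xr] [s ys] E.
  pose u := r + s; pose v := z + r + s; pose w := r - s.
  have [r' rE] : exists r', r = 2 * r' + 1.
    by exists (a - c - r); move: xr; rewrite xE zE; clear; lia.
  have [s' sE] : exists s', s = 2 * s'.
    by exists (b - c - s); move: ys; rewrite yE zE; clear; lia.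
  apply: (@trep_sqr _ _ _ _ u v w (r' + s') (c + r' + s') (r' - s')).
  - by rewrite /u rE sE; ring.
  - by rewrite /v rE sE zE; ring.
  - by rewrite /w rE sE; ring.
  apply: (mulfI (isT : 3 != 0 :> int)).
  transitivity (2 * (x * x + y * y + z * z)); last by rewrite E; ring.
  have -> : x = z + 3 * r by move: xr; clear; lia.
  have -> : y = z + 3 * s by move: ys; clear; lia.
  by rewrite /u /v /w; ring.
have mod3 (s : int) : (exists a, s = 3 * a) /\ (exists q, s * s = 3 * q) \/
   (exists a, s = 3 * a + 1 \/ - s = 3 * a + 1) /\ (exists q, s * s = 3 * q + 1).
  have h3 := divz_eq s 3; have h2 := ltz_pmod s (isT : 0 < 3 :> int).
  have h1 := modz_ge0 s (isT : 3 != 0 :> int).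
  move: (s %/ 3)%Z (s %% 3)%Z h3 h1 h2 => q r sE r0 r5.
  have : [|| r == 0, r == 1 | r == 2] by clear -r0 r5; lia.
  case/orP=> [/eqP r1|/orP[]/eqP r1]; rewrite sE r1.
  - by left; split; [exists q; ring | exists (3 * q * q); ring].
  - by right; split; [exists q; left; ring | exists (3 * q * q + 2 * q); ring].
  - by right; split; [exists (- q - 1); right; ring | exists (3 * q * q + 4 * q + 1); ring].
have key2 (x y z a b c : int) : x = 2 * a + 1 -> y = 2 * b -> z = 2 * c ->
    x * x + y * y + z * z = 12 * n%:Z + 9 -> trep [:: 1; 2; 3]%N n.
  move=> xE yE zE E.
  have [[[p xp] [qx xx]]|[[p xp] [qx xx]]] := mod3 x;
  have [[[q yq] [qy yy]]|[[q yq] [qy yy]]] := mod3 y;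
  have [[[r zr] [qz zz]]|[[r zr] [qz zz]]] := mod3 z;
    try (exfalso; move: E; rewrite xx yy zz; clear; lia).
    by apply: (key x y z a b c) => //; [exists (p - r) | exists (q - r)]; rewrite ?xp ?yq zr; ring.
  have {xx yy zz} : exists x' y' z' a' b' c' : int,
    [/\ x' = 2 * a' + 1, y' = 2 * b' & z' = 2 * c'] /\
    [/\ x' = 3 * p + 1, y' = 3 * q + 1, z' = 3 * r + 1 &
        x' * x' + y' * y' + z' * z' = 12 * n%:Z + 9].
    exists (3 * p + 1), (3 * q + 1), (3 * r + 1).
    exists (if x == 3 * p + 1 then a else - a - 1), (if y == 3 * q + 1 then b else - b),
      (if z == 3 * r + 1 then c else - c).
    split; first split.
    - by case: eqP => [<-//|ne]; case: xp => [//|<-]; rewrite xE; ring.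
    - by case: eqP => [<-//|ne]; case: yq => [//|<-]; rewrite yE; ring.
    - by case: eqP => [<-//|ne]; case: zr => [//|<-]; rewrite zE; ring.
    split=> //; rewrite -E.
    by case: xp => <-; case: yq => <-; case: zr => <-; ring.
  move=> [x' [y' [z' [a' [b' [c' [[xE' yE' zE'] [xp' yq' zr' E']]]]]]]].
  by apply: (key x' y' z' a' b' c') => //; [exists (p - r) | exists (q - r)];
    rewrite ?xp' ?yq' zr'; ring.
have [|x [y [z]]] := @three_squares_1mod4 (12 * n + 9); first by lia.
rewrite !expr2 => E.
have {}E : x * x + y * y + z * z = 12 * n%:Z + 9 by rewrite E; clear; lia.
have [[a [xE xx]]|[a [x' [xE xx]]]] := sqr_parity x;
have [[b [yE yy]]|[b [y' [yE yy]]]] := sqr_parity y;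
have [[c [zE zz]]|[c [z' [zE zz]]]] := sqr_parity z;
  try (exfalso; move: E; rewrite xx yy zz; clear; lia).
- by apply: (key2 _ _ _ _ _ _ zE xE yE); rewrite -E; ring.
- by apply: (key2 _ _ _ _ _ _ yE xE zE); rewrite -E; ring.
- by apply: (key2 _ _ _ _ _ _ xE yE zE); rewrite -E; ring.
Qed.

(** If the variables are not all odd, one of x, y is odd and the other two variables are 2 b and 2 c
    with b + c odd; then 4 (b^2 + 3 c^2) = (b + 3 c)^2 + 3 (b - c)^2 restores odd entries. *)
Lemma trep_113_of_form n :
  (exists x y z : int, x ^+ 2 + y ^+ 2 + 3 * z ^+ 2 = (8 * n + 5)%N%:Z) -> trep [:: 1; 1; 3]%N n.
Proof.
have key (x y z a b c : int) : x = 2 * a + 1 -> y = 2 * b -> z = 2 * c ->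
    x * x + y * y + 3 * (z * z) = 8 * n%:Z + 5 -> trep [:: 1; 1; 3]%N n.
  move=> xE yE zE E.
  have [x' xx] := odd_sqr_triangular xE.
  have E4 : x * x + 4 * (b * b + 3 * (c * c)) = 8 * n%:Z + 5 by rewrite -E yE zE; ring.
  have h : x * x + (b + 3 * c) * (b + 3 * c) + 3 * ((b - c) * (b - c)) = 8 * n%:Z + 5.
    by rewrite -E4; ring.
  have [[d [bE bb]]|[d [? [bE bb]]]] := sqr_parity b;
  have [[f [cE cc]]|[f [? [cE cc]]]] := sqr_parity c;
    try (exfalso; move: E4; rewrite xx bb cc; clear; lia).
  - apply: (@trep_sqr _ _ _ _ x (b + 3 * c) (b - c) a (d + 3 * f + 1) (d - f - 1)) => //.
    + by rewrite bE cE; ring.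
    + by rewrite bE cE; ring.
    + by rewrite !mul1r h; ring.
  - apply: (@trep_sqr _ _ _ _ x (b + 3 * c) (b - c) a (d + 3 * f) (d - f)) => //.
    + by rewrite bE cE; ring.
    + by rewrite bE cE; ring.
    + by rewrite !mul1r h; ring.
move=> [x [y [z]]]; rewrite !expr2 PoszD PoszM => E.
have [[a [xE xx]]|[a [x' [xE xx]]]] := sqr_parity x;
have [[b [yE yy]]|[b [y' [yE yy]]]] := sqr_parity y;
have [[c [zE zz]]|[c [z' [zE zz]]]] := sqr_parity z;
  try (exfalso; move: E; rewrite xx yy zz; clear; lia).
- by apply: (key _ _ _ _ _ _ yE xE zE); rewrite -E; ring.
- by apply: (key _ _ _ _ _ _ xE yE zE); rewrite -E; ring.
- by apply: (trep_sqr xE yE zE); rewrite !mul1r E; ring.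
Qed.

(** Modulo 8 the variables x = 2 a and y = 2 b are even with a + b odd, and 4 (a^2 + b^2) = 2 (a +
    b)^2 + 2 (a - b)^2. *)
Lemma trep_223_of_form n :
  (exists x y z : int, x ^+ 2 + y ^+ 2 + 3 * z ^+ 2 = (8 * n + 7)%N%:Z) -> trep [:: 2; 2; 3]%N n.
Proof.
move=> [x [y [z]]]; rewrite !expr2 PoszD PoszM => E.
have [[a [xE xx]]|[a [x' [xE xx]]]] := sqr_parity x;
have [[b [yE yy]]|[b [y' [yE yy]]]] := sqr_parity y;
have [[c [zE zz]]|[c [z' [zE zz]]]] := sqr_parity z;
  try (exfalso; move: E; rewrite xx yy zz; clear; lia).
- have h : 2 * ((a + b) * (a + b)) + 2 * ((a - b) * (a - b)) + 3 * (z * z) = 8 * n%:Z + 7.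
    by rewrite -E xE yE; ring.
  have [[d [aE aa]]|[d [? [aE aa]]]] := sqr_parity a;
  have [[f [bE bb]]|[f [? [bE bb]]]] := sqr_parity b;
    try (exfalso; move: E; rewrite xx yy zz aa bb; clear; lia).
  + apply: (@trep_sqr _ _ _ _ (a + b) (a - b) z (d + f) (d - f - 1) c) => //.
    * by rewrite aE bE; ring.
    * by rewrite aE bE; ring.
    * by rewrite h; ring.
  + apply: (@trep_sqr _ _ _ _ (a + b) (a - b) z (d + f) (d - f) c) => //.
    * by rewrite aE bE; ring.
    * by rewrite aE bE; ring.
    * by rewrite h; ring.
all: have [[d [cE cc]]|[d [? [cE cc]]]] := sqr_parity c;
     exfalso; move: E; rewrite xx yy zz cc; clear; lia.
Qed.

Lemma trep_234_of_in_S n : in_S n -> trep [:: 2; 3; 4]%N n.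
Proof.
move=> [_ [x [y [z]]]]; rewrite !expr2 => E.
have [[a [xE xx]]|[a [x' [xE xx]]]] := sqr_parity x;
have [[b [yE yy]]|[b [y' [yE yy]]]] := sqr_parity y;
have [[c [zE zz]]|[c [z' [zE zz]]]] := sqr_parity z;
  try (exfalso; move: E; rewrite xx yy zz; clear; lia).
all: try (have [[d [aE aa]]|[d [? [aE aa]]]] := sqr_parity a;
     exfalso; move: E; rewrite xx yy zz aa; clear; lia).
by apply: (trep_sqr xE yE zE); rewrite E; ring.
Qed.

Local Close Scope ring_scope.

Lemma leq_triangular x : x <= T x.
Proof.
rewrite -(leq_pmul2l (isT : 0 < 2)) triangular_double mulnC leq_mul2l.
by case: x.
Qed.

Lemma trep_rcons (l : seq nat) (b x n : nat) : trep l n -> trep (rcons l b) (n + b * T x).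
Proof.
elim: l n => [|c l IH] n /=; first by move=> ->; exists x, 0; rewrite addn0.
by case=> y [m [-> /IH h]]; exists y, (m + b * T x); rewrite addnA.
Qed.

Lemma trep_rcons0 (l : seq nat) (b n : nat) : trep l n -> trep (rcons l b) n.
Proof. by move/(trep_rcons b 0); rewrite triangular0 muln0 addn0. Qed.

Lemma trep_sub (l : seq nat) (b x n : nat) : b * T x <= n -> trep l (n - b * T x) ->
  trep (rcons l b) n.
Proof. by move=> h /(trep_rcons b x); rewrite subnK. Qed.

(** * Extensions of (1,1,3) and (2,2,3) and their exceptions *)

Lemma trep_113_good n : n %% 3 != 2 -> trep [:: 1; 1; 3] n.
Proof. by move=> h; apply: trep_113_of_form; apply: form113_coprime3; lia. Qed.

Lemma trep_113_2mod9 n : n %% 9 = 2 -> trep [:: 1; 1; 3] n.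
Proof.
move=> h; apply: trep_113_of_form.
have -> : 8 * n + 5 = 3 * (24 * (n %/ 9) + 7) by have := divn_eq n 9; rewrite h; lia.
by apply: form113_triple; lia.
Qed.

Lemma trep_113_5mod9 k : k %% 3 != 2 -> trep [:: 1; 1; 3] (9 * k + 5).
Proof. by move=> h; exact: trep_scale3 (trep_113_good h). Qed.

(** The number 8 n + 5 is prime to 3 unless n = 2 modulo 3. For n = 2 modulo 9 it is 3 times a
    number that is 1 modulo 3; for n = 8 modulo 9 the cofactor is 2 modulo 3; for n = 9 k + 5 it is
    9 (8 k + 5), which leads back to k. The last constructor only leaves the case undecided: 23,
    with k = 2, is represented. *)
Variant class113 (n : nat) : Prop :=
  | Class113Good of trep [:: 1; 1; 3] n
  | Class113Bad8 k of n = 9 * k + 8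
  | Class113Bad5 k of n = 9 * k + 5 & k %% 3 = 2.

Lemma class113P n : class113 n.
Proof.
have [h|h] := eqVneq (n %% 3) 2; last by constructor 1; exact: trep_113_good.
have [h2|h2] := eqVneq (n %% 9) 2; first by constructor 1; exact: trep_113_2mod9.
have [h8|h8] := eqVneq (n %% 9) 8; first by apply: (@Class113Bad8 _ (n %/ 9)); lia.
have nE : n = 9 * (n %/ 9) + 5 by lia.
have [h3|h3] := eqVneq (n %/ 9 %% 3) 2; first exact: (@Class113Bad5 _ (n %/ 9)).
by constructor 1; rewrite nE; exact: trep_113_5mod9.
Qed.

(** All bad n are 2 modulo 3, so subtracting c once leaves the bad class; apart from 8 they are at
    least 17, so c fits. *)
Lemma trep_113c c n : c %% 3 != 0 -> c <= 17 -> n != 8 -> trep [:: 1; 1; 3; c] n.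
Proof.
move=> c3 c17 n8.
suff : trep [:: 1; 1; 3] n \/ c <= n /\ (n - c) %% 3 != 2.
  case=> [h|[cn h]]; first exact: (@trep_rcons0 [:: 1; 1; 3]).
  by apply: (@trep_sub [:: 1; 1; 3] c 1); rewrite triangular1 muln1 //; exact: trep_113_good.
by have [h|k h|k h hk] := class113P n; [left|right; lia|right; lia].
Qed.

(** Subtracting 6 takes 8 to 2 modulo 9; subtracting 6 T_2 = 18 lowers k by 2 in 9 k + 5, out of the
    class 2 modulo 3. *)
Lemma trep_1136 n : n != 8 -> trep [:: 1; 1; 3; 6] n.
Proof.
move=> n8; have [h|k h|k h hk] := class113P n; first exact: (@trep_rcons0 [:: 1; 1; 3]).
  apply: (@trep_sub [:: 1; 1; 3] 6 1); rewrite triangular1; first by lia.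
  by apply: trep_113_2mod9; lia.
apply: (@trep_sub [:: 1; 1; 3] 6 2); rewrite (_ : T 2 = 3) //; first by lia.
have -> : n - 6 * 3 = 9 * (k - 2) + 5 by lia.
by apply: trep_113_5mod9; lia.
Qed.

Lemma trep_113_15 n : n != 8 -> trep [:: 1; 1; 3; 15] n.
Proof.
move=> n8; have [h|k h|k h hk] := class113P n; first exact: (@trep_rcons0 [:: 1; 1; 3]).
  apply: (@trep_sub [:: 1; 1; 3] 15 1); rewrite triangular1; first by lia.
  by apply: trep_113_2mod9; lia.
(* For k = 2 there is no room for 15 T_2 = 45, but 23 = 9 * 2 + 5 is the scaling of 2. *)
have [k2|k2] := eqVneq k 2.
  apply: (@trep_rcons0 [:: 1; 1; 3]); rewrite h k2.
  by apply: (@trep_scale3 [:: 1; 1; 3] 2); exact: trep_113_2mod9.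
apply: (@trep_sub [:: 1; 1; 3] 15 2); rewrite (_ : T 2 = 3) //; first by lia.
have -> : n - 15 * 3 = 9 * (k - 5) + 5 by lia.
by apply: trep_113_5mod9; lia.
Qed.

(** The coefficient sum is 8, so scaling by 3 carries k to 9 k + 8 and induction settles the
    obstructed class. *)
Lemma trep_1133 n : trep [:: 1; 1; 3; 3] n.
Proof.
elim/ltn_ind: n => n IH.
have [h|k h|k h hk] := class113P n; first exact: (@trep_rcons0 [:: 1; 1; 3]).
  by rewrite h; apply: (@trep_scale3 [:: 1; 1; 3; 3]); apply: IH; lia.
apply: (@trep_sub [:: 1; 1; 3] 3 1); rewrite triangular1; first by lia.
by apply: trep_113_2mod9; lia.
Qed.

(** The coefficient sum is 17, so scaling reaches 9 k + 17, that is, every n = 8 modulo 9 except 8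
    itself. As 8 * 8 + 17 = 9^2, exceptions can only lie on the chain that starts at 8. *)
Lemma trep_113_12 n : trep [:: 1; 1; 3; 12] n \/ exists j, 8 * n + 17 = 9 ^ j.
Proof.
elim/ltn_ind: n => n IH.
have [h|k h|k h hk] := class113P n; first by left; exact: (@trep_rcons0 [:: 1; 1; 3]).
  case: k => [|k] in h *; first by right; exists 2; rewrite h.
  have nE : n = 9 * k + 17 by lia.
  case: (IH k) => [|hk|[j hj]]; first by lia.
    by left; rewrite nE; exact: (@trep_scale3 [:: 1; 1; 3; 12]).
  by right; exists j.+1; rewrite expnS -hj nE; lia.
left; apply: (@trep_sub [:: 1; 1; 3] 12 1); rewrite triangular1; first by lia.
by apply: trep_113_2mod9; lia.
Qed.

Lemma pow9_gap (i j a b c : nat) : 8 * a + c = 9 ^ i -> 8 * b + c = 9 ^ j -> a < b ->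
  9 ^ j <= 9 * (b - a).
Proof.
move=> hi hj ab; have ij : i < j by rewrite -(@ltn_exp2l 9) // -hi -hj; lia.
have : 9 * 9 ^ i <= 9 ^ j by rewrite -expnS leq_exp2l.
by rewrite -hi -hj; lia.
Qed.

(** If n fails, n - c is represented unless both lie on the chain; beyond 89 consecutive members
    differ by at least 9^3 > 89. *)
Lemma trep_113_12c c n : 0 < c <= 89 -> 89 < n -> trep [:: 1; 1; 3; 12; c] n.
Proof.
move=> /andP[c0 c89] n89.
have [h|[j hj]] := trep_113_12 n; first exact: (@trep_rcons0 [:: 1; 1; 3; 12]).
apply: (@trep_sub [:: 1; 1; 3; 12] c 1); rewrite triangular1 muln1; first by lia.
have [//|[i hi]] := trep_113_12 (n - c).
have j3 : 3 < j by rewrite -(@ltn_exp2l 9) // -hj; lia.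
have : 9 * 9 ^ 3 <= 9 ^ j by rewrite -expnS leq_exp2l.
by have := pow9_gap hi hj; lia.
Qed.

Lemma trep_223_good n : n %% 3 != 1 -> trep [:: 2; 2; 3] n.
Proof. by move=> h; apply: trep_223_of_form; apply: form113_coprime3; lia. Qed.

Lemma trep_223_4mod9 n : n %% 9 = 4 -> trep [:: 2; 2; 3] n.
Proof.
move=> h; apply: trep_223_of_form.
have -> : 8 * n + 7 = 3 * (24 * (n %/ 9) + 13) by have := divn_eq n 9; rewrite h; lia.
by apply: form113_triple; lia.
Qed.

Lemma trep_223_7mod9 k : k %% 3 != 1 -> trep [:: 2; 2; 3] (9 * k + 7).
Proof. by move=> h; exact: trep_scale3 (trep_223_good h). Qed.

Variant class223 (n : nat) : Prop :=
  | Class223Good of trep [:: 2; 2; 3] n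
  | Class223Bad1 k of n = 9 * k + 1
  | Class223Bad7 k of n = 9 * k + 7 & k %% 3 = 1.

Lemma class223P n : class223 n.
Proof.
have [h|h] := eqVneq (n %% 3) 1; last by constructor 1; exact: trep_223_good.
have [h2|h2] := eqVneq (n %% 9) 4; first by constructor 1; exact: trep_223_4mod9.
have [h8|h8] := eqVneq (n %% 9) 1; first by apply: (@Class223Bad1 _ (n %/ 9)); lia.
have nE : n = 9 * (n %/ 9) + 7 by lia.
have [h3|h3] := eqVneq (n %/ 9 %% 3) 1; first exact: (@Class223Bad7 _ (n %/ 9)).
by constructor 1; rewrite nE; exact: trep_223_7mod9.
Qed.

Lemma trep_223c c n : c %% 3 != 0 -> c <= 10 -> n != 1 -> trep [:: 2; 2; 3; c] n.
Proof.
move=> c3 c10 n1.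
suff : trep [:: 2; 2; 3] n \/ c <= n /\ (n - c) %% 3 != 1.
  case=> [h|[cn h]]; first exact: (@trep_rcons0 [:: 2; 2; 3]).
  by apply: (@trep_sub [:: 2; 2; 3] c 1); rewrite triangular1 muln1 //; exact: trep_223_good.
by have [h|k h|k h hk] := class223P n; [left|right; lia|right; lia].
Qed.

Lemma trep_2236 n : n != 1 -> n != 16 -> trep [:: 2; 2; 3; 6] n.
Proof.
move=> n1 n16; have [h|k h|k h hk] := class223P n; first exact: (@trep_rcons0 [:: 2; 2; 3]).
  apply: (@trep_sub [:: 2; 2; 3] 6 1); rewrite triangular1; first by lia.
  by apply: trep_223_4mod9; lia.
apply: (@trep_sub [:: 2; 2; 3] 6 2); rewrite (_ : T 2 = 3) //; first by lia.
have -> : n - 6 * 3 = 9 * (k - 2) + 7 by lia.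
by apply: trep_223_7mod9; lia.
Qed.

(** As for (1,1,3,12), with coefficient sum 10 and the chain starting at 1, where 8 + 10 = 2 * 9. *)
Lemma trep_2233 n : trep [:: 2; 2; 3; 3] n \/ exists j, 8 * n + 10 = 2 * 9 ^ j.
Proof.
elim/ltn_ind: n => n IH.
have [h|k h|k h hk] := class223P n; first by left; exact: (@trep_rcons0 [:: 2; 2; 3]).
  case: k => [|k] in h *; first by right; exists 1; rewrite h.
  have nE : n = 9 * k + 10 by lia.
  case: (IH k) => [|hk|[j hj]]; first by lia.
    by left; rewrite nE; exact: (@trep_scale3 [:: 2; 2; 3; 3]).
  by right; exists j.+1; rewrite expnS mulnCA -hj nE; lia.
left; apply: (@trep_sub [:: 2; 2; 3] 3 1); rewrite triangular1; first by lia.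
by apply: trep_223_4mod9; lia.
Qed.

Lemma trep_2233c c n : 0 < c <= 19 -> 19 < n -> trep [:: 2; 2; 3; 3; c] n.
Proof.
move=> /andP[c0 c19] n19.
have [h|[j hj]] := trep_2233 n; first exact: (@trep_rcons0 [:: 2; 2; 3; 3]).
apply: (@trep_sub [:: 2; 2; 3; 3] c 1); rewrite triangular1 muln1; first by lia.
have [//|[i hi]] := trep_2233 (n - c).
have ij : i < j by rewrite -(@ltn_exp2l 9) //; lia.
have : 9 * 9 ^ i <= 9 ^ j by rewrite -expnS leq_exp2l.
have j2 : 2 < j by rewrite -(@ltn_exp2l 9) //; lia.
have : 9 * 9 ^ 2 <= 9 ^ j by rewrite -expnS leq_exp2l.
by lia.
Qed.

Fixpoint trepb (l : seq nat) (n : nat) : bool :=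
  if l is b :: l' then has (fun x => (b * T x <= n) && trepb l' (n - b * T x)) (iota 0 n.+1)
  else n == 0.

Lemma trepP (l : seq nat) n : all (leq 1) l -> trep l n -> trepb l n.
Proof.
elim: l n => [|b l IH] n; first by move=> _ /= ->.
move=> /andP[b0 l0] [x [m [-> /(IH _ l0) h]]].
rewrite /trepb -/trepb; apply/hasP; exists x; last by rewrite leq_addr addKn h.
rewrite mem_iota /= ltnS; apply: leq_trans (leq_triangular x) _.
by apply: leq_trans (leq_pmull _ b0) (leq_addr _ _).
Qed.

(** * Escalation on the coefficients of a given form *)

Section Tuple.
Variables (k : nat) (b : k.-tuple nat).
Hypothesis hb : is_triangular_sum b.

Let c (i : 'I_k) := tnth b i.

Let c_gt0 i : 0 < c i. Proof. by case: hb => _ + _; apply. Qed.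

Lemma trep_sum (s : seq 'I_k) n : uniq s ->
  trep (map c s) n <-> exists x : 'I_k -> nat, n = \sum_(i <- s) c i * T (x i).
Proof.
elim: s n => [|i s IH] n /=.
  by move=> _; split=> [->|[x ->]]; [exists (fun=> 0) |]; rewrite big_nil.
move=> /andP[is_ us]; split=> [[y [m [-> /(IH _ us)[x ->]]]]|[x ->]].
  exists (fun j => if j == i then y else x j); rewrite big_cons eqxx; congr (_ + _).
  by apply: eq_big_seq => j js; rewrite ifN //; apply: contraNneq is_ => <-.
by rewrite big_cons; exists (x i), (\sum_(j <- s) c j * T (x j)); split=> //; apply/IH => //; exists x.
Qed.

Lemma represents_of_trep (s : seq 'I_k) n : uniq s -> trep (map c s) n -> represents b n.
Proof.
move=> us /(trep_sum _ us)[x ->]; exists (fun i => if i \in s then x i else 0).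
rewrite [RHS](bigID (mem s)) /= [X in _ = _ + X]big1 ?addn0 => [|i /negPf->]; last first.
  by rewrite triangular0 muln0.
by rewrite big_uniq //=; apply: eq_bigr => i ->.
Qed.

(* For [d = 0] the first alternative says that the coefficients indexed by [s]
   already represent [n], and [~~ (0 %| c i)] is automatic. *)
Lemma next_coefficient (d : nat) (s : seq 'I_k) n : uniq s -> represents b n ->
  (exists v r, trep (map c s) v /\ n = v + d * r) \/
  (exists i, [/\ uniq (rcons s i), ~~ (d %| c i) & 0 < c i <= n]).
Proof.
move=> us [x nE].
have [/existsP[i /and3P[is_ di xi]]|no] :=
  boolP [exists i, [&& i \notin s, ~~ (d %| c i) & 0 < T (x i)]].
  right; exists i; split=> //; first by rewrite rcons_uniq is_.
  rewrite c_gt0 nE (bigD1 i) //=.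
  by apply: leq_trans (leq_pmulr _ xi) (leq_addr _ _).
left; exists (\sum_(i <- s) c i * T (x i)).
have /dvdnP[r rE] : d %| \sum_(i | i \notin s) c i * T (x i).
  apply: dvdn_sum => i is_; move/existsPn: no => /(_ i); rewrite is_ /= negb_and negbK.
  by case/orP=> [h|]; [rewrite dvdn_mulr | rewrite -eqn0Ngt => /eqP->; rewrite muln0].
exists r; split; first by apply/trep_sum => //; exists x.
by rewrite nE (bigID (mem s)) /= big_uniq //= rE mulnC.
Qed.

(** If [n] stays unrepresented after removing any multiple of [d], coefficients divisible by [d]
    cannot help, so one not divisible by [d] must occur; the premise is a finite computation. *)
Lemma next_coefficient_dvd (d : nat) (s : seq 'I_k) n : uniq s -> represents b n ->
  all (fun r => (n < d * r) || ~~ trepb (map c s) (n - d * r)) (iota 0 n.+1) ->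
  exists i, [/\ uniq (rcons s i), ~~ (d %| c i) & 0 < c i <= n].
Proof.
move=> us /(next_coefficient d us)[[v [r [h nE]]]|//] /allP nt; exfalso.
have [d0|d0] := posnP d.
  rewrite d0 addn0 in nE; have := nt 0; rewrite d0 subn0 => /(_ isT); rewrite nE.
  by rewrite trepP //; apply/allP => _ /mapP[i _ ->]; exact: c_gt0.
have rn : r \in iota 0 n.+1.
  by rewrite mem_iota /= add0n ltnS nE; apply: leq_trans (leq_pmull _ d0) (leq_addl _ _).
have := nt r rn; rewrite nE ltnNge leq_addl addnK /=.
by rewrite trepP //; apply/allP => _ /mapP[i _ ->]; exact: c_gt0.
Qed.

Lemma next_coefficient0 (s : seq 'I_k) n : uniq s -> represents b n ->
  ~~ trepb (map c s) n -> exists i, uniq (rcons s i) /\ 0 < c i <= n.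
Proof.
move=> us hn nt; have [|i [ui _ h]] := @next_coefficient_dvd 0 s n us hn; last by exists i.
by apply/allP => r _; rewrite mul0n subn0 nt orbT.
Qed.

Hypothesis small : forall n, n \in [:: 2; 3; 4; 5; 10; 16; 17; 19; 89] -> represents b n.

Lemma represents_with_113 (s : seq 'I_k) n : uniq s -> map c s = [:: 1; 1; 3] -> n != 8 ->
  represents b n.
Proof.
move=> us sE n8.
(* The form (1,1,3) represents neither 17 nor 17 - 9 = 8. A multiple of 9 would not move n out of
   the class 8 modulo 9, hence the exclusion of these. *)
have [|i [ui ni /andP[l u]]] := @next_coefficient_dvd 9 s 17 us (@small 17 isT).
  by rewrite sE; vm_compute.
have mE : map c (rcons s i) = [:: 1; 1; 3; c i] by rewrite map_rcons sE.
have [->|n89] := eqVneq n 89; first exact: small.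
have [c3|c3] := eqVneq (c i %% 3) 0; last first.
  by apply: (represents_of_trep ui); rewrite mE; exact: trep_113c.
have : [|| c i == 3, c i == 6, c i == 12 | c i == 15] by move: ni; lia.
case/or4P => /eqP ci; rewrite ci in mE.
- by apply: (represents_of_trep ui); rewrite mE; exact: trep_1133.
- by apply: (represents_of_trep ui); rewrite mE; exact: trep_1136.
- have [big|lo] := ltnP 89 n.
    have [|j [uj hj]] := @next_coefficient0 (rcons s i) 89 ui (@small 89 isT).
      by rewrite mE; vm_compute.
    apply: (represents_of_trep uj); rewrite map_rcons mE /=; exact: trep_113_12c.
  apply: (represents_of_trep ui); rewrite mE.
  (* For n <= 89 the equation 8 n + 17 = 9^e leaves only 8 and 89, both set aside. *)
  have [//|[e he]] := trep_113_12 n; exfalso.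
  have e4 : e < 4 by rewrite -(@ltn_exp2l 9) // -he; lia.
  by case: e e4 he => [|[|[|[|//]]]] _ he; rewrite ?expn0 ?expn1 /= in he; lia.
- by apply: (represents_of_trep ui); rewrite mE; exact: trep_113_15.
Qed.

(** The smallest integers missed by (1), (1,1) and (1,2) are 2, 5 and 4; each bounds the next
    coefficient. *)
Lemma represents_unit_coefficient (i1 : 'I_k) n : c i1 = 1 -> n != 8 -> represents b n.
Proof.
move=> e1 n8.
have [|i2 [u12 /andP[l2 u2]]] := @next_coefficient0 [:: i1] 2 isT (@small 2 isT).
  by rewrite /= e1.
have [e2|e2] : c i2 = 1 \/ c i2 = 2 by lia.
  have [|i3 [u123 /andP[l3 u3]]] := @next_coefficient0 [:: i1; i2] 5 u12 (@small 5 isT).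
    by rewrite /= e1 e2.
  have : [|| c i3 == 1, c i3 == 2, c i3 == 3, c i3 == 4 | c i3 == 5] by lia.
  case/or4P => [/eqP e3|/eqP e3|/eqP e3|/orP[]/eqP e3].
  - by apply: (represents_of_trep u123); rewrite /= e1 e2 e3; exact: trep_111.
  - by apply: (represents_of_trep u123); rewrite /= e1 e2 e3; exact: trep_112.
  - by apply: (represents_with_113 u123) => //=; rewrite e1 e2 e3.
  - by apply: (represents_of_trep u123); rewrite /= e1 e2 e3; exact: trep_114.
  - by apply: (represents_of_trep u123); rewrite /= e1 e2 e3; exact: trep_115.
have [|i3 [u123 /andP[l3 u3]]] := @next_coefficient0 [:: i1; i2] 4 u12 (@small 4 isT).
  by rewrite /= e1 e2.
have : [|| c i3 == 1, c i3 == 2, c i3 == 3 | c i3 == 4] by lia.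
case/or4P => /eqP e3.
- have u132 : uniq [:: i1; i3; i2].
    by rewrite (perm_uniq (s2 := [:: i1; i2; i3])) // perm_cons (perm_catC [:: i3] [:: i2]).
  by apply: (represents_of_trep u132); rewrite /= e1 e2 e3; exact: trep_112.
- by apply: (represents_of_trep u123); rewrite /= e1 e2 e3; exact: trep_122.
- by apply: (represents_of_trep u123); rewrite /= e1 e2 e3; exact: trep_123.
- by apply: (represents_of_trep u123); rewrite /= e1 e2 e3; exact: trep_124.
Qed.

Lemma represents_with_223 (s : seq 'I_k) n : uniq s -> map c s = [:: 2; 2; 3] ->
  (forall i, c i != 1) -> trep [:: 2; 3; 4] n -> n != 1 -> represents b n.
Proof.
move=> us sE no1 n234 n1.
have [|i [ui ni /andP[l u]]] := @next_coefficient_dvd 9 s 10 us (@small 10 isT).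
  by rewrite sE; vm_compute.
have mE : map c (rcons s i) = [:: 2; 2; 3; c i] by rewrite map_rcons sE.
(* 16 is missed by (2,2,3,6), and 19 follows 1 on the chain of (2,2,3,3). *)
have [->|n16] := eqVneq n 16; first exact: small.
have [->|n19] := eqVneq n 19; first exact: small.
have [c3|c3] := eqVneq (c i %% 3) 0; last first.
  by apply: (represents_of_trep ui); rewrite mE; exact: trep_223c.
have : (c i == 3) || (c i == 6) by move: ni; lia.
case/orP => /eqP ci; rewrite ci in mE; last first.
  by apply: (represents_of_trep ui); rewrite mE; exact: trep_2236.
have [big|lo] := ltnP 19 n.
  have [|j [uj hj]] := @next_coefficient0 (rcons s i) 19 ui (@small 19 isT).
    by rewrite mE; vm_compute.
  apply: (represents_of_trep uj); rewrite map_rcons mE /=; exact: trep_2233c.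
apply: (represents_of_trep ui); rewrite mE.
have [//|[e he]] := trep_2233 n; exfalso.
have e4 : e < 3 by rewrite -(@ltn_exp2l 9) //; lia.
by case: e e4 he => [|[|[|//]]] _ he; rewrite ?expn0 ?expn1 /= in he; lia.
Qed.

Lemma represents_no_unit_coefficient n : (forall i, c i != 1) -> trep [:: 2; 3; 4] n ->
  n != 1 -> represents b n.
Proof.
move=> no1 n234 n1.
(* Even coefficients give even values only, so 3 forces an odd coefficient of at most 3, and 1 is
   excluded. *)
have [|i3 [u3 d3 /andP[l3 h3]]] := @next_coefficient_dvd 2 [::] 3 isT (@small 3 isT).
  by vm_compute.
have {l3 h3 d3} e3 : c i3 = 3 by move: d3 (no1 i3); lia.
have [|i2 [u32 /andP[l2 h2]]] := @next_coefficient0 [:: i3] 2 u3 (@small 2 isT).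
  by rewrite /= e3.
have {l2 h2} e2 : c i2 = 2 by move: (no1 i2); lia.
have u23 : uniq [:: i2; i3].
  by rewrite (perm_uniq (s2 := [:: i3; i2])) // (perm_catC [:: i2] [:: i3]).
(* Neither 4 nor 4 - 3 is a value of (2,3), so a further coefficient of at most 4 and prime to 3
   occurs: 2 or 4. *)
have [|i4 [u234 d4 /andP[l4 h4]]] := @next_coefficient_dvd 3 [:: i2; i3] 4 u23 (@small 4 isT).
  by rewrite /= e2 e3; vm_compute.
have [e4|e4] : c i4 = 4 \/ c i4 = 2 by move: d4 (no1 i4); lia.
  by apply: (represents_of_trep u234); rewrite /= e2 e3 e4.
have u243 : uniq [:: i2; i4; i3].
  by rewrite (perm_uniq (s2 := [:: i2; i3; i4])) // perm_cons (perm_catC [:: i4] [:: i3]).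
by apply: (represents_with_223 u243) => //=; rewrite e2 e3 e4.
Qed.

Lemma represents_in_S n : in_S n -> represents b n.
Proof.
move=> nS; have n234 := trep_234_of_in_S nS.
have tb := trepP (isT : all (leq 1) [:: 2; 3; 4]) n234.
(* Neither 8 nor 1 is a value of (2,3,4), so S avoids the possible exceptions of the extended
   forms. *)
have n8 : n != 8 by apply/eqP => e; rewrite e in tb.
have n1 : n != 1 by apply/eqP => e; rewrite e in tb.
have [/existsP[i /eqP ci]|/existsPn no1] := boolP [exists i, c i == 1].
  exact: represents_unit_coefficient ci n8.
exact: represents_no_unit_coefficient.
Qed.

End Tuple.

Lemma in_S_critical n : n \in [:: 2; 3; 4; 5; 10; 16; 17; 19; 89] -> in_S n.
Proof.
have key (m x y z : nat) : 0 < m -> (2 * x ^ 2 + 3 * y ^ 2 + 4 * z ^ 2 == 8 * m + 9) -> in_S m.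
  by move=> m0 /eqP h; split=> //; exists (Posz x), (Posz y), (Posz z); lia.
rewrite !inE.
case/predU1P=> [->|]; first exact: (key _ 3 1 1).
case/predU1P=> [->|]; first exact: (key _ 1 3 1).
case/predU1P=> [->|]; first exact: (key _ 1 1 3).
case/predU1P=> [->|]; first exact: (key _ 3 3 1).
case/predU1P=> [->|]; first exact: (key _ 5 1 3).
case/predU1P=> [->|]; first exact: (key _ 7 1 3).
case/predU1P=> [->|]; first exact: (key _ 3 3 5).
by case/predU1P=> [->|/eqP->]; [exact: (key _ 5 5 3) | exact: (key _ 3 3 13)].
Qed.

Theorem theorem1p7 (k : nat) (b : k.-tuple nat) (hb : is_triangular_sum b) :
  (forall n : nat, in_S n -> represents b n) <->
  (forall n : nat, n \in [:: 2; 3; 4; 5; 10; 16; 17; 19; 89] -> represents b n).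
Proof.
split=> h n hn; first by apply: h; exact: in_S_critical.
exact: represents_in_S hn.
Qed.
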